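(* Let $(N_l)_{l\in\mathbb{N}}$ be a strictly increasing sequence of natural numbers and for each $l$ let $x_{1,l}<\dots<x_{N_l,l}$ be real points, all contained in $[-M,M]$ for some $M>0$ independent of $l$. Assume that $\mu^l=\frac{1}{N_l}\sum_{k=1}^{N_l}\delta_{x_{k,l}}$ converges weakly to a probability measure $\mu$ as $l\to\infty$. Let $g_t:D_t\to\mathbb{H}$ be the solution of the Loewner equation $$\dot g_t(z)=M_t(g_t(z)),\qquad g_0(z)=z\in\mathbb{H},$$ where $M_t$ is given by the complex Burgers equation $$\frac{\partial M_t(z)}{\partial t}=-2M_t(z)\frac{\partial M_t(z)}{\partial z},\qquad M_0(z)=\int_{\mathbb{R}}\frac{2\,\mu(du)}{z-u},\qquad z\in\mathbb{H},\ t\ge0.$$ Then the set $K_t=\mathbb{H}\setminus D_t$ is bounded for every $t\ge 0$, and there exists $T>0$ such that for every $t>T$ the boundary $\partial K_t\cap\mathbb{H}$ is an analytic curve in $\mathbb{H}$.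
   Context: $\mathbb{H}=\{z\in\mathbb{C}:\operatorname{Im}z>0\}$, and $\delta_x$ is the Dirac measure at $x$. The solution of the Burgers equation meant is the one of the form $M_t(z)=\int_{\mathbb{R}}\frac{2\,\mu_t(du)}{z-u}$, $z\in\mathbb{H}$, with $(\mu_t)_{t\ge0}$ a family of probability measures on $\mathbb{R}$ and $\mu_0=\mu$. For $z\in\mathbb{H}$ the lifetime $T(z)\in(0,\infty]$ is the time up to which the solution $t\mapsto g_t(z)$ of the Loewner equation exists and stays in $\mathbb{H}$; $D_t=\{z\in\mathbb{H}:T(z)>t\}$ is the domain of $g_t$, which $g_t$ maps conformally onto $\mathbb{H}$, and $K_t=\{z\in\mathbb{H}:T(z)\le t\}$. *)

(* Defs.v *)
From HB Require Import structures.
From mathcomp Require Import all_boot all_order all_algebra.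
From mathcomp Require Import all_classical all_reals all_analysis.
From mathcomp Require Import complex.

Set Implicit Arguments.
Unset Strict Implicit.
Unset Printing Implicit Defensive.

Import Order.TTheory GRing.Theory Num.Theory.
Import numFieldNormedType.Exports.

Local Open Scope classical_set_scope.
Local Open Scope ring_scope.
Local Open Scope complex_scope.

(* The regular module [R[i]^o] carries the topology and the complex
   differential calculus. Its norm, like that of [R[i]], takes values in
   [R[i]]. *)
Notation cplx R := ((complex R)^o).

Definition upper_half_plane {R : realType} : set (cplx R) :=
  [set z | 0 < complex.Im z].

Definition boundary {T : topologicalType} (A : set T) : set T :=
  closure A `\` interior A.

(* Relative to [A], so one-sided at the end points of an interval. *)
Definition has_deriv_within {R : realType} (A : set R) (f : R -> cplx R)
    (t : R) (l : cplx R) : Prop :=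
  ((s - t)^-1%:C * (f s - f t) : cplx R) @[s --> within A (dnbhs t)] --> l.

Definition cintegral {R : realType}
    (mu : {measure set (measurableTypeR R) -> \bar R}) (f : R -> cplx R)
    : cplx R :=
  Complex (\int[mu]_u complex.Re (f u)) (\int[mu]_u complex.Im (f u)).

Definition cauchy_integral {R : realType}
    (mu : {measure set (measurableTypeR R) -> \bar R}) (z : cplx R) : cplx R :=
  cintegral mu (fun u => 2 / (z - u%:C)).

Definition empirical_measure {R : realType} (n : nat) (x : nat -> R)
    : {measure set (measurableTypeR R) -> \bar R} :=
  mscale (n%:R^-1 : R)%:nng
    (msum (fun k => dirac (x k : measurableTypeR R)) n).

Definition weakly_cvg {R : realType}
    (mu_ : nat -> {measure set (measurableTypeR R) -> \bar R})
    (mu : {measure set (measurableTypeR R) -> \bar R}) : Prop :=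
  forall f : R -> R, continuous f -> bounded_fun (f : R -> R^o) ->
    (\int[mu_ n]_u f u) @[n --> \oo] --> \int[mu]_u f u.

(* Only the values at times [t >= 0] and points of the upper half-plane are
   constrained. *)
Definition burgers_solution {R : realType}
    (mu : probability (measurableTypeR R) R) (M : R -> cplx R -> cplx R)
    : Prop :=
  [/\ exists mu_ : R -> probability (measurableTypeR R) R,
        (forall A, measurable A -> mu_ 0 A = mu A) /\
        (forall (t : R) (z : cplx R), 0 <= t -> upper_half_plane z ->
           M t z = cauchy_integral (mu_ t) z),
      forall z, upper_half_plane z -> M 0 z = cauchy_integral mu z
    & forall (t : R) (z : cplx R), 0 <= t -> upper_half_plane z ->
        derivable (M t) z 1 /\
        has_deriv_within `[0, +oo[ (M^~ z) t (- 2 * M t z * derive1 (M t) z)].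

Definition loewner_solution {R : realType} (M : R -> cplx R -> cplx R)
    (z : cplx R) (s : \bar R) (g : R -> cplx R) : Prop :=
  g 0 = z /\
  forall t : R, 0 <= t -> (t%:E < s)%E ->
    upper_half_plane (g t) /\
    has_deriv_within [set u | 0 <= u /\ (u%:E < s)%E] g t (M t (g t)).

Definition lifetime {R : realType} (M : R -> cplx R -> cplx R) (z : cplx R)
    : \bar R :=
  ereal_sup [set s | exists g, loewner_solution M z s g].

Definition loewner_flow {R : realType} (M g : R -> cplx R -> cplx R) : Prop :=
  forall z, upper_half_plane z -> loewner_solution M z (lifetime M z) (g^~ z).

Definition flow_domain {R : realType} (M : R -> cplx R -> cplx R) (t : R)
    : set (cplx R) :=
  [set z | upper_half_plane z /\ (t%:E < lifetime M z)%E].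

Definition hull {R : realType} (M : R -> cplx R -> cplx R) (t : R)
    : set (cplx R) :=
  upper_half_plane `\` flow_domain M t.

Definition real_analytic_on {R : realType} (A : set R) (f : R -> cplx R)
    : Prop :=
  forall s0, A s0 -> exists (a : nat -> cplx R) (r : R), 0 < r /\
    forall s, `|s - s0| < r ->
      series (fun n => a n * ((s - s0) ^+ n)%:C : cplx R) @ \oo --> f s.

(* The image of an open interval under an injective real-analytic map whose
   derivative has no zero. Every open interval is real-analytically
   diffeomorphic to a bounded one. *)
Definition analytic_curve {R : realType} (Gamma : set (cplx R)) : Prop :=
  exists (a b : R) (gamma : R -> cplx R),
    [/\ a < b,
        real_analytic_on `]a, b[ gamma,
        (forall s : R, s \in `]a, b[ ->
           exists2 l : cplx R, l != 0 & has_deriv_within `]a, b[ gamma s l),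
        set_inj `]a, b[ gamma
      & Gamma = gamma @` `]a, b[].

(* Main.v *)
Require Import Defs.
From mathcomp Require Import all_boot all_order all_algebra.
From mathcomp Require Import all_classical all_reals all_analysis.
From mathcomp Require Import measurable_realfun complex.
From mathcomp Require Import ring lra.

Set Implicit Arguments.
Unset Strict Implicit.
Unset Printing Implicit Defensive.

Import Order.TTheory GRing.Theory Num.Theory.
Import numFieldNormedType.Exports.

Local Open Scope classical_set_scope.
Local Open Scope ring_scope.
Local Open Scope complex_scope.

(** Put [M0 z = \int 2 mu(du) / (z - u)], let [F] be the primitive
    [\int 2 log (z - u) mu(du)] of [M0], and set [G_t z = z + 2 t M0 z] and
    [E_t z = F z + t (M0 z)^2]. By Gronwall's inequality [M_t] is constant along
    the characteristics [t |-> G_t z], so [G_t] maps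
    [Omega_t = {z | 0 < Im z, 0 < Im (G_t z)}] bijectively onto the upper
    half-plane [H], and [M_t (G_t z) = M0 z]. In the coordinate [w = G_t z] the
    function [E_t] has derivative [M_t w], whose imaginary part is negative;
    since [H] is convex, [E_t] is injective on [Omega_t].

    Writing [g_t z = G_t zeta_t], the Loewner equation is equivalent to the
    conservation law [E_t zeta_t = F z]. Hence [z] lies in [D_t] if and only if
    [F z = E_t zeta] for some [zeta] in [Omega_t]. By Jensen's inequality
    [t |M0|^2 <= 1] on [Omega_t], so [zeta_t] is large when [z] is; and [zeta_t]
    cannot reach the real axis outside the support of [mu], where [Im E_t] is
    [0] or [2 pi] whereas [0 < Im (F z) < 2 pi]. This bounds the hull.

    For large [t] the closure of [Omega_t] is far from the support of [mu], and
    the same argument gives that the boundary of the hull in [H] is the image of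
    [{zeta | 0 < Im zeta, Im (G_t zeta) = 0}] under [F^-1 \o E_t]. This set is a
    graph over an interval of the real axis, so [G_t] maps it onto an open
    interval, which parametrizes the boundary through the holomorphic function
    [F^-1 \o E_t \o G_t^-1]. Its derivative [M0 zeta / M0 z] has no zero. *)

(** [E_t] comes from a search for a conserved quantity. For fixed [z] one has [d/dt G_t = 2 M0],
    whereas the Loewner equation asks for [d/dt (G_t zeta_t) = M0 zeta_t]; hence
    [G_t' zeta_t' = - M0]. Since [E_t' = M0 G_t'], the motion of [zeta_t] changes [E_t] at the rate
    [- M0^2], and the explicit term [t (M0 z)^2] cancels exactly this.

    The delicate points lie on the boundary of [Omega_t] off the real axis, where the flow dies. Two
    devices reach them. Strict inequalities for the Cauchy kernel keep [G_t] injective and locally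
    invertible up to that boundary. And along a level curve of [E] the value [Im G] decreases in
    time, so that a boundary point at time [t] becomes interior one step earlier. Stepping back
    extends the injectivity of [E_t] to the boundary and, continued down to time [0], produces the
    points [F^-1 (E_t zeta)] of the hull boundary. *)

Local Notation Re := complex.Re.
Local Notation Im := complex.Im.

(** * Modulus of complex numbers *)

Section modulus.
Variable R : realType.
Implicit Types (z w : R[i]).

(* The norm [`|z|] takes values in [R[i]]; [nc] is the same modulus in [R]. *)
Definition nc z : R := Num.sqrt (Re z ^+ 2 + Im z ^+ 2).

Lemma ncE z : `|z| = (nc z)%:C.
Proof. exact: normc_def. Qed.

Lemma nc_ge0 z : 0 <= nc z. Proof. exact: sqrtr_ge0. Qed.

Lemma nc0 : nc 0 = 0.
Proof. by apply: complexI; rewrite -ncE normr0. Qed.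

Lemma nc1 : nc 1 = 1.
Proof. by apply: complexI; rewrite -ncE normr1. Qed.

Lemma nc_eq0 z : (nc z == 0) = (z == 0).
Proof.
rewrite -(normr_eq0 z) ncE; apply/eqP/eqP => [->//|].
by move=> h; apply: complexI.
Qed.

Lemma nc_gt0 z : (0 < nc z) = (z != 0).
Proof. by rewrite lt_def nc_ge0 andbT nc_eq0. Qed.

Lemma ncN z : nc (- z) = nc z.
Proof. by apply: complexI; rewrite -!ncE normrN. Qed.

Lemma ncBC z w : nc (z - w) = nc (w - z).
Proof. by rewrite -ncN opprB. Qed.

Lemma ncM z w : nc (z * w) = nc z * nc w.
Proof. by apply: complexI; rewrite rmorphM /= -!ncE normrM. Qed.

Lemma ncX z n : nc (z ^+ n) = nc z ^+ n.
Proof. by apply: complexI; rewrite rmorphXn /= -!ncE normrX. Qed.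

Lemma ncV z : nc (z^-1) = (nc z)^-1.
Proof.
have [->|z0] := eqVneq z 0; first by rewrite invr0 nc0 invr0.
apply: (mulfI (x := nc z)); first by rewrite nc_eq0.
by rewrite -ncM !mulfV ?nc_eq0 // nc1.
Qed.

Lemma nc_real (x : R) : nc x%:C = `|x|.
Proof. by rewrite /nc /= expr0n addr0 sqrtr_sqr. Qed.

Lemma nc_nat n : nc n%:R = n%:R.
Proof. by rewrite -(rmorph_nat (real_complex R)) /= nc_real normr_nat. Qed.

Lemma ncD z w : nc (z + w) <= nc z + nc w.
Proof. by rewrite -lecR rmorphD /= -!ncE ler_normD. Qed.

Lemma ncB z w : nc (z - w) <= nc z + nc w.
Proof. by rewrite -(ncN w) ncD. Qed.

Lemma nc_distD y z w : nc (z - w) <= nc (z - y) + nc (y - w).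
Proof. by apply: le_trans (ncD _ _); rewrite addrA subrK. Qed.

Lemma nc_subD z w : nc z - nc w <= nc (z - w).
Proof. by rewrite lerBlDr; apply: le_trans (ncD _ _); rewrite subrK. Qed.

Lemma nc_sum n (f : 'I_n -> R[i]) : nc (\sum_(i < n) f i) <= \sum_(i < n) nc (f i).
Proof.
elim/big_ind2 : _ => [|x1 x2 y1 y2 h1 h2|//]; first by rewrite nc0.
by apply: le_trans (ncD _ _) _; rewrite lerD.
Qed.

Lemma nc_sqr z : nc z ^+ 2 = Re z ^+ 2 + Im z ^+ 2.
Proof. by rewrite sqr_sqrtr // addr_ge0 ?sqr_ge0. Qed.

Lemma Re_le_nc z : `|Re z| <= nc z.
Proof. by rewrite -(@ler_sqr R) ?nnegrE ?nc_ge0 // nc_sqr real_normK ?num_real // lerDl sqr_ge0. Qed.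

Lemma Im_le_nc z : `|Im z| <= nc z.
Proof. by rewrite -(@ler_sqr R) ?nnegrE ?nc_ge0 // nc_sqr real_normK ?num_real // lerDr sqr_ge0. Qed.

Lemma nc_le_ReIm z : nc z <= `|Re z| + `|Im z|.
Proof.
rewrite -(@ler_sqr R) ?nnegrE ?nc_ge0 ?addr_ge0 // nc_sqr.
rewrite sqrrD !real_normK ?num_real // -addrA lerD2l lerDr.
by rewrite mulrn_wge0 // mulr_ge0.
Qed.

Lemma reD z w : Re (z + w) = Re z + Re w.
Proof. by case: z w => [a b] [c d]. Qed.
Lemma imD z w : Im (z + w) = Im z + Im w.
Proof. by case: z w => [a b] [c d]. Qed.
Lemma reN z : Re (- z) = - Re z.
Proof. by case: z. Qed.
Lemma imN z : Im (- z) = - Im z.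
Proof. by case: z. Qed.
Lemma reM z w : Re (z * w) = Re z * Re w - Im z * Im w.
Proof. by case: z w => [a b] [c d]. Qed.
Lemma imM z w : Im (z * w) = Re z * Im w + Im z * Re w.
Proof. by case: z w => [a b] [c d]. Qed.
Lemma reC (x : R) : Re x%:C = x. Proof. by []. Qed.
Lemma imC (x : R) : Im x%:C = 0. Proof. by []. Qed.
Lemma reV z : Re z^-1 = Re z / nc z ^+ 2.
Proof. by rewrite nc_sqr; case: z. Qed.
Lemma imV z : Im z^-1 = - Im z / nc z ^+ 2.
Proof. by rewrite nc_sqr; case: z => a b /=; rewrite mulNr. Qed.
Lemma re_nat n : Re (n%:R : R[i]) = n%:R.
Proof. by rewrite -(rmorph_nat (real_complex R)). Qed.
Lemma im_nat n : Im (n%:R : R[i]) = 0.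
Proof. by rewrite -(rmorph_nat (real_complex R)). Qed.
Lemma reB z w : Re (z - w) = Re z - Re w.
Proof. by rewrite reD reN. Qed.
Lemma imB z w : Im (z - w) = Im z - Im w.
Proof. by rewrite imD imN. Qed.
Definition ReImE := (reD, imD, reN, imN, reM, imM, reC, imC, re_nat, im_nat).

Lemma complex_ext z w : Re z = Re w -> Im z = Im w -> z = w.
Proof. by case: z w => [a b] [c d] /= -> ->. Qed.

Lemma half_lt (x : R) : 0 < x -> x / 2 < x.
Proof. by move=> x0; rewrite ltr_pdivrMr // ltr_pMr // ltr1n. Qed.

Lemma pow2_small (K e : R) : 0 < e -> exists k0, forall k, (k0 <= k)%N -> K / 2 ^+ k <= e.
Proof.
move=> e0; exists (Num.bound (`|K| / e)) => k hk.
rewrite ler_pdivrMr ?exprn_gt0 // -ler_pdivrMl // mulrC.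
apply: le_trans (_ : `|K| / e <= _); first by rewrite ler_pM2r ?invr_gt0 // ler_norm.
apply: le_trans (ltW (archi_boundP _)) _; first by rewrite divr_ge0 // ltW.
by rewrite -natrX ler_nat (leq_trans hk) // ltnW // ltn_expl.
Qed.

(** Radii of balls live in [R[i]], where [0 < e] forces [e] to be real; so they may be taken in
    [R]. *)
Lemma nbhs_cplxP (z : cplx R) (A : set (cplx R)) :
  nbhs z A <-> exists2 e : R, 0 < e & forall y : R[i], nc (y - z) < e -> A y.
Proof.
split.
  move/nbhs_ballP => [e /= e0 zA].
  have [a b eab] : exists2 a, 0 < a & e = a%:C.
    case: e e0 {zA} => a b; rewrite ltcE /= => /andP[/eqP -> a0].
    by exists a.
  exists a => // y yz; apply: zA.
  by rewrite -ball_normE /ball_ /= eab ncE ncBC ltcR.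
case=> e e0 zA; apply/nbhs_ballP; exists e%:C => /=; first by rewrite ltcR.
move=> y; rewrite -ball_normE /ball_ /= ncE ltcR ncBC => yz.
exact: zA.
Qed.

Lemma cvg_cplxP (T : Type) (F : set_system T) (FF : Filter F) (f : T -> cplx R) (l : cplx R) :
  f @ F --> l <-> forall e : R, 0 < e -> \forall x \near F, nc (f x - l) < e.
Proof.
split=> [h e e0|h].
  by apply: (h [set y : cplx R | nc (y - l) < e]); apply/nbhs_cplxP; exists e.
move=> A /nbhs_cplxP[e e0 eA]; have := h _ e0.
by apply: filterS => x /eA.
Qed.

(** Bolzano-Weierstrass, from compactness of a square. Arbitrarily late indices replace a
    subsequence, since later arguments test one index at a time. *)
Lemma cluster_bounded (u : nat -> R[i]) (K : R) : (forall n, nc (u n) <= K) ->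
  exists l : R[i], forall e : R, 0 < e -> forall N, exists2 n, (N <= n)%N & nc (u n - l) < e.
Proof.
move=> uK.
pose A : set (R * R) := `[-K, K]%classic `*` `[-K, K]%classic.
have cA : compact A by apply: compact_setX; exact: segment_compact.
pose v n := (Re (u n), Im (u n)).
have vA : (v @ \oo) A.
  exists 0%N => // n _; rewrite /A /= !in_itv /= -!ler_norml.
  by rewrite !(le_trans _ (uK n)) ?Re_le_nc ?Im_le_nc.
have [[a b] [_ ab]] := cA _ _ vA.
exists (a +i* b) => e e0 N.
have h1 : (v @ \oo) [set v n | n in [set n | (N <= n)%N]].
  by exists N => // n /= Nn; exists n.
have e20 : 0 < e / 2 by rewrite divr_gt0.
have h2 : nbhs (a, b) (ball (a, b) (e / 2)) by exact: nbhsx_ballx.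
have [_ [[n /= Nn <-]]] := ab _ _ h1 h2.
rewrite /ball /= /prod_ball /= -!ball_normE /ball_ /= => -[h3 h4].
exists n => //; apply: le_lt_trans (nc_le_ReIm _) _.
rewrite !ReImE /= -(subrK a e) {1}(splitr e).
rewrite distrC in h3; rewrite distrC in h4. 
by rewrite subrK; apply: ltrD.
Qed.

Lemma geometric_cauchy (u : nat -> R[i]) (K : R) :
  (forall n, nc (u n.+1 - u n) <= K / 2 ^+ n) ->
  exists l, forall n, nc (u n - l) <= 2 * K / 2 ^+ n.
Proof.
move=> uK.
(* The subtracted term, the tail of the geometric series, is what lets the induction on [m]
   close. *)
have uD m n : nc (u (n + m)%N - u n) <= 2 * K / 2 ^+ n - 2 * K / 2 ^+ (n + m).
  elim: m => [|m IH]; first by rewrite addn0 !subrr nc0.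
  apply: le_trans (nc_distD (u (n + m)%N) _ _) _.
  rewrite addnS; apply: le_trans (lerD (uK _) IH) _.
  set a := 2 * K / 2 ^+ n; set x : R := 2 ^+ (n + m).
  have x0 : x != 0 by rewrite expf_neq0.
  have -> : 2 * K / 2 ^+ (n + m).+1 = K / x by rewrite exprS -/x; field.
  by rewrite -(mulrA 2 K); lra.
have K0 : 0 <= K by have := le_trans (nc_ge0 _) (uK 0%N); rewrite expr0 divr1.
have bd n : nc (u n) <= nc (u 0%N) + 2 * K.
  rewrite -lerBlDl; apply: le_trans (nc_subD _ _) _.
  have := uD n 0%N; rewrite add0n expr0 divr1 => /le_trans; apply.
  by rewrite gerBl divr_ge0 ?exprn_ge0 // mulr_ge0.
have [l hl] := cluster_bounded bd; exists l => n.
apply/ler_addgt0Pr => e e0.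
have [m nm ml] := hl _ e0 n.
apply: le_trans (nc_distD (u m) _ _) _.
apply: lerD; last exact: ltW.
rewrite ncBC -(subnKC nm); apply: le_trans (uD _ _) _.
by rewrite gerBl divr_ge0 ?exprn_ge0 // mulr_ge0.
Qed.

End modulus.

(** * Derivatives along real and complex variables *)

Section derivatives.
Variable R : realType.
Implicit Types (A : set R) (f g : R -> R[i]) (h : R[i] -> R[i]).

(* Derivatives in increment form, which needs no case distinction at [s = t]. *)
Definition has_rderiv A (f : R -> R) (t d : R) : Prop :=
  forall e, 0 < e -> exists2 dl, 0 < dl & forall s, A s -> `|s - t| < dl ->
    `|f s - f t - (s - t) * d| <= e * `|s - t|.

Definition has_vderiv A f (t : R) (l : R[i]) : Prop :=
  forall e : R, 0 < e -> exists2 dl : R, 0 < dl & forall s, A s -> `|s - t| < dl ->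
    nc (f s - f t - (s - t)%:C * l) <= e * `|s - t|.

Definition has_cderiv h (z l : R[i]) : Prop :=
  forall e : R, 0 < e -> exists2 dl : R, 0 < dl & forall w, nc (w - z) < dl ->
    nc (h w - h z - (w - z) * l) <= e * nc (w - z).

Lemma has_deriv_withinP A f t l : has_deriv_within A f t l <-> has_vderiv A f t l.
Proof.
rewrite /has_deriv_within.
have eqd s : s != t ->
    nc ((s - t)^-1%:C * (f s - f t) - l) * `|s - t| = nc (f s - f t - (s - t)%:C * l).
  move=> st; rewrite -nc_real mulrC -ncM; congr nc.
  rewrite fmorphV mulrBr mulVKf // (inj_eq (@complexI _)) subr_eq0 //.
split.
  move/cvg_cplxP => h e e0; have [dl /= dl0 H] := h _ e0.
  exists dl => // s As st.
  have [->|st0] := eqVneq s t; first by rewrite !subrr mul0r subrr nc0 normr0 mulr0.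
  rewrite -eqd //; apply: ler_wpM2r => //; apply: ltW; apply: H => //.
  by rewrite /ball /= distrC.
move=> h; apply/cvg_cplxP => e e0; have [dl dl0 H] := h _ (divr_gt0 e0 (ltr0Sn _ 1)).
exists dl => //= s; rewrite /ball /= distrC => st st0 As.
have := H s As st; rewrite -eqd // ler_pM2r ?normr_gt0 ?subr_eq0 // => /le_lt_trans; apply.
by rewrite half_lt //.
Qed.

Lemma has_cderiv_derive1 (h : cplx R -> cplx R) z l : has_cderiv h z l -> derive1 h z = l.
Proof.
move=> hz; rewrite derive1E; apply: (cvg_lim (@norm_hausdorff _ _)).
apply/cvg_cplxP => e e0.
have [dl dl0 H] := hz _ (divr_gt0 e0 (ltr0Sn _ 1)).
have : nbhs (0 : cplx R) [set w | nc w < dl].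
  by apply/nbhs_cplxP; exists dl => // y; rewrite subr0.
move=> H0.
have H1 : (0 : cplx R)^' [set w : cplx R | nc w < dl].
  by move: H0; apply: filterS => w wd _.
have H2 : (0 : cplx R)^' [set w : cplx R | w != 0] by rewrite /dnbhs /within /=; apply: nearW.
have HH := filterI H1 H2.
apply: (filterS _ (HH _)) => w [/= wd w0].
have := H (z + w); rewrite addrAC subrr add0r => /(_ wd).
have -> : h (z + w) - h z - w * l = w * (w^-1 *: ((h \o shift z) (w *: 1) - h z) - l).
  rewrite mulrBr /= [w^-1 *: _](_ : _ = w^-1 * (h (w * 1 + z) - h z)) //.
  by rewrite mulr1 mulVKf // (addrC w).
rewrite ncM mulrC ler_pM2r ?nc_gt0 // => /le_lt_trans; apply.
by rewrite half_lt //.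
Qed.


Lemma has_vderiv_subset A A' f t l : A' `<=` A -> has_vderiv A f t l -> has_vderiv A' f t l.
Proof. by move=> AA h e /h[dl dl0 H]; exists dl => // s /AA; exact: H. Qed.

Lemma has_vderiv_lip A f t l : has_vderiv A f t l ->
  exists2 dl, 0 < dl & forall s, A s -> `|s - t| < dl ->
    nc (f s - f t) <= (nc l + 1) * `|s - t|.
Proof.
move=> /(_ 1 ltr01)[dl dl0 H]; exists dl => // s As st.
rewrite -(subrK ((s - t)%:C * l) (f s - f t)); apply: le_trans (ncD _ _) _.
rewrite ncM nc_real [leRHS]mulrDl (mulrC `|s - t|) [leLHS]addrC lerD2l.
exact: H.
Qed.

Lemma has_vderiv_cst A (c : R[i]) t : has_vderiv A (fun=> c) t 0.
Proof.
by move=> e e0; exists 1 => // s _ _; rewrite subrr mulr0 subrr nc0 mulr_ge0 // ltW.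
Qed.

Lemma has_vderiv_id A t : has_vderiv A (real_complex R) t 1.
Proof.
by move=> e e0; exists 1 => // s _ _; rewrite mulr1 rmorphB /= subrr nc0 mulr_ge0 // ltW.
Qed.

Lemma has_vderivD A f g t l m : has_vderiv A f t l -> has_vderiv A g t m ->
  has_vderiv A (fun s => f s + g s) t (l + m).
Proof.
move=> hf hg e e0; have e2 : 0 < e / 2 by rewrite divr_gt0.
have [a a0 ha] := hf _ e2; have [b b0 hb] := hg _ e2.
exists (Num.min a b); first by rewrite lt_min a0.
move=> s As; rewrite lt_min => /andP[sa sb].
have -> : f s + g s - (f t + g t) - (s - t)%:C * (l + m) =
  (f s - f t - (s - t)%:C * l) + (g s - g t - (s - t)%:C * m) by ring.
apply: le_trans (ncD _ _) _; rewrite (splitr e) mulrDl lerD //; [exact: ha|exact: hb].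
Qed.

Lemma has_vderiv_comp A h f t l m : has_cderiv h (f t) l -> has_vderiv A f t m ->
  has_vderiv A (h \o f) t (l * m).
Proof.
move=> hh hf e e0.
have e1 : 0 < e / (2 * (nc m + 1)) by rewrite divr_gt0 // mulr_gt0 // ltr_wpDl // nc_ge0.
have e2 : 0 < e / (2 * (nc l + 1)) by rewrite divr_gt0 // mulr_gt0 // ltr_wpDl // nc_ge0.
have [a a0 ha] := hh _ e1; have [b b0 hb] := hf _ e2.
have [c c0 hc] := has_vderiv_lip hf.
have m0 : 0 < nc m + 1 by rewrite ltr_wpDl // nc_ge0.
have l0 : 0 < nc l + 1 by rewrite ltr_wpDl // nc_ge0.
exists (Num.min (a / (nc m + 1)) (Num.min b c)); first by rewrite !lt_min b0 c0 divr_gt0.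
move=> s As; rewrite !lt_min => /and3P[sa sb sc].
have fst : nc (f s - f t) < a.
  apply: le_lt_trans (hc _ As sc) _.
  by rewrite mulrC -ltr_pdivlMr.
rewrite /=; have -> : h (f s) - h (f t) - (s - t)%:C * (l * m) =
  (h (f s) - h (f t) - (f s - f t) * l) + l * (f s - f t - (s - t)%:C * m) by ring.
apply: le_trans (ncD _ _) _; rewrite ncM.
have h1 := le_trans (ha _ fst) (ler_wpM2l (ltW e1) (hc _ As sc)).
have h2 : nc l * nc (f s - f t - (s - t)%:C * m) <= (nc l + 1) * (e / (2 * (nc l + 1)) * `|s - t|).
  apply: ler_pM; rewrite ?nc_ge0 ?lerDl //; exact: hb.
apply: le_trans (lerD h1 h2) _.
rewrite le_eqVlt; apply/orP; left; apply/eqP.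
have l1 : nc l + 1 != 0 by rewrite gt_eqF.
have m1 : nc m + 1 != 0 by rewrite gt_eqF.
by field; rewrite l1.
Qed.

Lemma has_vderivM A f g t l m : has_vderiv A f t l -> has_vderiv A g t m ->
  has_vderiv A (fun s => f s * g s) t (l * g t + f t * m).
Proof.
move=> hf hg e e0.
have [d d0 hd] := has_vderiv_lip hf; have [d' d'0 hd'] := has_vderiv_lip hg.
pose K := (nc l + 1) * (nc m + 1).
have l0 : 0 < nc l + 1 by rewrite ltr_wpDl // nc_ge0.
have m0 : 0 < nc m + 1 by rewrite ltr_wpDl // nc_ge0.
have F0 : 0 < nc (f t) + 1 by rewrite ltr_wpDl // nc_ge0.
have G0 : 0 < nc (g t) + 1 by rewrite ltr_wpDl // nc_ge0.
have K0 : 0 < K by rewrite mulr_gt0.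
have [a a0 ha] := hf (e / 3 / (nc (g t) + 1)) (divr_gt0 (divr_gt0 e0 (ltr0Sn _ 2)) G0).
have [b b0 hb] := hg (e / 3 / (nc (f t) + 1)) (divr_gt0 (divr_gt0 e0 (ltr0Sn _ 2)) F0).
exists (Num.min (Num.min a b) (Num.min (Num.min d d') (e / 3 / K))).
  by rewrite !lt_min a0 b0 d0 d'0 !divr_gt0.
move=> s As; rewrite !lt_min => /andP[/andP[sa sb] /andP[/andP[sd sd'] sK]].
have -> : f s * g s - f t * g t - (s - t)%:C * (l * g t + f t * m) =
  (f s - f t - (s - t)%:C * l) * g t + (f t * (g s - g t - (s - t)%:C * m))
  + (f s - f t) * (g s - g t) by ring.
apply: le_trans (ncD _ _) _; apply: le_trans (lerD (ncD _ _) (lexx _)) _.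
rewrite !ncM.
have h1 : nc (f s - f t - (s - t)%:C * l) * nc (g t) <= e / 3 * `|s - t|.
  apply: le_trans (ler_wpM2l (nc_ge0 _) (ler_wpDr ler01 (lexx (nc (g t))))) _.
  apply: le_trans (ler_wpM2r (ltW G0) (ha _ As sa)) _.
  by rewrite mulrAC divfK // gt_eqF.
have h2 : nc (f t) * nc (g s - g t - (s - t)%:C * m) <= e / 3 * `|s - t|.
  rewrite mulrC; apply: le_trans (ler_wpM2l (nc_ge0 _) (ler_wpDr ler01 (lexx (nc (f t))))) _.
  apply: le_trans (ler_wpM2r (ltW F0) (hb _ As sb)) _.
  by rewrite mulrAC divfK // gt_eqF.
have h3 : nc (f s - f t) * nc (g s - g t) <= e / 3 * `|s - t|.
  apply: le_trans (ler_pM (nc_ge0 _) (nc_ge0 _) (hd _ As sd) (hd' _ As sd')) _.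
  have -> : (nc l + 1) * `|s - t| * ((nc m + 1) * `|s - t|) = (`|s - t| * K) * `|s - t|.
    by rewrite /K; ring.
  by apply: ler_wpM2r => //; rewrite -ler_pdivlMr // ltW.
by apply: le_trans (lerD (lerD h1 h2) h3) _; lra.
Qed.

Lemma has_rderivC A (f : R -> R) t d :
  has_rderiv A f t d <-> has_vderiv A (fun s => (f s)%:C) t d%:C.
Proof.
by split=> h e /h[dl dl0 H]; exists dl => // s As st; have := H s As st;
  rewrite -!rmorphB -rmorphM -rmorphB /= nc_real.
Qed.

Lemma has_rderiv_Re A f t l : has_vderiv A f t l ->
  has_rderiv A (fun s => Re (f s)) t (Re l).
Proof.
move=> h e /h[dl dl0 H]; exists dl => // s As st; apply: le_trans (H s As st).
by apply: le_trans (Re_le_nc _); rewrite !ReImE mul0r subr0.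
Qed.

Lemma has_rderiv_Im A f t l : has_vderiv A f t l ->
  has_rderiv A (fun s => Im (f s)) t (Im l).
Proof.
move=> h e /h[dl dl0 H]; exists dl => // s As st; apply: le_trans (H s As st).
by apply: le_trans (Im_le_nc _); rewrite !ReImE mul0r addr0.
Qed.

Lemma is_derive_rderiv A (f : R -> R) (t d : R) : is_derive t 1 f d -> has_rderiv A f t d.
Proof.
move=> [df fd] e e0.
have : (fun y : R => y^-1 *: ((f \o shift t) (y *: 1) - f t)) @ 0^' --> d.
  by rewrite -fd; exact: df.
move=> /cvgrPdist_le /(_ e e0)[dl /= dl0 H].
exists dl => // s _ st.
have [->|st0] := eqVneq s t; first by rewrite !subrr mul0r subrr normr0 mulr0.
have s0 : s - t != 0 by rewrite subr_eq0.
have := H (s - t); rewrite /= sub0r normrN => /(_ st s0).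
rewrite [_ *: 1](mulr1 (s - t)) subrK distrC => h.
rewrite -(@ler_pM2r _ `|(s - t)^-1|) ?normr_gt0 ?invr_eq0 // -normrM mulrBl.
rewrite normfV mulfK ?normr_eq0 // [X in _ - X]mulrAC mulfV // mul1r.
by rewrite mulrC.
Qed.

(** Derivatives are one-sided at the end points. For each slope [e > 0], the set [S] of points lying
    under the line of slope [e] through [(a, f a)] contains its supremum, which can be pushed to the
    right unless it is [b]. *)
Lemma has_rderiv_le0 (f : R -> R) (d : R -> R) a b : a <= b ->
  (forall s, a <= s <= b -> has_rderiv `[a, b] f s (d s)) ->
  (forall s, a <= s <= b -> d s <= 0) -> f b <= f a.
Proof.
move=> ab hf hd; apply/ler_addgt0Pr => e' e'0.
pose e := e' / (b - a + 1).
have ba0 : 0 < b - a + 1 by rewrite ltr_wpDl // subr_ge0.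
have e0 : 0 < e by rewrite divr_gt0.
pose S := [set s | a <= s <= b /\ f s <= f a + e * (s - a)].
have Sa : S a by split; rewrite ?lexx //= subrr mulr0 addr0.
have supS : has_sup S by split; [exists a | exists b => s [/andP[]]].
pose c := sup S.
have ac : a <= c by apply: ub_le_sup => //; case: supS.
have cb : c <= b by apply: ge_sup; [exists a|move=> s [/andP[]]].
have cab : a <= c <= b by rewrite ac.
have Sc : f c <= f a + e * (c - a).
  apply/ler_addgt0Pr => n n0.
  have [dl dl0 H] := hf c cab 1 ltr01.
  (* Within distance [m] of [c] the expansion with error [1] gives [f c <= f s + n]. *)
  pose m := Num.min dl (n / (1 + `|d c| + e)).
  have k0 : 0 < 1 + `|d c| + e by rewrite ltr_wpDl // addr_ge0.
  have m0 : 0 < m by rewrite lt_min dl0 divr_gt0.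
  have [s [sab fs] cs] := sup_adherent m0 supS.
  have sc : s <= c by apply: ub_le_sup; [case: supS|].
  have sm : `|s - c| < m by rewrite distrC ger0_norm ?subr_ge0 // ltrBlDr -ltrBlDl.
  move: (sm); rewrite lt_min => /andP[sdl sn].
  have := H s; rewrite /= in_itv /= => /(_ sab sdl).
  rewrite mul1r ltr_pdivlMr // in sn *.
  rewrite ler_norml => /andP[h1 _].
  have : (s - c) * d c <= `|s - c| * `|d c| by rewrite -normrM ler_norm.
  have : (s - c) * d c >= - (`|s - c| * `|d c|) by rewrite -normrM lerNl -normrN ler_norm.
  have : e * (s - a) <= e * (c - a) by rewrite ler_pM2l // lerD2r.
  have : 0 <= `|s - c| * e by rewrite mulr_ge0 // ltW.
  have : `|s - c| = c - s by rewrite distrC ger0_norm // subr_ge0.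
  nra.
have cb' : c = b.
  apply/eqP; rewrite eq_le cb /= leNgt; apply/negP => cltb.
  have [dl dl0 H] := hf c cab e e0.
  pose m := Num.min (dl / 2) (b - c).
  have m0 : 0 < m by rewrite lt_min subr_gt0 cltb divr_gt0.
  have mdl : m < dl.
    by rewrite gt_min half_lt //.
  have mb : c + m <= b by rewrite -lerBrDl ge_min lexx orbT.
  have Scm : S (c + m).
    have am : a <= c + m <= b by rewrite mb (le_trans ac) // lerDl ltW.
    split => //.
    have := H (c + m); rewrite /= in_itv /= addrAC subrr add0r (gtr0_norm m0) => /(_ am mdl).
    rewrite ler_norml => /andP[_].
    have : m * d c <= 0 by rewrite pmulr_rle0 // hd.
    by move: Sc; rewrite !mulrBr !mulrDr; lra.
  have : c + m <= c by apply: ub_le_sup => //; case: supS.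
  by rewrite gerDl leNgt m0.
move: Sc; rewrite cb' => /le_trans; apply; rewrite lerD2l /e mulrAC ler_pdivrMr //.
by rewrite ler_pM2l // lerDl.
Qed.

Lemma has_rderiv_subset A A' (f : R -> R) t d : A' `<=` A -> has_rderiv A f t d -> has_rderiv A' f t d.
Proof. by move=> AA h e /h[dl dl0 H]; exists dl => // s /AA; exact: H. Qed.

(** Strictness is gained on a short initial interval; [has_rderiv_le0] carries it on to [b]. *)
Lemma has_rderiv_lt0 (f : R -> R) (d : R -> R) a b : a < b ->
  (forall s, a <= s <= b -> has_rderiv `[a, b] f s (d s)) ->
  (forall s, a <= s <= b -> d s < 0) -> f b < f a.
Proof.
move=> ab hf hd.
have aab : a <= a <= b by rewrite lexx ltW.
have da0 : 0 < - d a / 2 by rewrite divr_gt0 // oppr_gt0 hd.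
have [dl dl0 H] := hf a aab _ da0.
pose m := Num.min (dl / 2) (b - a).
have m0 : 0 < m by rewrite lt_min subr_gt0 ab divr_gt0.
have mdl : m < dl.
  by rewrite gt_min half_lt //.
have mb : a + m <= b by rewrite -lerBrDl ge_min lexx orbT.
have am : a <= a + m <= b by rewrite mb lerDl ltW.
have fam : f (a + m) < f a.
  have := H (a + m); rewrite /= in_itv /= addrAC subrr add0r (gtr0_norm m0) => /(_ am mdl).
  rewrite ler_norml => /andP[_].
  have : m * d a < 0 by rewrite pmulr_rlt0 // hd.
  by nra.
apply: le_lt_trans fam; apply: (@has_rderiv_le0 f d) => //.
- move=> s /andP[s1 s2]; have sab : a <= s <= b by rewrite s2 (le_trans _ s1) // lerDl ltW.
  apply: has_rderiv_subset (hf s sab) => x /=; rewrite !in_itv /= => /andP[x1 ->].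
  by rewrite (le_trans _ x1) // lerDl ltW.
- by move=> s /andP[s1 s2]; rewrite ltW // hd // s2 (le_trans _ s1) // lerDl ltW.
Qed.

Lemma has_rderivD A (f g : R -> R) t l m : has_rderiv A f t l -> has_rderiv A g t m ->
  has_rderiv A (fun s => f s + g s) t (l + m).
Proof.
move=> /has_rderivC hf /has_rderivC hg; apply/has_rderivC.
have := has_vderivD hf hg; rewrite rmorphD /=.
by under [fun s => _ + _]eq_fun do rewrite -rmorphD.
Qed.

Lemma has_rderivM A (f g : R -> R) t l m : has_rderiv A f t l -> has_rderiv A g t m ->
  has_rderiv A (fun s => f s * g s) t (l * g t + f t * m).
Proof.
move=> /has_rderivC hf /has_rderivC hg; apply/has_rderivC.
have := has_vderivM hf hg; rewrite rmorphD /= !rmorphM /=.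
by under [fun s => _ * _]eq_fun do rewrite -rmorphM.
Qed.

Lemma has_rderiv_cst A (c : R) t : has_rderiv A (fun=> c) t 0.
Proof. by apply/has_rderivC; exact: has_vderiv_cst. Qed.

Lemma has_rderiv_id A (t : R) : has_rderiv A id t 1.
Proof. by apply/has_rderivC; exact: has_vderiv_id. Qed.

(** The factor [2] pays for treating real and imaginary parts separately. *)
Lemma mean_value_nc f (l : R -> R[i]) (K : R) a b : a <= b ->
  (forall s, a <= s <= b -> has_vderiv `[a, b] f s (l s)) ->
  (forall s, a <= s <= b -> nc (l s) <= K) -> nc (f b - f a) <= 2 * K * (b - a).
Proof.
move=> ab hf hl.
have bound (p : R -> R) (q : R -> R) :
  (forall s, a <= s <= b -> has_rderiv `[a, b] p s (q s)) ->
  (forall s, a <= s <= b -> `|q s| <= K) -> `|p b - p a| <= K * (b - a).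
  have up (p' : R -> R) (q' : R -> R) :
    (forall s, a <= s <= b -> has_rderiv `[a, b] p' s (q' s)) ->
    (forall s, a <= s <= b -> `|q' s| <= K) -> p' b - p' a <= K * (b - a).
    move=> hp hq.
    have : p' b + b * (- K) <= p' a + a * (- K).
      apply: (@has_rderiv_le0 (fun s => p' s + s * (- K)) (fun s => q' s + (1 * (- K) + s * 0))) => //.
        move=> s sab; apply: has_rderivD; first exact: hp.
        by apply: (@has_rderivM _ id); [exact: has_rderiv_id|exact: has_rderiv_cst].
      move=> s /hq; rewrite ler_norml => /andP[_]; lra.
    by lra.
  move=> hp hq; rewrite ler_norml; apply/andP; split; last exact: (up p q).
  have : -1 * p b - -1 * p a <= K * (b - a).
    apply: (up (fun s => -1 * p s) (fun s => 0 * p s + -1 * q s)) => s sab.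
      by apply: (@has_rderivM _ (fun=> -1) p); [exact: has_rderiv_cst|exact: hp].
    by rewrite mul0r add0r mulN1r normrN; exact: hq.
  by rewrite !mulN1r; lra.
apply: le_trans (nc_le_ReIm _) _.
rewrite -mulrA mulr2n mulrDl mul1r; apply: lerD; rewrite !ReImE.
  apply: (bound (fun s => Re (f s)) (fun s => Re (l s))).
    by move=> s /hf; exact: has_rderiv_Re.
  by move=> s /hl; apply: le_trans; exact: Re_le_nc.
apply: (bound (fun s => Im (f s)) (fun s => Im (l s))).
  by move=> s /hf; exact: has_rderiv_Im.
by move=> s /hl; apply: le_trans; exact: Im_le_nc.
Qed.

Lemma vderiv0_cst f a b : a <= b ->
  (forall s, a <= s <= b -> has_vderiv `[a, b] f s 0) -> f b = f a.
Proof.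
move=> ab hf; apply/eqP; rewrite -subr_eq0 -nc_eq0 eq_le nc_ge0 andbT.
have := @mean_value_nc f (fun=> 0) 0 a b ab hf.
by rewrite nc0 mulr0 mul0r; apply.
Qed.

End derivatives.

(** * Integrals of bounded functions *)

Section mean.
Variables (R : realType) (P : probability (measurableTypeR R) R).

Definition bounded_meas (f : R -> R) : Prop :=
  measurable_fun [set: measurableTypeR R] (f : measurableTypeR R -> measurableTypeR R)
  /\ exists K, forall u, `|f u| <= K.

Lemma bounded_meas_integrable f : bounded_meas f -> P.-integrable setT (EFin \o f).
Proof.
move=> [mf [K fK]]; apply: measurable_bounded_integrable => //.
  by rewrite ltey_eq fin_num_measure.
exists K; split; first exact: num_real.
by move=> y Ky u _ /=; apply: le_trans (fK u) _; rewrite ltW.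
Qed.

Lemma bounded_meas_cst c : bounded_meas (fun=> c).
Proof. by split; [exact: measurable_cst|exists `|c|]. Qed.

Lemma bounded_measD f g : bounded_meas f -> bounded_meas g -> bounded_meas (fun u => f u + g u).
Proof.
move=> [mf [K fK]] [mg [L gL]]; split; first exact: measurable_funD.
by exists (K + L) => u; apply: le_trans (ler_normD _ _) _; rewrite lerD.
Qed.

Lemma bounded_measM f g : bounded_meas f -> bounded_meas g -> bounded_meas (fun u => f u * g u).
Proof.
move=> [mf [K fK]] [mg [L gL]]; split; first exact: measurable_funM.
by exists (K * L) => u; rewrite normrM ler_pM.
Qed.

Lemma bounded_measN f : bounded_meas f -> bounded_meas (fun u => - f u).
Proof.
move=> [mf [K fK]]; split; first exact: measurable_funN.
by exists K => u; rewrite normrN.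
Qed.

Lemma mean_cst c : \int[P]_u c = c.
Proof.
rewrite Rintegral_cst // -[RHS]mulr1; congr (_ * _).
by rewrite -[RHS]/(fine 1%E); congr fine; exact: probability_setT.
Qed.

Lemma meanD f g : bounded_meas f -> bounded_meas g ->
  \int[P]_u (f u + g u) = \int[P]_u f u + \int[P]_u g u.
Proof. by move=> bf bg; rewrite RintegralD //; exact: bounded_meas_integrable. Qed.

Lemma meanB f g : bounded_meas f -> bounded_meas g ->
  \int[P]_u (f u - g u) = \int[P]_u f u - \int[P]_u g u.
Proof. by move=> bf bg; rewrite RintegralB //; exact: bounded_meas_integrable. Qed.

Lemma meanZ c f : bounded_meas f -> \int[P]_u (c * f u) = c * \int[P]_u f u.
Proof. by move=> bf; rewrite RintegralZl //; exact: bounded_meas_integrable. Qed.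

Lemma eq_mean f g : f =1 g -> \int[P]_u f u = \int[P]_u g u.
Proof. by move=> fg; apply: eq_Rintegral => u _. Qed.

Lemma mean_le f g : bounded_meas f -> bounded_meas g -> (forall u, f u <= g u) ->
  \int[P]_u f u <= \int[P]_u g u.
Proof. by move=> bf bg fg; apply: le_Rintegral => //; exact: bounded_meas_integrable. Qed.

Lemma mean_gt0 f : bounded_meas f -> (forall u, 0 < f u) -> 0 < \int[P]_u f u.
Proof.
move=> bf f0; rewrite lt_def Rintegral_ge0 ?andbT; last by move=> u _; exact: ltW.
apply/eqP => If0.
have If : (\int[P]_u (f u)%:E = 0)%E.
  rewrite -[LHS]fineK; first by rewrite -[fine _]/(\int[P]_u f u) If0.
  by apply: integrable_fin_num => //; exact: bounded_meas_integrable.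
have If' : (\int[P]_u `|(f u)%:E| = 0)%E.
  by rewrite -[RHS]If; apply: eq_integral => u _; rewrite gee0_abs // lee_fin ltW.
have mf : measurable_fun setT (fun u => (f u)%:E) by apply/measurable_EFinP; case: bf.
have /(ae_eq_integral_abs P measurableT mf) [N [mN N0 sN]] := If'.
have NT : N = setT.
  apply/seteqP; split => // u _; apply: sN => /= h.
  have := h Logic.I => -[] fu0.
  by have := f0 u; rewrite fu0 ltxx.
have := @probability_setT _ _ _ P; rewrite -NT N0 => /eqP.
by rewrite eqe eq_sym oner_eq0.
Qed.

Lemma mean_lt f g : bounded_meas f -> bounded_meas g -> (forall u, f u < g u) ->
  \int[P]_u f u < \int[P]_u g u.
Proof.
move=> bf bg fg; rewrite -subr_gt0 -meanB //; apply: mean_gt0.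
  exact: bounded_measD bg (bounded_measN bf).
by move=> u; rewrite subr_gt0.
Qed.

Lemma mean_bound f K : bounded_meas f -> (forall u, `|f u| <= K) -> `|\int[P]_u f u| <= K.
Proof.
move=> bf fK; rewrite ler_norml -[leLHS]mean_cst -[X in _ && (_ <= X)]mean_cst.
apply/andP; split; apply: mean_le => //; try exact: bounded_meas_cst;
  by move=> u; have := fK u; rewrite ler_norml => /andP[].
Qed.

(** Integrate [(f - m)^2 >= 0], where [m] is the mean of [f]. *)
Lemma mean_sqr_le f : bounded_meas f -> (\int[P]_u f u) ^+ 2 <= \int[P]_u (f u ^+ 2).
Proof.
move=> bf; set m := \int[P]_u f u.
have b2 : bounded_meas (fun u => f u ^+ 2).
  by under eq_fun do rewrite expr2; exact: bounded_measM.
have bm : bounded_meas (fun u => 2 * m * f u).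
  by apply: (@bounded_measM (fun=> 2 * m)) => //; exact: bounded_meas_cst.
have : \int[P]_u (2 * m * f u) <= \int[P]_u (f u ^+ 2 + m ^+ 2).
  apply: mean_le => //; first by apply: bounded_measD => //; exact: bounded_meas_cst.
  by move=> u; rewrite -subr_ge0; have := sqr_ge0 (f u - m); nra.
rewrite meanD //; last exact: bounded_meas_cst.
by rewrite mean_cst meanZ // -/m; nra.
Qed.

Definition bounded_cmeas (f : R -> R[i]) : Prop :=
  bounded_meas (fun u => Re (f u)) /\ bounded_meas (fun u => Im (f u)).

Lemma bounded_cmeas_cst c : bounded_cmeas (fun=> c).
Proof. by split; exact: bounded_meas_cst. Qed.

Lemma bounded_cmeasD f g : bounded_cmeas f -> bounded_cmeas g -> bounded_cmeas (fun u => f u + g u).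
Proof.
move=> [bf bf'] [bg bg']; split; under eq_fun do rewrite !ReImE; exact: bounded_measD.
Qed.

Lemma bounded_cmeasN f : bounded_cmeas f -> bounded_cmeas (fun u => - f u).
Proof.
move=> [bf bf']; split; under eq_fun do rewrite !ReImE; exact: bounded_measN.
Qed.

Lemma bounded_cmeasM f g : bounded_cmeas f -> bounded_cmeas g -> bounded_cmeas (fun u => f u * g u).
Proof.
move=> [bf bf'] [bg bg']; split; under eq_fun do rewrite !ReImE.
  by apply: bounded_measD; [|apply: bounded_measN]; exact: bounded_measM.
by apply: bounded_measD; exact: bounded_measM.
Qed.

Lemma eq_cmean f g : f =1 g -> cintegral P f = cintegral P g.
Proof. by move=> /funext ->. Qed.

Lemma cmeanD f g : bounded_cmeas f -> bounded_cmeas g ->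
  cintegral P (fun u => f u + g u) = cintegral P f + cintegral P g.
Proof.
move=> [bf bf'] [bg bg']; apply: complex_ext; rewrite !ReImE /= -meanD //;
 by apply: eq_mean => u; rewrite ReImE.
Qed.

Lemma cmeanZ c f : bounded_cmeas f ->
  cintegral P (fun u => c * f u) = c * cintegral P f.
Proof.
move=> [bf bf'].
have bZ k h : bounded_meas h -> bounded_meas (fun u => k * h u).
  by move=> ?; apply: (@bounded_measM (fun=> k)) => //; exact: bounded_meas_cst.
apply: complex_ext; rewrite !ReImE /= -!meanZ // -?meanD ?meanB //; try exact: bZ;
  by rewrite -?meanB -?meanD //; try exact: bZ; apply: eq_mean => u; rewrite ReImE.
Qed.

Lemma cmeanB f g : bounded_cmeas f -> bounded_cmeas g ->
  cintegral P (fun u => f u - g u) = cintegral P f - cintegral P g.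
Proof.
move=> bf bg; rewrite cmeanD //; last exact: bounded_cmeasN.
by congr (_ + _); rewrite -mulN1r -cmeanZ //; apply: eq_cmean => u; rewrite mulN1r.
Qed.

Lemma cmean_bound f K : bounded_cmeas f -> (forall u, nc (f u) <= K) -> nc (cintegral P f) <= 2 * K.
Proof.
move=> [bf bf'] fK; apply: le_trans (nc_le_ReIm _) _; rewrite mulr2n mulrDl mul1r /=.
by apply: lerD; apply: mean_bound => // u; apply: le_trans (fK u);
  [exact: Re_le_nc|exact: Im_le_nc].
Qed.

Lemma cmean_jensen f : bounded_cmeas f -> nc (cintegral P f) ^+ 2 <= \int[P]_u (nc (f u) ^+ 2).
Proof.
move=> [bf bf']; rewrite nc_sqr /=.
under [X in _ <= X]eq_mean do rewrite nc_sqr.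
have b2 h : bounded_meas h -> bounded_meas (fun u => h u ^+ 2).
  by move=> bh; under eq_fun do rewrite expr2; exact: bounded_measM.
by rewrite meanD; [apply: lerD; exact: mean_sqr_le|exact: b2|exact: b2].
Qed.

End mean.

(** * Cauchy transform *)

Section cauchy_transform.
Variables (R : realType) (P : probability (measurableTypeR R) R).
Variable U : R -> R.
Hypothesis mU : measurable_fun [set: measurableTypeR R] (U : measurableTypeR R -> measurableTypeR R).

(** The Cauchy kernel is composed with [U] to serve two cases: [U] is a truncation to [[-B, B]] for
    the initial measure, whose logarithmic kernel must be bounded in [u], and the identity for the
    measures at later times. *)
Definition ckern (z : R[i]) (u : R) : R[i] := (z - (U u)%:C)^-1.

Definition ctrans (z : R[i]) : R[i] := cintegral P (fun u => 2 * ckern z u).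

Definition ctrans' (z : R[i]) : R[i] := cintegral P (fun u => -2 * ckern z u ^+ 2).

(** Since [Im (ctrans z) = - 2 Im z energy z], the sign of [Im (z + 2 t ctrans z)] is that of
    [1 - 4 t energy z]. *)
Definition energy (z : R[i]) : R := \int[P]_u (nc (ckern z u) ^+ 2).

Lemma sub_real_neq0 (z : R[i]) (v : R) : 0 < Im z -> z - v%:C != 0.
Proof.
move=> z0; apply/eqP => /(congr1 (@complex.Im R)); rewrite !ReImE oppr0 addr0 /= => z1.
by rewrite z1 ltxx in z0.
Qed.

Lemma Im_le_nc_sub (z : R[i]) (v : R) : Im z <= nc (z - v%:C).
Proof.
by apply: le_trans (ler_norm _) _; apply: le_trans (Im_le_nc _); rewrite !ReImE oppr0 addr0.
Qed.

Lemma nc_ckern_le z u eta : 0 < eta -> eta <= Im z -> nc (ckern z u) <= eta^-1.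
Proof.
move=> e0 ez; have z0 := lt_le_trans e0 ez.
rewrite ncV lef_pV2 ?posrE ?nc_gt0 ?sub_real_neq0 //.
exact: le_trans ez (Im_le_nc_sub _ _).
Qed.

Lemma Re_ckern z u : Re (ckern z u) =
  (Re z - U u) / ((Re z - U u) ^+ 2 + Im z ^+ 2).
Proof. by rewrite /ckern reV nc_sqr !ReImE oppr0 addr0. Qed.

Lemma Im_ckern z u : Im (ckern z u) =
  - Im z / ((Re z - U u) ^+ 2 + Im z ^+ 2).
Proof. by rewrite /ckern imV nc_sqr !ReImE oppr0 addr0. Qed.

Lemma nc_ckern_sqr z u : nc (ckern z u) ^+ 2 =
  ((Re z - U u) ^+ 2 + Im z ^+ 2)^-1.
Proof. by rewrite /ckern ncV exprVn nc_sqr !ReImE oppr0 addr0. Qed.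

Lemma bounded_cmeas_ckern z : 0 < Im z -> bounded_cmeas (ckern z).
Proof.
move=> z0.
pose den (v : R) := ((Re z - v) ^+ 2 + Im z ^+ 2)^-1.
have cd : continuous den.
  move=> v; apply: cvgV; first by rewrite gt_eqF // ltr_wpDl ?sqr_ge0 // exprn_gt0.
  apply: cvgD; last exact: cvg_cst.
  rewrite expr2; under eq_fun do rewrite expr2.
  by apply: cvgM; (apply: cvgB; [exact: cvg_cst|exact: cvg_id]).
have md := continuous_measurable_fun cd.
split; split.
- under eq_fun do rewrite Re_ckern.
  apply: measurable_funM; last exact: (measurableT_comp md mU).
  by apply: measurable_funB => //; exact: measurable_cst.
- by exists (Im z)^-1 => u; apply: le_trans (nc_ckern_le _ z0 (lexx _)); exact: Re_le_nc.
- under eq_fun do rewrite Im_ckern.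
  apply: measurable_funM; last exact: (measurableT_comp md mU).
  exact: measurable_cst.
- by exists (Im z)^-1 => u; apply: le_trans (nc_ckern_le _ z0 (lexx _)); exact: Im_le_nc.
Qed.

Lemma bounded_cmeasZ c f : bounded_cmeas f -> bounded_cmeas (fun u => c * f u : R[i]).
Proof. by move=> bf; apply: (@bounded_cmeasM _ (fun=> c)) => //; exact: bounded_cmeas_cst. Qed.

Lemma bounded_cmeas_ckern2 z : 0 < Im z -> bounded_cmeas (fun u => 2 * ckern z u).
Proof. by move=> z0; apply: bounded_cmeasZ; exact: bounded_cmeas_ckern. Qed.

Lemma bounded_cmeas_ckernN2 z : 0 < Im z -> bounded_cmeas (fun u => -2 * ckern z u ^+ 2).
Proof.
move=> z0; apply: bounded_cmeasZ; under eq_fun do rewrite expr2.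
by apply: bounded_cmeasM; exact: bounded_cmeas_ckern.
Qed.

Lemma bounded_meas_nc_ckern z : 0 < Im z -> bounded_meas (fun u => nc (ckern z u) ^+ 2).
Proof.
move=> /bounded_cmeas_ckern [b1 b2]; under eq_fun do rewrite nc_sqr !expr2.
by apply: bounded_measD; exact: bounded_measM.
Qed.

Lemma energy_gt0 z : 0 < Im z -> 0 < energy z.
Proof.
move=> z0; apply: mean_gt0; first exact: bounded_meas_nc_ckern.
by move=> u; rewrite exprn_gt0 // nc_gt0 invr_eq0 sub_real_neq0.
Qed.

Lemma Im_ctrans z : 0 < Im z ->
  Im (ctrans z) = - (2 * Im z * energy z).
Proof.
move=> z0; rewrite /energy -mulNr -meanZ; last exact: bounded_meas_nc_ckern.
apply: eq_mean => u; rewrite !ReImE mul0r addr0 Im_ckern nc_ckern_sqr.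
by rewrite !mulNr mulrN mulrA.
Qed.

Lemma Im_ctrans_lt0 z : 0 < Im z -> Im (ctrans z) < 0.
Proof. by move=> z0; rewrite Im_ctrans // oppr_lt0 !mulr_gt0 // energy_gt0. Qed.

Lemma ctrans_neq0 z : 0 < Im z -> ctrans z != 0.
Proof. by move=> /Im_ctrans_lt0 h; apply/eqP => h0; rewrite h0 ltxx in h. Qed.

Lemma ctrans_jensen z : 0 < Im z -> nc (ctrans z) ^+ 2 <= 4 * energy z.
Proof.
move=> z0; rewrite /ctrans cmeanZ; last exact: bounded_cmeas_ckern.
rewrite ncM nc_nat exprMn (_ : 2 ^+ 2 = 4 :> R); last by rewrite -natrX.
by rewrite ler_pM2l //; apply: cmean_jensen; exact: bounded_cmeas_ckern.
Qed.

Lemma nc_ctrans_le z eta : 0 < eta -> eta <= Im z -> nc (ctrans z) <= 4 / eta.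
Proof.
move=> e0 ez; have z0 := lt_le_trans e0 ez.
apply: le_trans (cmean_bound (K := 2 / eta) _ (bounded_cmeas_ckern2 z0) _) _.
  by move=> u; rewrite ncM nc_nat ler_pM2l //; exact: nc_ckern_le.
lra.
Qed.

Lemma ckern_sub a b u : 0 < Im a -> 0 < Im b ->
  ckern b u - ckern a u = (a - b) * (ckern a u * ckern b u).
Proof.
move=> a0 b0; rewrite /ckern; field.
by rewrite !sub_real_neq0.
Qed.

Lemma ctrans_sub a b : 0 < Im a -> 0 < Im b ->
  ctrans b - ctrans a = (a - b) * cintegral P (fun u => 2 * (ckern a u * ckern b u)).
Proof.
move=> a0 b0; have ka := bounded_cmeas_ckern a0; have kb := bounded_cmeas_ckern b0.
rewrite /ctrans -cmeanB; try exact: bounded_cmeas_ckern2.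
rewrite -cmeanZ; last by apply: bounded_cmeasZ; exact: bounded_cmeasM.
by apply: eq_cmean => u; rewrite -mulrBr ckern_sub // mulrCA.
Qed.

Lemma ctrans_taylor a b eta : 0 < eta -> eta <= Im a -> eta <= Im b ->
  nc (ctrans b - ctrans a - (b - a) * ctrans' a) <= 4 / eta ^+ 3 * nc (b - a) ^+ 2.
Proof.
move=> e0 ea eb; have a0 := lt_le_trans e0 ea; have b0 := lt_le_trans e0 eb.
have ka := bounded_cmeas_ckern a0; have kb := bounded_cmeas_ckern b0.
have kab : bounded_cmeas (fun u => 2 * (ckern a u * ckern a u * ckern b u)).
  by apply: bounded_cmeasZ; do 2 apply: bounded_cmeasM => //.
(* Applying the resolvent identity twice makes the remainder exactly [(b - a)^2] times an integral
   of three kernels. *)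
have -> : ctrans b - ctrans a - (b - a) * ctrans' a =
    (b - a) ^+ 2 * cintegral P (fun u => 2 * (ckern a u * ckern a u * ckern b u)).
  rewrite /ctrans /ctrans' -cmeanB; try exact: bounded_cmeas_ckern2.
  rewrite -cmeanZ; last exact: bounded_cmeas_ckernN2.
  rewrite -cmeanB; first last.
  - by apply: bounded_cmeasZ; exact: bounded_cmeas_ckernN2.
  - by apply: bounded_cmeasD; [|apply: bounded_cmeasN]; exact: bounded_cmeas_ckern2.
  rewrite -cmeanZ //; apply: eq_cmean => u; rewrite /ckern; field.
  by rewrite !sub_real_neq0.
rewrite ncM ncX mulrC; apply: ler_wpM2r; first by rewrite exprn_ge0 // nc_ge0.
apply: le_trans (cmean_bound (K := 2 / eta ^+ 3) _ _ _) _; first exact: kab.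
- move=> u; rewrite !ncM nc_nat ler_pM2l // -exprVn !exprSr expr0 mul1r.
  by apply: ler_pM; rewrite ?mulr_ge0 ?nc_ge0 //; [apply: ler_pM; rewrite ?nc_ge0 //|]; exact: nc_ckern_le.
- lra.
Qed.

Lemma nc_ctrans'_le z eta : 0 < eta -> eta <= Im z -> nc (ctrans' z) <= 4 / eta ^+ 2.
Proof.
move=> e0 ez; have z0 := lt_le_trans e0 ez.
apply: le_trans (cmean_bound (K := 2 / eta ^+ 2) _ (bounded_cmeas_ckernN2 z0) _) _.
  move=> u; rewrite ncM ncN nc_nat ler_pM2l // ncX -exprVn.
  by apply: lerXn2r; rewrite ?nnegrE ?nc_ge0 ?invr_ge0 ?(ltW e0) // nc_ckern_le.
lra.
Qed.

(* [Re (1 / (a b)) < (1/|a|^2 + 1/|b|^2) / 2] strictly, as [a b] is never a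
   positive real for [a], [b] in the upper half-plane. *)
Lemma Re_ckern2_lt a b u : 0 < Im a -> 0 < Im b ->
  Re (2 * (ckern a u * ckern b u)) < nc (ckern a u) ^+ 2 + nc (ckern b u) ^+ 2.
Proof.
move=> a0 b0; rewrite !nc_sqr !ReImE mul0r subr0.
have Ia : Im (ckern a u) < 0.
  by rewrite Im_ckern mulNr oppr_lt0 divr_gt0 // ltr_wpDl ?sqr_ge0 // exprn_gt0.
have Ib : Im (ckern b u) < 0.
  by rewrite Im_ckern mulNr oppr_lt0 divr_gt0 // ltr_wpDl ?sqr_ge0 // exprn_gt0.
set p := Re _; set q := Im _ in Ia *.
set r := Re _; set s := Im _ in Ib *.
have := sqr_ge0 (p - r); have := sqr_ge0 (q + s).
have : 0 < q * s by rewrite nmulr_rgt0.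
nra.
Qed.

(** The strict sign matters: where [4 t energy <= 1] at both points it gives [2 t Re (...) < 1], so
    that the factor [1 - 2 t (...)] in a difference of values of [z + 2 t ctrans z] cannot vanish,
    even in the case of equality. *)
Lemma Re_cmean_ckern2_lt a b : 0 < Im a -> 0 < Im b ->
  Re (cintegral P (fun u => 2 * (ckern a u * ckern b u))) < energy a + energy b.
Proof.
move=> a0 b0; rewrite /energy -meanD; try exact: bounded_meas_nc_ckern.
apply: mean_lt.
- have : bounded_cmeas (fun u => 2 * (ckern a u * ckern b u)).
    by apply: bounded_cmeasZ; apply: bounded_cmeasM; exact: bounded_cmeas_ckern.
  by case.
- by apply: bounded_measD; exact: bounded_meas_nc_ckern.
- by move=> u; exact: Re_ckern2_lt.
Qed.

(** The diagonal case [a = b] of the previous inequality. *)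
Lemma Re_ctrans'_gt a : 0 < Im a -> - (2 * energy a) < Re (ctrans' a).
Proof.
move=> a0.
have -> : ctrans' a = - cintegral P (fun u => 2 * (ckern a u * ckern a u)).
  rewrite -mulN1r -cmeanZ.
    by apply: eq_cmean => u; rewrite mulrA mulN1r expr2.
  by apply: bounded_cmeasZ; apply: bounded_cmeasM; exact: bounded_cmeas_ckern.
by rewrite reN ltrN2 (lt_le_trans (Re_cmean_ckern2_lt _ _)) //; lra.
Qed.

End cauchy_transform.

(** * Logarithmic potential *)

Section log_kernel.
Variable R : realType.

Lemma is_derive_ln_norm (x0 p y0 q s : R) : 0 < (x0 + s * p) ^+ 2 + (y0 + s * q) ^+ 2 ->
  is_derive s (1 : R) (fun s : R => ln ((x0 + s * p) ^+ 2 + (y0 + s * q) ^+ 2))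
    (((x0 + s * p) ^+ 2 + (y0 + s * q) ^+ 2)^-1 *
     (2 * (x0 + s * p) * p + 2 * (y0 + s * q) * q)).
Proof.
move=> h; pose f (s : R) := (x0 + s * p) ^+ 2 + (y0 + s * q) ^+ 2.
have h1 : is_derive s 1 f (2 * (x0 + s * p) * p + 2 * (y0 + s * q) * q).
  by apply: is_derive_eq; rewrite /GRing.scale /=; ring.
have h2 := is_derive1_ln h.
exact: (@is_derive1_comp R (@ln R) f s _ _ h2 h1).
Qed.

Lemma is_derive_atan_quotient (x0 p y0 q s : R) : 0 < y0 + s * q ->
  is_derive s (1 : R) (fun s : R => atan ((x0 + s * p) / (y0 + s * q)))
    ((1 + ((x0 + s * p) / (y0 + s * q)) ^+ 2)^-1 *
     ((p * (y0 + s * q) - q * (x0 + s * p)) / (y0 + s * q) ^+ 2)).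
Proof.
move=> h; have h0 : y0 + s * q != 0 by rewrite gt_eqF.
pose f (s : R) := (x0 + s * p) / (y0 + s * q).
have h1 : is_derive s 1 f ((p * (y0 + s * q) - q * (x0 + s * p)) / (y0 + s * q) ^+ 2).
  have h3 : is_derive s 1 (fun s : R => y0 + s * q) q.
    by apply: is_derive_eq; rewrite /GRing.scale /=; ring.
  have h2 := @is_deriveV R (fun s : R => y0 + s * q) s q 1 h0 h3.
  by apply: is_derive_eq; rewrite /GRing.scale /=; field.
exact: (@is_derive1_comp R (@atan R) f s _ _ (is_derive1_atan _) h1).
Qed.

Lemma has_vderiv_ReIm (A : set R) (f : R -> R[i]) t l :
  has_rderiv A (fun s => Re (f s)) t (Re l) ->
  has_rderiv A (fun s => Im (f s)) t (Im l) -> has_vderiv A f t l.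
Proof.
move=> hr hi e e0; have e2 : 0 < e / 2 by rewrite divr_gt0.
have [a a0 ha] := hr _ e2; have [b b0 hb] := hi _ e2.
exists (Num.min a b); first by rewrite lt_min a0.
move=> s As; rewrite lt_min => /andP[sa sb].
apply: le_trans (nc_le_ReIm _) _; rewrite !ReImE !mul0r subr0 addr0.
by rewrite [leRHS](_ : _ = e / 2 * `|s - t| + e / 2 * `|s - t|);
  [apply: lerD; [exact: ha|exact: hb]|lra].
Qed.

Lemma atan_pihalf (e : R) : 0 < e -> exists2 Q, 0 < Q & forall q, Q <= q -> pi / 2 - e <= atan q.
Proof.
(* The cap keeps [pi / 2 - e'] inside [(0, pi / 2)], where [tan] is positive and inverted by
   [atan]. *)
move=> e0; pose e' := Num.min e (pi / 4).
have p4 : 0 < pi / 4 :> R by rewrite divr_gt0 // pi_gt0.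
have e'0 : 0 < e' by rewrite lt_min e0.
have e'1 : e' <= pi / 4 by rewrite ge_min lexx orbT.
have e'e : e' <= e by rewrite ge_min lexx.
have hin : pi / 2 - e' \in `](-(pi / 2)), (pi / 2)[.
  by rewrite in_itv /=; apply/andP; split; lra.
exists (tan (pi / 2 - e')).
  rewrite -tan0 ltr_tan //; last by rewrite in_itv /=; apply/andP; split; lra.
  lra.
by move=> q /le_atan; rewrite tanK //; lra.
Qed.

End log_kernel.

Section potential.
Variables (R : realType) (P : probability (measurableTypeR R) R).
Variables (U : R -> R) (B : R).
Hypothesis mU : measurable_fun [set: measurableTypeR R] (U : measurableTypeR R -> measurableTypeR R).
Hypothesis UB : forall u, `|U u| <= B.

(* [2 log (z - U u)] with the branch of argument in [(0, pi)]. *)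
Definition lkern (z : R[i]) (u : R) : R[i] :=
  ln ((Re z - U u) ^+ 2 + Im z ^+ 2)
  +i* (pi - 2 * atan ((Re z - U u) / Im z)).

Definition cpot (z : R[i]) : R[i] := cintegral P (lkern z).

Lemma nc_sub_sqr z u : (Re z - U u) ^+ 2 + Im z ^+ 2 = nc (z - (U u)%:C) ^+ 2.
Proof. by rewrite nc_sqr !ReImE oppr0 addr0. Qed.

Lemma bound_ge0 : 0 <= B. Proof. exact: le_trans (UB 0). Qed.

Lemma nc_sub_le z u : nc (z - (U u)%:C) <= nc z + B.
Proof. by apply: le_trans (ncB _ _) _; rewrite lerD2l nc_real. Qed.

Lemma nc_sub_ge z u : nc z - B <= nc (z - (U u)%:C).
Proof. by apply: le_trans (nc_subD _ _); rewrite lerD2l lerN2 nc_real. Qed.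

Lemma has_vderiv_lkern (a d : R[i]) (u s : R) A : 0 < Im (a + s%:C * d) ->
  has_vderiv A (fun s => lkern (a + s%:C * d) u) s (d * (2 * ckern U (a + s%:C * d) u)).
Proof.
move=> h0.
have E1 t : Re (a + t%:C * d) - U u = (Re a - U u) + t * Re d.
  by rewrite !ReImE mul0r subr0 addrAC.
have E2 t : Im (a + t%:C * d) = Im a + t * Im d.
  by rewrite !ReImE mul0r addr0.
have y0 : 0 < Im a + s * Im d by rewrite -E2.
set X := Re a - U u + s * Re d in E1 *.
set Y := Im a + s * Im d in y0 E2 *.
have XY : 0 < X ^+ 2 + Y ^+ 2 by rewrite ltr_wpDl ?sqr_ge0 // exprn_gt0.
have XY0 : X ^+ 2 + Y ^+ 2 != 0 by rewrite gt_eqF.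
have Y0 : Y != 0 by rewrite gt_eqF.
apply: has_vderiv_ReIm.
  rewrite /=; under eq_fun do rewrite E1 E2.
  rewrite reM reM imM !Re_ckern !Im_ckern !E1 E2 -/X -/Y !(re_nat,im_nat).
  have := is_derive_rderiv A (is_derive_ln_norm XY); rewrite -/X -/Y.
  congr (has_rderiv _ _ _ _); by field.
rewrite /=; under eq_fun do rewrite E1 E2.
rewrite imM reM imM !Re_ckern !Im_ckern !E1 E2 -/X -/Y !(re_nat,im_nat).
have := has_rderivD (has_rderiv_cst A (pi : R) s) (has_rderivM (has_rderiv_cst A (- 2 : R) s)
  (is_derive_rderiv A (is_derive_atan_quotient (Re a - U u) (Re d) y0))).
rewrite -/X -/Y.
have -> : (fun s0 : R => pi + -2 * atan ((Re a - U u + s0 * Re d) /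
    (Im a + s0 * Im d))) = (fun s0 : R => pi - 2 * atan ((Re a - U u + s0 * Re d) /
    (Im a + s0 * Im d))) by apply/funext => t; rewrite mulNr.
congr (has_rderiv _ _ _ _); field.
by rewrite ?Y0 ?XY0 /= ?(addrC (Y ^+ 2)) ?XY0 ?Y0.
Qed.

Lemma lkern_taylor a b u eta : 0 < eta -> eta <= Im a -> eta <= Im b ->
  nc (lkern b u - lkern a u - (b - a) * (2 * ckern U a u)) <= 4 / eta ^+ 2 * nc (b - a) ^+ 2.
Proof.
move=> e0 ea eb; set d := b - a.
have adb : a + d = b by rewrite /d addrC subrK.
have Im_seg s : 0 <= s <= 1 -> eta <= Im (a + s%:C * d).
  move=> /andP[s0 s1]; rewrite !ReImE mul0r addr0.
  have : s * eta <= s * Im b by rewrite ler_wpM2l.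
  have : (1 - s) * eta <= (1 - s) * Im a by rewrite ler_wpM2l // subr_ge0.
  lra.
(* With the linear part removed, the derivative along the segment is a difference of two Cauchy
   kernels, which is again of order [nc d]. *)
pose f s := lkern (a + s%:C * d) u - s%:C * (d * (2 * ckern U a u)).
have -> : lkern b u - lkern a u - d * (2 * ckern U a u) = f 1 - f 0.
  rewrite /f (_ : 1%:C = 1) // (_ : 0%:C = 0) // !mul1r !mul0r addr0 subr0.
  by rewrite adb addrAC.
pose l s := d * (2 * ckern U (a + s%:C * d) u) + (-1 * (d * (2 * ckern U a u)) + (- s%:C) * 0).
have e2 : 0 <= 2 / eta ^+ 2 * nc d ^+ 2.
  by rewrite mulr_ge0 ?exprn_ge0 ?nc_ge0 ?divr_ge0 ?exprn_ge0 // ltW.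
apply: le_trans (mean_value_nc (l := l) (K := 2 / eta ^+ 2 * nc d ^+ 2) ler01 _ _) _; last first.
- by rewrite subr0 mulr1 !mulrA -natrM.
- move=> s s01; have es := Im_seg s s01.
  have -> : l s = 2 * d * (ckern U (a + s%:C * d) u - ckern U a u) by rewrite /l; ring.
  rewrite ckern_sub ?(lt_le_trans e0) // opprD addrA subrr add0r.
  rewrite !ncM ncN ncM !nc_nat nc_real ger0_norm; last by case/andP: s01.
  have k1 := nc_ckern_le U u e0 ea; have k2 := nc_ckern_le U u e0 es.
  have k3 : nc (ckern U a u) * nc (ckern U (a + s%:C * d) u) <= (eta ^+ 2)^-1.
    by rewrite -exprVn expr2; apply: ler_pM; rewrite ?nc_ge0.
  have -> : 2 / eta ^+ 2 * nc d ^+ 2 = 2 * nc d * (nc d * (eta ^+ 2)^-1) by ring.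
  apply: ler_wpM2l; first by rewrite mulr_ge0 ?nc_ge0.
  apply: ler_pM; rewrite ?mulr_ge0 ?nc_ge0 //; first by case/andP: s01.
  by rewrite ler_piMl ?nc_ge0 //; case/andP: s01.
- move=> s s01; have es := Im_seg s s01.
  apply: has_vderivD; first by apply: has_vderiv_lkern; rewrite (lt_le_trans e0).
  have := has_vderivM (has_vderiv_id `[0, 1] s) (has_vderiv_cst `[0, 1] (-1 * (d * (2 * ckern U a u))) s).
  have -> : (fun s0 : R => s0%:C * (-1 * (d * (2 * ckern U a u)))) =
      (fun s0 => - (s0%:C * (d * (2 * ckern U a u)))).
    by apply/funext => t; ring.
  by rewrite !mulr0 mul1r.
Qed.

Lemma bounded_cmeas_lkern z : 0 < Im z -> bounded_cmeas (lkern z).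
Proof.
move=> z0.
have msub : measurable_fun [set: measurableTypeR R]
    ((fun u => Re z - U u) : measurableTypeR R -> measurableTypeR R).
  by apply: measurable_funB => //; exact: measurable_cst.
have lo u : Im z ^+ 2 <= (Re z - U u) ^+ 2 + Im z ^+ 2 by rewrite lerDr sqr_ge0.
have y2 : 0 < Im z ^+ 2 by rewrite exprn_gt0.
have hi u : (Re z - U u) ^+ 2 + Im z ^+ 2 <= (nc z + B) ^+ 2.
  rewrite nc_sub_sqr; apply: lerXn2r; rewrite ?nnegrE ?nc_ge0 ?addr_ge0 ?nc_ge0 ?bound_ge0 //.
  exact: nc_sub_le.
split; split.
- have mg : measurable_fun [set: measurableTypeR R]
      ((fun u => (Re z - U u) ^+ 2 + Im z ^+ 2) : measurableTypeR R -> measurableTypeR R).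
    by apply: measurable_funD; [exact: measurable_funX|exact: measurable_cst].
  exact: (measurableT_comp (@measurable_ln R) mg).
- exists (`|ln (Im z ^+ 2)| + `|ln ((nc z + B) ^+ 2)|) => u /=.
  have p1 : 0 < (Re z - U u) ^+ 2 + Im z ^+ 2 by apply: lt_le_trans (lo u).
  have p2 : 0 < (nc z + B) ^+ 2 by apply: lt_le_trans (hi u).
  have := lo u; rewrite -ler_ln ?posrE // => h1.
  have := hi u; rewrite -ler_ln ?posrE // => h2.
  have := ler_norm (ln ((nc z + B) ^+ 2)); have := ler_norm (- ln (Im z ^+ 2)); rewrite normrN => h3 h4.
  have := normr_ge0 (ln ((nc z + B) ^+ 2)); have := normr_ge0 (ln (Im z ^+ 2)) => h5 h6.
  rewrite ler_norml; apply/andP; split; lra.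
- rewrite /=; apply: measurable_funB; first exact: measurable_cst.
  apply: measurable_funM; first exact: measurable_cst.
  have mg : measurable_fun [set: measurableTypeR R]
      ((fun u => (Re z - U u) / Im z) : measurableTypeR R -> measurableTypeR R).
    by apply: measurable_funM => //; exact: measurable_cst.
  exact: (measurableT_comp (continuous_measurable_fun (@continuous_atan R)) mg).
- exists (2 * pi) => u /=.
  have := atan_gtNpi2 ((Re z - U u) / Im z).
  have := atan_ltpi2 ((Re z - U u) / Im z).
  have := pi_gt0 R.
  rewrite ler_norml => h1 h2 h3; apply/andP; split; lra.
Qed.

Lemma cpot_taylor a b eta : 0 < eta -> eta <= Im a -> eta <= Im b ->
  nc (cpot b - cpot a - (b - a) * ctrans P U a) <= 8 / eta ^+ 2 * nc (b - a) ^+ 2.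
Proof.
move=> e0 ea eb; have a0 := lt_le_trans e0 ea; have b0 := lt_le_trans e0 eb.
have ba := bounded_cmeas_lkern a0; have bb := bounded_cmeas_lkern b0.
have bk := bounded_cmeas_ckern2 mU a0.
have bk' : bounded_cmeas (fun u => (b - a) * (2 * ckern U a u)) by exact: bounded_cmeasZ.
have bd : bounded_cmeas (fun u => lkern b u - lkern a u).
  exact: bounded_cmeasD bb (bounded_cmeasN ba).
have -> : cpot b - cpot a - (b - a) * ctrans P U a =
    cintegral P (fun u => lkern b u - lkern a u - (b - a) * (2 * ckern U a u)).
  by rewrite /cpot /ctrans (cmeanB P bd bk') (cmeanB P bb ba) (cmeanZ P _ bk).
apply: le_trans (cmean_bound (K := 4 / eta ^+ 2 * nc (b - a) ^+ 2) P _ _) _.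
- exact: bounded_cmeasD bd (bounded_cmeasN bk').
- by move=> u; exact: lkern_taylor.
- by rewrite !mulrA -natrM.
Qed.

Lemma Re_cpot_le z : 0 < Im z -> Re (cpot z) <= ln ((nc z + B) ^+ 2).
Proof.
move=> z0; rewrite -(mean_cst P (ln ((nc z + B) ^+ 2))); apply: mean_le.
- by case: (bounded_cmeas_lkern z0).
- exact: bounded_meas_cst.
move=> u; rewrite /= nc_sub_sqr.
have p1 : 0 < nc (z - (U u)%:C) by rewrite nc_gt0 sub_real_neq0.
have p2 := lt_le_trans p1 (nc_sub_le z u).
by rewrite ler_ln ?posrE ?exprn_gt0 // lerXn2r ?nnegrE ?(ltW p1) ?(ltW p2) // nc_sub_le.
Qed.

Lemma Re_cpot_ge z : 0 < Im z -> B < nc z -> ln ((nc z - B) ^+ 2) <= Re (cpot z).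
Proof.
move=> z0 zB; rewrite -(mean_cst P (ln ((nc z - B) ^+ 2))); apply: mean_le.
- exact: bounded_meas_cst.
- by case: (bounded_cmeas_lkern z0).
move=> u; rewrite /= nc_sub_sqr.
have p1 : 0 < nc z - B by rewrite subr_gt0.
have p2 := lt_le_trans p1 (nc_sub_ge z u).
by rewrite ler_ln ?posrE ?exprn_gt0 // lerXn2r ?nnegrE ?(ltW p1) ?(ltW p2) // nc_sub_ge.
Qed.

Lemma Im_cpot_gt0 z : 0 < Im z -> 0 < Im (cpot z).
Proof.
move=> z0; apply: mean_gt0; first by case: (bounded_cmeas_lkern z0).
by move=> u /=; have := atan_ltpi2 ((Re z - U u) / Im z); lra.
Qed.

Lemma Im_cpot_lt2pi z : 0 < Im z -> Im (cpot z) < 2 * pi.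
Proof.
move=> z0; rewrite -(mean_cst P (2 * pi)); apply: mean_lt.
- by case: (bounded_cmeas_lkern z0).
- exact: bounded_meas_cst.
by move=> u /=; have := atan_gtNpi2 ((Re z - U u) / Im z); lra.
Qed.

Lemma U_bounds u : -B <= U u <= B. Proof. by rewrite -ler_norml. Qed.

(** To the right of the support the argument of [z - U u] tends to [0] as [Im z] does. The gap of
    [1] between [B] and [Re z] makes this uniform in [u]. *)
Lemma Im_cpot_right e : 0 < e -> exists2 dl, 0 < dl & forall z, 0 < Im z ->
  Im z < dl -> B + 1 <= Re z -> Im (cpot z) <= e.
Proof.
move=> e0; have [Q Q0 HQ] := atan_pihalf (divr_gt0 e0 (ltr0Sn _ 1)).
exists Q^-1; rewrite ?invr_gt0 // => z z0 zQ zB.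
rewrite -(mean_cst P e); apply: mean_le.
- by case: (bounded_cmeas_lkern z0).
- exact: bounded_meas_cst.
move=> u /=.
have /HQ : Q <= (Re z - U u) / Im z; last by lra.
rewrite ler_pdivlMr //; have /andP[_ h] := U_bounds u.
have : Q * Im z <= 1 by rewrite -ler_pdivlMl // mulr1 ltW.
lra.
Qed.

Lemma Im_cpot_left e : 0 < e -> exists2 dl, 0 < dl & forall z, 0 < Im z ->
  Im z < dl -> Re z <= - (B + 1) -> 2 * pi - e <= Im (cpot z).
Proof.
move=> e0; have [Q Q0 HQ] := atan_pihalf (divr_gt0 e0 (ltr0Sn _ 1)).
exists Q^-1; rewrite ?invr_gt0 // => z z0 zQ zB.
rewrite -(mean_cst P (2 * pi - e)); apply: mean_le.
- exact: bounded_meas_cst.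
- by case: (bounded_cmeas_lkern z0).
move=> u /=.
have /HQ : Q <= - ((Re z - U u) / Im z); last by rewrite atanN; lra.
rewrite -mulNr ler_pdivlMr //; have /andP[h _] := U_bounds u.
have : Q * Im z <= 1 by rewrite -ler_pdivlMl // mulr1 ltW.
lra.
Qed.

Lemma energy_le z : 0 < Im z -> B < nc z -> energy P U z <= (nc z - B) ^- 2.
Proof.
move=> z0 zB; rewrite -(mean_cst P ((nc z - B) ^- 2)); apply: mean_le.
- exact: bounded_meas_nc_ckern.
- exact: bounded_meas_cst.
move=> u; have p1 : 0 < nc z - B by rewrite subr_gt0.
have p2 := lt_le_trans p1 (nc_sub_ge z u).
rewrite /ckern ncV exprVn lef_pV2 ?posrE ?exprn_gt0 //.
by rewrite lerXn2r ?nnegrE ?(ltW p1) ?(ltW p2) // nc_sub_ge.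
Qed.

Lemma energy_ge z : 0 < Im z -> (nc z + B) ^- 2 <= energy P U z.
Proof.
move=> z0; rewrite -(mean_cst P ((nc z + B) ^- 2)); apply: mean_le.
- exact: bounded_meas_cst.
- exact: bounded_meas_nc_ckern.
move=> u; have p1 : 0 < nc (z - (U u)%:C) by rewrite nc_gt0 sub_real_neq0.
have p2 := lt_le_trans p1 (nc_sub_le z u).
rewrite /ckern ncV exprVn lef_pV2 ?posrE ?exprn_gt0 //.
by rewrite lerXn2r ?nnegrE ?(ltW p1) ?(ltW p2) // nc_sub_le.
Qed.

End potential.

(** * Local inverses of holomorphic functions *)

Section local_inverse.
Variable R : realType.
Implicit Types (f g h : R[i] -> R[i]) (a b c d l y z : R[i]).

(* Newton's iteration with frozen slope [d]. *)
Lemma solve_near f c d y (rho : R) : d != 0 ->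
  (forall a b, nc (a - c) <= rho -> nc (b - c) <= rho ->
     nc (f b - f a - (b - a) * d) <= nc d / 2 * nc (b - a)) ->
  2 * nc (y - f c) <= nc d * rho ->
  exists2 x, nc (x - c) <= 2 * nc (y - f c) / nc d & f x = y.
Proof.
move=> d0 fd yrho; have nd0 : 0 < nc d by rewrite nc_gt0.
pose x := fix x n := if n is n.+1 then x n - (f (x n) - y) / d else c.
have xS n : x n.+1 = x n - (f (x n) - y) / d by [].
pose D := nc (y - f c) / nc d.
have D0 : 0 <= D by rewrite divr_ge0 ?nc_ge0.
have Drho : 2 * D <= rho by rewrite /D mulrA ler_pdivrMr // (mulrC rho).
(* The steps halve and their total stays below [2 * D <= rho], so that the iteration never leaves
   the disc where [fd] holds. *)
have key n : nc (x n.+1 - x n) <= D / 2 ^+ n /\ nc (x n.+1 - c) <= 2 * D - D / 2 ^+ n.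
  elim: n => [|n [IH1 IH2]].
    rewrite xS /= expr0 divr1 addrAC subrr add0r ncN ncM ncV ncBC -/D.
    by split => //; lra.
  have D2 : 0 <= D / 2 ^+ n by rewrite divr_ge0 ?exprn_ge0.
  have D3 : D / 2 ^+ n.+1 = D / 2 ^+ n / 2 by rewrite exprSr invfM mulrA.
  have xn : nc (x n - c) <= rho.
    case: n IH1 IH2 D2 D3 => [|n] IH1 IH2 D2 D3.
      by rewrite /= subrr nc0; lra.
    apply: le_trans (nc_distD (x n.+2) _ _) _; rewrite ncBC.
    apply: le_trans (lerD IH1 IH2) _; lra.
  have h1 : nc (x n.+2 - x n.+1) <= D / 2 ^+ n.+1.
    have -> : x n.+2 - x n.+1 = - (f (x n.+1) - f (x n) - (x n.+1 - x n) * d) / d.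
      have E : x n.+1 - x n = - (f (x n) - y) / d by rewrite xS addrAC subrr add0r mulNr.
      by rewrite E [x n.+2]xS; field.
    rewrite ncM ncN ncV ler_pdivrMr //; apply: le_trans (fd _ _ _ _) _ => //.
      by apply: le_trans IH2 _; lra.
    rewrite D3 mulrAC [leRHS]mulrAC ler_pM2r //.
    by rewrite mulrC; apply: ler_wpM2r; rewrite ?nc_ge0.
  split => //; apply: le_trans (nc_distD (x n.+1) _ _) _.
  apply: le_trans (lerD h1 IH2) _; lra.
have [l hl] : exists l, forall n, nc (x n - l) <= 2 * D / 2 ^+ n.
  by apply: geometric_cauchy => n; case: (key n).
have lc : nc (l - c) <= 2 * D by have := hl 0%N; rewrite expr0 divr1 ncBC.
exists l; first by rewrite -mulrA.
have xr n : nc (x n - c) <= rho.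
  case: n => [|n]; first by rewrite /= subrr nc0; lra.
  by have [_ h] := key n; apply: le_trans h _; have : 0 <= D / 2 ^+ n; [rewrite divr_ge0 ?exprn_ge0|lra].
apply/eqP; rewrite -subr_eq0 -nc_eq0 eq_le nc_ge0 andbT.
apply/ler_addgt0Pr => e e0; rewrite add0r.
have K0 : 0 < 4 * (D + 1) * nc d by rewrite !mulr_gt0 // ltr_wpDl.
have [n /(_ n (leqnn n)) hn] := pow2_small (4 * (D + 1) * nc d) e0.
apply: le_trans hn.
have -> : f l - y = (f l - f (x n) - (l - x n) * d) + (l - x n) * d - (x n.+1 - x n) * d.
  by rewrite xS; field.
apply: le_trans (ncB _ _) _; apply: le_trans (lerD (ncD _ _) (lexx _)) _.
rewrite !ncM.
have h1 := fd _ _ (xr n) (le_trans lc Drho).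
have h2 := hl n; rewrite ncBC in h2; have [h3 _] := key n.
have h4 : nc (l - x n) * nc d <= 2 * D / 2 ^+ n * nc d by rewrite ler_pM2r.
have h5 : nc (x n.+1 - x n) * nc d <= D / 2 ^+ n * nc d by rewrite ler_pM2r.
have h6 : nc d / 2 * nc (l - x n) <= D / 2 ^+ n * nc d.
  have -> : D / 2 ^+ n * nc d = nc d / 2 * (2 * D / 2 ^+ n) by field; rewrite expf_neq0.
  by rewrite ler_pM2l // divr_gt0.
apply: le_trans (lerD (lerD (le_trans h1 h6) h4) h5) _.
have -> : 4 * (D + 1) * nc d / 2 ^+ n = 4 * D / 2 ^+ n * nc d + 4 * nc d / 2 ^+ n.
  by field; rewrite expf_neq0.
have : 0 <= 4 * nc d / 2 ^+ n by rewrite divr_ge0 ?exprn_ge0 ?mulr_ge0 ?nc_ge0.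
rewrite -!(mulrA _ D); lra.
Qed.

(* Complex differentiability near [c] with a locally uniform quadratic Taylor
   remainder: stable under composition and inversion, and sufficient for a
   power series expansion. *)
Definition qdiff f c l : Prop :=
  exists f' : R[i] -> R[i], f' c = l /\
  exists (rho L : R), [/\ 0 < rho, 0 <= L & forall a b, nc (a - c) < rho -> nc (b - c) < rho ->
    nc (f b - f a - (b - a) * f' a) <= L * nc (b - a) ^+ 2].

(** The expansions at [a] and at [b] add up to [(f' b - f' a) * (b - a)]. *)
Lemma taylor_lip f (f' : R[i] -> R[i]) c (rho L : R) : 0 <= L ->
  (forall a b, nc (a - c) < rho -> nc (b - c) < rho ->
    nc (f b - f a - (b - a) * f' a) <= L * nc (b - a) ^+ 2) ->
  forall a b, nc (a - c) < rho -> nc (b - c) < rho -> nc (f' b - f' a) <= 2 * L * nc (b - a).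
Proof.
move=> L0 hf a b ha hb.
have [->|ab] := eqVneq b a; first by rewrite !subrr nc0 mulr0.
have ba0 : 0 < nc (b - a) by rewrite nc_gt0 subr_eq0.
rewrite -(ler_pM2r ba0) -ncM.
have -> : (f' b - f' a) * (b - a) =
   (f a - f b - (a - b) * f' b) + (f b - f a - (b - a) * f' a) by ring.
apply: le_trans (ncD _ _) _.
apply: le_trans (lerD (hf _ _ hb ha) (hf _ _ ha hb)) _.
by rewrite (ncBC a b); lra.
Qed.

(** Strict differentiability: both points move, as [solve_near] and the Lipschitz bounds require. *)
Lemma qdiff_strict f c l : qdiff f c l -> forall e, 0 < e -> exists2 rho, 0 < rho &
  forall a b, nc (a - c) <= rho -> nc (b - c) <= rho ->
    nc (f b - f a - (b - a) * l) <= e * nc (b - a).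
Proof.
move=> [f' [<- [r [L [r0 L0 hf]]]]] e e0.
pose rho := Num.min (r / 2) (e / (4 * (L + 1))).
have L1 : 0 < 4 * (L + 1) by rewrite mulr_gt0 // ltr_wpDl.
have rho0 : 0 < rho by rewrite lt_min !divr_gt0.
have rhor : rho < r by rewrite gt_min half_lt //.
have rhoe : rho * (4 * (L + 1)) <= e by rewrite -ler_pdivlMr // ge_min lexx orbT.
exists rho => // a b ha hb.
have ha' := le_lt_trans ha rhor; have hb' := le_lt_trans hb rhor.
have hc : nc (c - c) < r by rewrite subrr nc0.
have -> : f b - f a - (b - a) * f' c = (f b - f a - (b - a) * f' a) + (b - a) * (f' a - f' c) by ring.
apply: le_trans (ncD _ _) _; rewrite ncM.
have h1 := hf _ _ ha' hb'; have h2 := taylor_lip L0 hf hc ha'.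
have h3 : nc (b - a) <= 2 * rho.
  by apply: le_trans (nc_distD c _ _) _; rewrite (ncBC c a); lra.
have h4 : nc (b - a) * nc (f' a - f' c) <= nc (b - a) * (2 * L * rho).
  by apply: ler_wpM2l; rewrite ?nc_ge0 //; apply: le_trans h2 _; apply: ler_wpM2l; rewrite ?mulr_ge0.
have h5 : L * nc (b - a) ^+ 2 <= nc (b - a) * (2 * L * rho).
  have -> : L * nc (b - a) ^+ 2 = nc (b - a) * (L * nc (b - a)) by ring.
  by apply: ler_wpM2l; rewrite ?nc_ge0 // -mulrA mulrCA; apply: ler_wpM2l.
apply: le_trans (lerD h1 h4) _; apply: le_trans (lerD h5 (lexx _)) _.
rewrite -mulrDr mulrC; apply: ler_wpM2r; rewrite ?nc_ge0 //.
by apply: le_trans rhoe; have : 0 <= rho := ltW rho0; nra.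
Qed.

Lemma qdiff_cderiv f c l : qdiff f c l -> has_cderiv f c l.
Proof.
move=> hf e e0; have [rho rho0 H] := qdiff_strict hf e0.
exists rho => // w wc; apply: H; last exact: ltW.
by rewrite subrr nc0 ltW.
Qed.

Lemma qdiff_lip f c l : qdiff f c l -> exists rho K, [/\ 0 < rho, 0 < K & forall a b,
  nc (a - c) <= rho -> nc (b - c) <= rho -> nc (f b - f a) <= K * nc (b - a)].
Proof.
move=> /qdiff_strict /(_ _ ltr01)[rho rho0 H]; exists rho, (nc l + 1); split => //.
  by rewrite ltr_wpDl ?nc_ge0.
move=> a b ha hb; rewrite -(subrK ((b - a) * l) (f b - f a)).
apply: le_trans (ncD _ _) _; rewrite ncM [leRHS]mulrDl [leLHS]addrC (mulrC (nc (b - a))) lerD2l.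
exact: H.
Qed.

Lemma qdiff_eq f g c l (rho : R) : 0 < rho -> (forall z, nc (z - c) < rho -> f z = g z) ->
  qdiff f c l -> qdiff g c l.
Proof.
move=> rho0 fg [f' [f'c [r [L [r0 L0 H]]]]]; exists f'; split => //.
exists (Num.min r rho), L; split => //; first by rewrite lt_min r0.
move=> a b; rewrite !lt_min => /andP[a1 a2] /andP[b1 b2].
by rewrite -!fg //; exact: H.
Qed.

Lemma qdiffD f g c l m : qdiff f c l -> qdiff g c m -> qdiff (fun z => f z + g z) c (l + m).
Proof.
move=> [f' [<- [r [L [r0 L0 H]]]]] [g' [<- [r' [L' [r'0 L'0 H']]]]].
exists (fun z => f' z + g' z); split => //.
exists (Num.min r r'), (L + L'); split; rewrite ?lt_min ?r0 ?addr_ge0 //.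
move=> a b; rewrite !lt_min => /andP[a1 a2] /andP[b1 b2].
have -> : f b + g b - (f a + g a) - (b - a) * (f' a + g' a) =
  (f b - f a - (b - a) * f' a) + (g b - g a - (b - a) * g' a) by ring.
apply: le_trans (ncD _ _) _; rewrite [leRHS]mulrDl.
by apply: lerD; [exact: H|exact: H'].
Qed.

Lemma qdiff_id c : qdiff id c 1.
Proof.
exists (fun=> 1); split => //; exists 1, 0; split => // a b _ _.
by rewrite mulr1 subrr nc0 mul0r.
Qed.

Lemma qdiffZ k f c l : qdiff f c l -> qdiff (fun z => k * f z) c (k * l).
Proof.
move=> [f' [<- [r [L [r0 L0 H]]]]]; exists (fun z => k * f' z); split => //.
exists r, (nc k * L); split; rewrite ?mulr_ge0 ?nc_ge0 //.
move=> a b ha hb; have -> : k * f b - k * f a - (b - a) * (k * f' a) =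
  k * (f b - f a - (b - a) * f' a) by ring.
by rewrite ncM -mulrA; apply: ler_wpM2l; rewrite ?nc_ge0 // H.
Qed.

Lemma qdiff_comp f g c l m : qdiff f c l -> qdiff g (f c) m -> qdiff (g \o f) c (m * l).
Proof.
move=> hf hg; have [r1 [K [r10 K0 Kf]]] := qdiff_lip hf.
case: hf => f' [<- [r [L [r0 L0 H]]]]; case: hg => g' [<- [r' [L' [r'0 L'0 H']]]].
pose rho := Num.min (Num.min r r1) (r' / K).
have rho0 : 0 < rho by rewrite !lt_min r0 r10 divr_gt0.
(* A bound for [g'] on the whole disc of radius [r'], by [taylor_lip]. *)
pose G := nc (g' (f c)) + 2 * L' * r'.
have G0 : 0 <= G by rewrite addr_ge0 ?mulr_ge0 ?nc_ge0 // ltW.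
exists (fun z => g' (f z) * f' z); split => //.
exists rho, (L' * K ^+ 2 + G * L); split => //.
  by rewrite addr_ge0 ?mulr_ge0 ?exprn_ge0 // ltW.
have fin a : nc (a - c) < rho -> nc (f a - f c) < r'.
  rewrite !lt_min => /andP[/andP[_ a1] a2].
  have : nc (f a - f c) <= K * nc (a - c) by apply: Kf; rewrite ?subrr ?nc0 ltW.
  by move=> /le_lt_trans; apply; rewrite mulrC -ltr_pdivlMr.
move=> a b ha hb; have fa := fin _ ha; have fb := fin _ hb.
move: ha hb; rewrite !lt_min => /andP[/andP[a0 a1] a2] /andP[/andP[b0 b1] b2].
have -> : (g \o f) b - (g \o f) a - (b - a) * (g' (f a) * f' a) =
  (g (f b) - g (f a) - (f b - f a) * g' (f a)) + g' (f a) * (f b - f a - (b - a) * f' a).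
  by rewrite /=; ring.
apply: le_trans (ncD _ _) _; rewrite ncM [leRHS]mulrDl; apply: lerD.
  apply: le_trans (H' _ _ fa fb) _; rewrite -mulrA; apply: ler_wpM2l => //.
  rewrite -exprMn; apply: lerXn2r; rewrite ?nnegrE ?mulr_ge0 ?nc_ge0 ?(ltW K0) //.
  by apply: Kf; exact: ltW.
rewrite -mulrA; apply: ler_pM; rewrite ?nc_ge0 //; last exact: H.
rewrite -(subrK (g' (f c)) (g' (f a))); apply: le_trans (ncD _ _) _; rewrite [leLHS]addrC /G lerD2l.
have hc : nc (f c - f c) < r' by rewrite subrr nc0.
apply: le_trans (taylor_lip L'0 H' hc fa) _.
by apply: ler_wpM2l; rewrite ?mulr_ge0 // ltW.
Qed.

Lemma qdiff_sqr c : qdiff (fun z => z ^+ 2) c (2 * c).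
Proof.
exists (fun z => 2 * z); split => //; exists 1, 1; split => // a b _ _.
have -> : b ^+ 2 - a ^+ 2 - (b - a) * (2 * a) = (b - a) ^+ 2 by ring.
by rewrite ncX mul1r.
Qed.

(** [h] selects the solutions given by [solve_near], with default [c] outside their range. By [inj]
    it is Lipschitz, and its quadratic remainder is that of [f] divided by [f']. *)
Lemma qdiff_inverse f c l : l != 0 -> qdiff f c l -> exists h, [/\ h (f c) = c,
  qdiff h (f c) l^-1 & exists2 s, 0 < s & forall y, nc (y - f c) < s -> f (h y) = y].
Proof.
move=> l0 hf; have nl0 : 0 < nc l by rewrite nc_gt0.
have [r1 r10 H1] := qdiff_strict hf (divr_gt0 nl0 (ltr0Sn _ 1)).
case: hf => f' [f'c [r [L [r0 L0 H]]]].
(* The last bound keeps [nc (f' a)] above [nc l / 2] on the disc; the [+ 1] covers [L = 0]. *)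
pose rho := Num.min (Num.min (r / 2) r1) (nc l / (4 * (L + 1))).
have L1 : 0 < 4 * (L + 1) by rewrite mulr_gt0 // ltr_wpDl.
have rho0 : 0 < rho by rewrite !lt_min r10 !divr_gt0.
have rhor1 : rho <= r1 by rewrite !ge_min lexx orbT.
have rhor : rho < r by rewrite !gt_min half_lt //.
have rhol : rho * (4 * (L + 1)) <= nc l by rewrite -ler_pdivlMr // ge_min lexx orbT.
pose s := nc l * rho / 2.
have s0 : 0 < s by rewrite divr_gt0 // mulr_gt0.
have sol y : exists x, nc (y - f c) < s -> nc (x - c) <= rho /\ f x = y.
  have [ys|ys] := ltP (nc (y - f c)) s; last by exists c.
  have ys2 : 2 * nc (y - f c) <= nc l * rho by rewrite mulrC -ler_pdivlMr // ltW.
  have [x xc xy] := @solve_near f c l y rho l0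
    (fun a b ha hb => H1 a b (le_trans ha rhor1) (le_trans hb rhor1)) ys2.
  exists x => _; split => //; apply: le_trans xc _.
  by rewrite ler_pdivrMr // (mulrC rho).
have [h hh] := choice sol.
have inj a b : nc (a - c) <= rho -> nc (b - c) <= rho -> nc (b - a) <= 2 / nc l * nc (f b - f a).
  move=> ha hb; have := H1 a b (le_trans ha rhor1) (le_trans hb rhor1).
  have : nc ((b - a) * l) - nc (f b - f a) <= nc (f b - f a - (b - a) * l).
    by rewrite (ncBC (f b - f a)); exact: nc_subD.
  rewrite ncM => h1 h2; rewrite mulrAC ler_pdivlMr //; nra.
have fcs : nc (f c - f c) < s by rewrite subrr nc0.
have hc : h (f c) = c.
  have [h1 h2] := hh _ fcs.
  have := inj _ _ h1 (_ : nc (c - c) <= rho); rewrite h2 !subrr !nc0 mulr0 => /(_ (ltW rho0)).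
  by move=> h3; apply/eqP; rewrite eq_sym -subr_eq0 -nc_eq0 eq_le nc_ge0 h3.
exists h; split => //; last by exists s => // y /hh[].
have f'lb a : nc (a - c) <= rho -> nc l / 2 <= nc (f' a).
  move=> ha; have hcc : nc (c - c) < r by rewrite subrr nc0.
  have := taylor_lip L0 H hcc (le_lt_trans ha rhor); rewrite f'c => h1.
  have h2 : nc l - nc (f' a) <= nc (f' a - l) by rewrite ncBC; exact: nc_subD.
  have h3 : 2 * L * nc (a - c) <= 2 * L * rho by apply: ler_wpM2l; rewrite ?mulr_ge0.
  have : 0 <= rho by exact: ltW.
  nra.
exists (fun y => (f' (h y))^-1); rewrite hc f'c; split => //.
exists s, (8 * L / nc l ^+ 3); split => //.
  by rewrite divr_ge0 ?mulr_ge0 ?exprn_ge0 ?nc_ge0.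
move=> y y' /hh[hy1 hy2] /hh[hy'1 hy'2].
set a := h y in hy1 hy2 *; set b := h y' in hy'1 hy'2 *.
have fa := f'lb _ hy1.
have fa0 : 0 < nc (f' a) by apply: lt_le_trans fa; rewrite divr_gt0.
have fan0 : f' a != 0 by rewrite -nc_gt0.
have -> : b - a - (y' - y) / f' a = - (f b - f a - (b - a) * f' a) / f' a.
  by rewrite hy2 hy'2; field.
rewrite ncM ncN ncV ler_pdivrMr //.
apply: le_trans (H _ _ (le_lt_trans hy1 rhor) (le_lt_trans hy'1 rhor)) _.
have h1 := inj _ _ hy1 hy'1; rewrite hy2 hy'2 in h1.
have h2 : nc (b - a) ^+ 2 <= (2 / nc l * nc (y' - y)) ^+ 2.
  by apply: lerXn2r => //; rewrite nnegrE ?nc_ge0 // mulr_ge0 ?divr_ge0 ?nc_ge0.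
apply: le_trans (ler_wpM2l L0 h2) _.
have -> : L * (2 / nc l * nc (y' - y)) ^+ 2 = 8 * L / nc l ^+ 3 * nc (y' - y) ^+ 2 * (nc l / 2).
  by field; rewrite gt_eqF.
by apply: ler_wpM2l => //; rewrite !mulr_ge0 ?invr_ge0 ?exprn_ge0 ?nc_ge0.
Qed.

End local_inverse.

(** * Power series expansions *)

Section cis.
Variable R : realType.

Definition cis (x : R) : R[i] := cos x +i* sin x.

Lemma cisD x y : cis (x + y) = cis x * cis y.
Proof.
apply: complex_ext; rewrite !ReImE /= ?cosD ?sinD //.
by rewrite addrC.
Qed.

Lemma cis0 : cis 0 = 1.
Proof. by rewrite /cis cos0 sin0. Qed.

Lemma cisX x n : cis x ^+ n = cis (x *+ n).
Proof.
elim: n => [|n IH]; first by rewrite expr0 mulr0n cis0.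
by rewrite exprS IH mulrS cisD.
Qed.

Lemma nc_cis x : nc (cis x) = 1.
Proof. by rewrite /nc /cis /= cos2Dsin2 sqrtr1. Qed.

Lemma cis2pi : cis (2 * pi) = 1.
Proof. by rewrite mulr_natl /cis -[pi *+ 2]add0r cosD2pi sinD2pi cos0 sin0. Qed.

(** [cos x = 1 - 2 sin (x / 2)^2], and [x / 2] lies in [(0, pi)]. *)
Lemma cis_neq1 x : 0 < x < 2 * pi -> cis x != 1.
Proof.
move=> /andP[x0 x2]; apply/eqP => /(congr1 (@complex.Re R)) /=.
rewrite (splitr x) cosD; have := cos2Dsin2 (x / 2).
have : 0 < sin (x / 2) by apply: sin_gt0_pi; apply/andP; split; lra.
nra.
Qed.

Lemma has_vderiv_cis A x : has_vderiv A cis x (- sin x +i* cos x).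
Proof.
apply: has_vderiv_ReIm => /=.
  exact: (is_derive_rderiv A (is_derive_cos x)).
exact: (is_derive_rderiv A (is_derive_sin x)).
Qed.

Lemma nc_cis_sub1 x : 0 <= x -> nc (cis x - 1) <= 2 * x.
Proof.
move=> x0; rewrite -cis0.
have := mean_value_nc (K := 1) x0 (fun s _ => has_vderiv_cis `[0, x] s).
rewrite mulr1 subr0; apply => s _.
by rewrite /nc /= sqrrN addrC cos2Dsin2 sqrtr1.
Qed.

End cis.

(** * Interpolation at dyadic roots of unity, converging to a power series *)

Section analytic.
Variable R : realType.

(** The orders are powers of two so that the nodes of level [k] are every other node of level
    [k.+1]. *)
Definition uroot (k : nat) : R[i] := cis (2 * pi / 2 ^+ k).

Lemma urootX k : uroot k ^+ (2 ^ k) = 1.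
Proof.
rewrite cisX -[_ *+ _]mulr_natr natrX divfK ?cis2pi //.
Qed.

Lemma uroot_sqr k : uroot k.+1 ^+ 2 = uroot k.
Proof.
rewrite cisX; congr cis; rewrite exprS invfM -mulr_natr.
by field.
Qed.

Lemma nc_uroot k : nc (uroot k) = 1. Proof. exact: nc_cis. Qed.

Lemma nc_uroot_sub1 k : nc (uroot k - 1) <= 4 * pi / 2 ^+ k.
Proof.
apply: le_trans (nc_cis_sub1 _) _; last by rewrite !mulrA -natrM.
by rewrite divr_ge0 ?exprn_ge0 // mulr_ge0 // pi_ge0.
Qed.

Lemma uroot_sum k n : (0 < n < 2 ^ k)%N -> \sum_(j < 2 ^ k) (uroot k ^+ j) ^- n = 0.
Proof.
move=> /andP[n0 nk].
have w1 : uroot k ^+ n != 1.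
  rewrite cisX; apply: cis_neq1; rewrite -[_ *+ n]mulr_natr.
  have p0 := pi_gt0 R; have k0 : 0 < 2 ^+ k :> R by rewrite exprn_gt0.
  rewrite pmulr_lgt0 ?ltr0n // divr_gt0 ?mulr_gt0 //=.
  rewrite mulrAC ltr_pdivrMr // ltr_pM2l ?mulr_gt0 //.
  by rewrite -natrX ltr_nat.
have w1' : (uroot k ^- n) - 1 != 0.
  by rewrite subr_eq0 -invr1 (inj_eq invr_inj).
under eq_bigr => j _ do rewrite exprAC -exprVn.
apply: (mulfI w1'); rewrite mulr0 -subrX1 exprVn exprAC urootX expr1n invr1 subrr //.
Qed.

Variables (f f' : R[i] -> R[i]) (r L : R).
Hypotheses (r0 : 0 < r) (L0 : 0 <= L).
Hypothesis fL : forall a b, nc a <= r -> nc b <= r ->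
  nc (f b - f a - (b - a) * f' a) <= L * nc (b - a) ^+ 2.

Let node k j : R[i] := r%:C * uroot k ^+ j.

Let nc_node k j : nc (node k j) = r.
Proof. by rewrite ncM ncX nc_uroot expr1n mulr1 nc_real gtr0_norm. Qed.

Let node_neq0 k j : node k j != 0.
Proof. by rewrite -nc_gt0 nc_node. Qed.

Let nodeX k j : node k j ^+ (2 ^ k) = r%:C ^+ (2 ^ k).
Proof. by rewrite exprMn exprAC urootX expr1n mulr1. Qed.

Let nodeS k j : node k j.+1 - node k j = node k j * (uroot k - 1).
Proof. by rewrite /node exprSr; ring. Qed.

(* Coefficients of the polynomial of degree [< 2^k] interpolating [f] at the
   nodes. *)
Let coef k n : R[i] := (2 ^ k)%:R^-1 * \sum_(j < 2 ^ k) f (node k j) * node k j ^- n.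

Let pol k w : R[i] := \sum_(n < 2 ^ k) coef k n * w ^+ n.

(* A Riemann sum of Cauchy's integral over the circle contracted towards [w] by
   the factor [s]: nearly independent of [s], equal to a multiple of [f w] at
   [s = 0] and of [pol k w] at [s = 1]. *)
Let path k w s : R[i] := (2 ^ k)%:R^-1 *
  \sum_(j < 2 ^ k) f (w + s%:C * (node k j - w)) * (node k j / (node k j - w)).

Let path' k w s : R[i] := (2 ^ k)%:R^-1 *
  \sum_(j < 2 ^ k) f' (w + s%:C * (node k j - w)) * node k j.

Lemma has_vderiv_sum (A : set R) t n (h : 'I_n -> R -> R[i]) (l : 'I_n -> R[i]) :
  (forall i, has_vderiv A (h i) t (l i)) ->
  has_vderiv A (fun s => \sum_(i < n) h i s) t (\sum_(i < n) l i).
Proof.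
elim: n h l => [|n IH] h l hl.
  under eq_fun do rewrite big_ord0.
  by rewrite big_ord0; exact: has_vderiv_cst.
under eq_fun do rewrite big_ord_recr.
by rewrite big_ord_recr; apply: has_vderivD; [exact: IH|exact: hl].
Qed.

Let N0 k : (2 ^ k)%:R != 0 :> R[i].
Proof. by rewrite pnatr_eq0 expn_eq0. Qed.

Let node_sub k j w : nc w < r -> node k j - w != 0.
Proof.
move=> wr; rewrite subr_eq0; apply/eqP => h.
by move: wr; rewrite -h nc_node ltxx.
Qed.

Let seg_r k j w s : nc w < r -> 0 <= s <= 1 -> nc (w + s%:C * (node k j - w)) <= r.
Proof.
move=> wr /andP[s0 s1].
have -> : w + s%:C * (node k j - w) = (1 - s)%:C * w + s%:C * node k j.
  by rewrite rmorphB rmorph1; ring.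
apply: le_trans (ncD _ _) _; rewrite (ncM _ w) (ncM _ (node k j)) !nc_real nc_node !ger0_norm ?subr_ge0 //.
have : (1 - s) * nc w <= (1 - s) * r by apply: ler_wpM2l; rewrite ?subr_ge0 // ltW.
lra.
Qed.

Let path_deriv k w s : nc w < r -> 0 <= s <= 1 -> has_vderiv `[0, 1] (path k w) s (path' k w s).
Proof.
move=> wr s01; rewrite /path /path'.
have -> : forall c X, c * X =
    0 * (\sum_(j < 2 ^ k) f (w + s%:C * (node k j - w)) * (node k j / (node k j - w))) + c * X :> R[i].
  by move=> c X; rewrite mul0r add0r.
apply: (has_vderivM (has_vderiv_cst _ _ _)); apply: has_vderiv_sum => j.
move=> e e0.
have d0 := node_sub k j wr; set d := node k j - w in d0 *.
have nd0 : 0 < nc d by rewrite nc_gt0.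
pose K := L * nc d ^+ 2 * nc (node k j / d).
have K0 : 0 <= K by rewrite !mulr_ge0 ?exprn_ge0 ?nc_ge0.
exists (e / (K + 1)); first by rewrite divr_gt0 // ltr_wpDl.
move=> t /=; rewrite in_itv /= => t01 ts.
set a := w + s%:C * d; set b := w + t%:C * d.
have ba : b - a = (t - s)%:C * d by rewrite /a /b rmorphB; ring.
have -> : f b * (node k j / d) - f a * (node k j / d) - (t - s)%:C * (f' a * node k j) =
   (f b - f a - (b - a) * f' a) * (node k j / d) by rewrite ba; field.
rewrite ncM; apply: le_trans (ler_wpM2r (nc_ge0 _) (fL (seg_r k j wr s01) (seg_r k j wr t01))) _.
rewrite -/d -/a -/b ba ncM nc_real exprMn.
have -> : L * (`|t - s| ^+ 2 * nc d ^+ 2) * nc (node k j / d) = (K * `|t - s|) * `|t - s|.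
  by rewrite /K; ring.
apply: ler_wpM2r => //; rewrite mulrC.
apply: le_trans (_ : `|t - s| * (K + 1) <= _); first by apply: ler_wpM2l => //; rewrite lerDl.
by rewrite -ler_pdivlMr ?ltW // ltr_wpDl.
Qed.

(** The contracted nodes form a closed polygon, around which the increments of [f] telescope to [0].
    The sum of [f'] times the steps thus reduces to Taylor remainders, quadratic in the step. *)
Let path'_le k w s : (0 < k)%N -> nc w < r -> 0 <= s <= 1 ->
  nc (path' k w s) <= L * r ^+ 2 * nc (uroot k - 1).
Proof.
move=> k0 wr s01; have /andP[s0 s1] := s01.
have k1 : (1 < 2 ^ k)%N by rewrite -[1%N]/(2 ^ 0)%N ltn_exp2l.
have u1 : uroot k - 1 != 0.
  rewrite subr_eq0; apply: cis_neq1; have p0 := pi_gt0 R.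
  rewrite divr_gt0 ?mulr_gt0 ?exprn_gt0 //= ltr_pdivrMr ?exprn_gt0 //.
  by rewrite ltr_pMr ?mulr_gt0 // -natrX ltr1n.
(* The factor [s] cancelled below vanishes here; instead all values of [f'] coincide and the nodes
   sum to [0]. *)
have [->|sn0] := eqVneq s 0.
  rewrite /path'; under eq_bigr => j _ do rewrite mul0r addr0.
  rewrite -mulr_sumr /node -mulr_sumr.
  have -> : \sum_(j < 2 ^ k) uroot k ^+ j = 0.
    by apply: (mulfI u1); rewrite mulr0 -subrX1 urootX subrr.
  by rewrite !mulr0 nc0 !mulr_ge0 ?nc_ge0 ?exprn_ge0 // ltW.
have sp : 0 < s by rewrite lt_def sn0.
pose p j := w + s%:C * (node k j - w).
have pS j : p j.+1 - p j = s%:C * (uroot k - 1) * node k j.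
  have -> : p j.+1 - p j = s%:C * (node k j.+1 - node k j) by rewrite /p; ring.
  by rewrite nodeS; ring.
have tel : \sum_(0 <= j < 2 ^ k) (f (p j.+1) - f (p j)) = 0.
  by rewrite telescope_sumr // /p /node urootX expr0 subrr.
have E : s%:C * (uroot k - 1) * ((2 ^ k)%:R * path' k w s) =
    - \sum_(j < 2 ^ k) (f (p j.+1) - f (p j) - (p j.+1 - p j) * f' (p j)).
  rewrite big_split /= sumrN -(big_mkord predT (fun j => f (p j.+1) - f (p j))) tel add0r opprK.
  rewrite /path' mulVKf // mulr_sumr; apply: eq_bigr => j _.
  by rewrite pS; ring.
have b1 : nc (s%:C * (uroot k - 1) * ((2 ^ k)%:R * path' k w s)) <=
    (2 ^ k)%:R * (L * (s * nc (uroot k - 1) * r) ^+ 2).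
  rewrite E ncN; apply: le_trans (nc_sum _) _.
  rewrite mulr_natl -[X in _ *+ X](card_ord (2 ^ k)) -sumr_const.
  apply: ler_sum => j _.
  apply: le_trans (fL (seg_r k j wr s01) (seg_r k j.+1 wr s01)) _.
  by rewrite -/(p j) -/(p j.+1) pS (ncM _ (node k j)) (ncM s%:C) nc_node nc_real ger0_norm.
move: b1; move: (path' k w s) => X; rewrite !ncM nc_nat nc_real (ger0_norm s0).
have u0 : 0 < nc (uroot k - 1) by rewrite nc_gt0.
have n0 : 0 < (2 ^ k)%:R :> R by rewrite ltr0n expn_gt0.
have -> : s * nc (uroot k - 1) * ((2 ^ k)%:R * nc X) =
  (s * nc (uroot k - 1) * (2 ^ k)%:R) * nc X by ring.
have -> : (2 ^ k)%:R * (L * (s * nc (uroot k - 1) * r) ^+ 2) =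
  (s * nc (uroot k - 1) * (2 ^ k)%:R) * (s * (L * r ^+ 2 * nc (uroot k - 1))) by ring.
rewrite ler_pM2l ?mulr_gt0 // => h; apply: le_trans h _.
by rewrite ler_piMl // !mulr_ge0 ?nc_ge0 ?exprn_ge0 // ltW.
Qed.

Let geom_node k j w : nc w < r ->
  \sum_(n < 2 ^ k) (w / node k j) ^+ n = (1 - (w / r%:C) ^+ (2 ^ k)) * (node k j / (node k j - w)).
Proof.
move=> wr; have d0 := node_sub k j wr; have j0 := node_neq0 k j.
have q1 : w / node k j - 1 != 0.
  have -> : w / node k j - 1 = - (node k j - w) / node k j by field.
  by rewrite mulf_neq0 ?oppr_eq0 ?invr_eq0.
apply: (mulfI q1); rewrite -subrX1 !expr_div_n nodeX.
by field; rewrite expf_neq0 ?d0 ?j0 // -nc_gt0 nc_real normr_gt0 gt_eqF.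
Qed.

(** All nodes have the same power of order [2 ^ k], so that the finite geometric sums turning
    [node / (node - w)] into powers of [w] share one defect factor [1 - Q]. *)
Let pol_sub k w : nc w < r -> pol k w - f w = (1 - (w / r%:C) ^+ (2 ^ k)) * (path k w 1 - path k w 0).
Proof.
move=> wr; set Q := _ ^+ _; rewrite mulrBr; congr (_ - _).
  rewrite /pol /coef /path; under eq_bigr => n _ do rewrite -mulrA mulr_suml.
  rewrite -mulr_sumr mulrCA; congr (_ * _).
  rewrite exchange_big /= mulr_sumr; apply: eq_bigr => j _.
  rewrite mulrCA -geom_node // mul1r addrC subrK mulr_sumr.
  by apply: eq_bigr => n _; rewrite expr_div_n -mulrA (mulrC (w ^+ n)).
set T := \sum_(j < 2 ^ k) node k j / (node k j - w).
have -> : path k w 0 = (2 ^ k)%:R^-1 * (f w * T).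
  rewrite mulr_sumr; congr (_ * _); apply: eq_bigr => j _.
  by rewrite (_ : 0%:C = 0) // mul0r addr0.
(* After expansion only the power [n = 0] survives: the sums of the other powers of the nodes
   vanish. *)
have QT : (1 - Q) * T = (2 ^ k)%:R.
  rewrite mulr_sumr; under eq_bigr => j _ do rewrite -geom_node //.
  rewrite exchange_big /=.
  have kk : (0 < 2 ^ k)%N by rewrite expn_gt0.
  rewrite (bigD1 (Ordinal kk)) //= [X in _ + X]big1 ?addr0.
    under eq_bigr do rewrite expr0.
    by rewrite sumr_const card_ord.
  move=> n n0; have nn : (0 < n < 2 ^ k)%N by rewrite ltn_ord lt0n andbT.
  have -> : \sum_(j < 2 ^ k) (w / node k j) ^+ n =
     (w / r%:C) ^+ n * \sum_(j < 2 ^ k) (uroot k ^+ j) ^- n.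
    rewrite mulr_sumr; apply: eq_bigr => j _.
    by rewrite /node invfM mulrA exprMn exprVn.
  by rewrite uroot_sum // mulr0.
have -> : (1 - Q) * ((2 ^ k)%:R^-1 * (f w * T)) = f w * ((2 ^ k)%:R^-1 * ((1 - Q) * T)) by ring.
by rewrite QT mulVf // mulr1.
Qed.

Let pol_cvg k w : (0 < k)%N -> nc w <= r / 2 -> nc (pol k w - f w) <= (16 * pi * L * r ^+ 2) / 2 ^+ k.
Proof.
move=> k0 wr; have wr' : nc w < r by apply: le_lt_trans wr _; rewrite half_lt //.
rewrite pol_sub // ncM.
have rC : nc (w / r%:C) <= 1.
  by rewrite ncM ncV nc_real gtr0_norm // ler_pdivrMr // mul1r ltW.
have h1 : nc (1 - (w / r%:C) ^+ (2 ^ k)) <= 2.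
  apply: le_trans (ncB _ _) _; rewrite nc1 ncX -[2]/(1 + 1) lerD2l.
  by apply: exprn_ile1 => //; exact: nc_ge0.
have h2 : nc (path k w 1 - path k w 0) <= 2 * (L * r ^+ 2 * nc (uroot k - 1)) * (1 - 0).
  apply: mean_value_nc => // s s01; [exact: path_deriv|exact: path'_le].
apply: le_trans (ler_pM (nc_ge0 _) (nc_ge0 _) h1 h2) _.
rewrite subr0 mulr1.
have -> : 2 * (2 * (L * r ^+ 2 * nc (uroot k - 1))) = 4 * L * r ^+ 2 * nc (uroot k - 1) by ring.
have -> : 16 * pi * L * r ^+ 2 / 2 ^+ k = 4 * L * r ^+ 2 * (4 * pi / 2 ^+ k) by ring.
by apply: ler_wpM2l; rewrite ?nc_uroot_sub1 // !mulr_ge0 // ltW.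
Qed.

Let fbound : exists2 F, 0 <= F & forall z, nc z <= r -> nc (f z) <= F.
Proof.
exists (nc (f 0) + r * nc (f' 0) + L * r ^+ 2).
  by rewrite !addr_ge0 ?mulr_ge0 ?nc_ge0 ?exprn_ge0 // ltW.
move=> z zr; have h0 : nc 0 <= r by rewrite nc0 ltW.
have := fL h0 zr; rewrite subr0 => h.
rewrite -(subrK (f 0) (f z)) -(subrK (z * f' 0) (f z - f 0)).
apply: le_trans (ncD _ _) _; apply: le_trans (lerD (ncD _ _) (lexx _)) _.
rewrite ncM.
have h1 : nc z * nc (f' 0) <= r * nc (f' 0) by apply: ler_wpM2r; rewrite ?nc_ge0.
have h2 : L * nc z ^+ 2 <= L * r ^+ 2.
  by apply: ler_wpM2l => //; rewrite lerXn2r ?nnegrE ?nc_ge0 // ltW.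
lra.
Qed.

Let flip : exists K, forall a b, nc a <= r -> nc b <= r -> nc (f b - f a) <= K * nc (b - a).
Proof.
have h0 : nc 0 <= r by rewrite nc0 ltW.
exists (nc (f' 0) + 4 * L * r) => a b ar br.
have E x : nc x <= r -> x != 0 -> nc (f' x - f' 0) <= 2 * L * r.
  move=> xr x0; have nx0 : 0 < nc x by rewrite nc_gt0.
  have := fL h0 xr; have := fL xr h0; rewrite !subr0 sub0r ncN => h1 h2.
  rewrite -(ler_pM2r nx0) -ncM.
  have -> : (f' x - f' 0) * x = (f 0 - f x - - x * f' x) + (f x - f 0 - x * f' 0) by ring.
  apply: le_trans (ncD _ _) _; apply: le_trans (lerD h1 h2) _.
  have h3 : L * nc x ^+ 2 <= L * r * nc x.
    by rewrite expr2 mulrA; apply: ler_wpM2r; rewrite ?nc_ge0 // ler_wpM2l.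
  lra.
have f'a : nc (f' a) <= nc (f' 0) + 2 * L * r.
  have [->|a0] := eqVneq a 0; first by rewrite lerDl !mulr_ge0 // ltW.
  rewrite -(subrK (f' 0) (f' a)); apply: le_trans (ncD _ _) _.
  by rewrite addrC lerD2l E.
rewrite -(subrK ((b - a) * f' a) (f b - f a)).
apply: le_trans (ncD _ _) _; apply: le_trans (lerD (fL ar br) (lexx _)) _.
have ba : nc (b - a) <= 2 * r by apply: le_trans (ncB _ _) _; lra.
have h1 : L * nc (b - a) ^+ 2 <= L * (2 * r) * nc (b - a).
  by rewrite expr2 mulrA; apply: ler_wpM2r; rewrite ?nc_ge0 // ler_wpM2l.
rewrite ncM.
have h2 : nc (b - a) * nc (f' a) <= nc (b - a) * (nc (f' 0) + 2 * L * r).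
  by apply: ler_wpM2l; rewrite ?nc_ge0.
lra.
Qed.

Let circle_lip n : exists K, forall a b, nc a = r -> nc b = r ->
  nc (f b * b ^- n - f a * a ^- n) <= K * nc (b - a).
Proof.
have [F F0 hF] := fbound.
elim: n => [|n [K hK]].
  have [K hK] := flip; exists K => a b ar br.
  by rewrite !expr0 !invr1 !mulr1; apply: hK; rewrite ?ar ?br.
exists (K / r + F / r ^+ n / r ^+ 2) => a b ar br.
have a0 : a != 0 by rewrite -nc_gt0 ar.
have b0 : b != 0 by rewrite -nc_gt0 br.
have -> : f b * b ^- n.+1 - f a * a ^- n.+1 =
  (f b * b ^- n - f a * a ^- n) / b - f a * a ^- n * (b - a) / (a * b).
  by rewrite !exprS; field; rewrite ?expf_neq0 ?a0 ?b0.
apply: le_trans (ncB _ _) _; rewrite !ncM !ncV !ncM ncX ar br mulrDl.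
apply: lerD.
  by rewrite mulrAC; apply: ler_wpM2r; rewrite ?hK // invr_ge0 ltW.
rewrite mulrAC -expr2; apply: ler_wpM2r; rewrite ?nc_ge0 // -!mulrA; apply: ler_wpM2r.
  by rewrite -invfM invr_ge0 mulr_ge0 ?exprn_ge0 // ltW.
by apply: hF; rewrite ar.
Qed.

(** Refining the nodes pairs each old node with its new neighbour. The change of the coefficient is
    half the average increment of [phi] between them, and their distance is of order [2^-k]. *)
Let coefS n : exists K, forall k, nc (coef k.+1 n - coef k n) <= K / 2 ^+ k.
Proof.
have [K hK] := circle_lip n.
pose phi z := f z * z ^- n.
exists (K * r * pi) => k.
have split2 (g : nat -> R[i]) m : \sum_(j < m.*2) g j = \sum_(j < m) (g j.*2 + g j.*2.+1).
  elim: m => [|m IH]; first by rewrite !big_ord0.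
  by rewrite doubleS !big_ord_recr /= IH addrA.
have e2 : (2 ^ k.+1 = (2 ^ k).*2)%N by rewrite expnS mul2n.
have ev j : node k.+1 j.*2 = node k j.
  by rewrite /node -mul2n exprM uroot_sqr.
have -> : coef k.+1 n - coef k n = (2 * (2 ^ k)%:R)^-1 *
    \sum_(j < 2 ^ k) (phi (node k.+1 j.*2.+1) - phi (node k.+1 j.*2)).
  rewrite /coef e2 (split2 (fun j => f (node k.+1 j) * node k.+1 j ^- n)).
  rewrite -muln2 natrM big_split /= sumrB.
  have -> : \sum_(j < 2 ^ k) phi (node k.+1 j.*2) = \sum_(j < 2 ^ k) f (node k j) * node k j ^- n.
    by apply: eq_bigr => j _; rewrite ev.
  by rewrite /phi; field.
have n0 : 0 < (2 ^ k)%:R :> R by rewrite ltr0n expn_gt0.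
rewrite ncM ncV ncM !nc_nat ler_pdivrMl ?mulr_gt0 //.
apply: le_trans (nc_sum _) _.
have b1 (j : 'I_(2 ^ k)) : nc (phi (node k.+1 j.*2.+1) - phi (node k.+1 j.*2)) <=
    K * r * (4 * pi / 2 ^+ k.+1).
  have h := hK _ _ (nc_node k.+1 j.*2) (nc_node k.+1 j.*2.+1).
  apply: le_trans h _; rewrite nodeS ncM nc_node mulrA.
  (* Read off from the two antipodal points [r] and [- r]. *)
  have K0 : 0 <= K.
    have := le_trans (nc_ge0 _) (hK r%:C (- r%:C) _ _).
    rewrite ncN nc_real gtr0_norm // => /(_ erefl erefl).
    by rewrite pmulr_lge0 // -opprD ncN nc_gt0 -rmorphD -nc_gt0 nc_real normr_gt0 gt_eqF // addr_gt0.
  apply: ler_wpM2l; last exact: nc_uroot_sub1.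
  by rewrite mulr_ge0 // ltW.
apply: le_trans (ler_sum _ (fun j _ => b1 j)) _.
rewrite sumr_const card_ord -[_ *+ (2 ^ k)]mulr_natl exprS natrX.
rewrite le_eqVlt; apply/orP; left; apply/eqP. field.
by rewrite expf_neq0.
Qed.

(** [a n] is the limit of [coef k n] as [k] grows. The bound [F / r^n], uniform in [k], makes the
    tail on the half disc geometric. *)
Lemma power_series_expansion : exists a : nat -> R[i], exists K : R,
  forall w m, nc w <= r / 2 -> nc (\sum_(0 <= n < m) a n * w ^+ n - f w) <= K / 2 ^+ m.
Proof.
have [F F0 hF] := fbound.
have lim n : exists p : R[i] * R, forall k, nc (coef k n - p.1) <= p.2 / 2 ^+ k.
  have [K hK] := coefS n; have [l hl] := geometric_cauchy hK.
  by exists (l, 2 * K).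
have [p hp] := choice lim; exists (fun n => (p n).1), (2 * F) => w m wr.
have cF k n : nc (coef k n * w ^+ n) <= F / 2 ^+ n.
  have n0 : 0 < (2 ^ k)%:R :> R by rewrite ltr0n expn_gt0.
  rewrite ncM ncX; apply: le_trans (_ : F / r ^+ n * (r / 2) ^+ n <= _); last first.
    rewrite expr_div_n le_eqVlt; apply/orP; left; apply/eqP; field.
    by rewrite !expf_neq0 // gt_eqF.
  apply: ler_pM; rewrite ?exprn_ge0 ?nc_ge0 //; last first.
    by rewrite lerXn2r ?nnegrE ?nc_ge0 // divr_ge0 // ltW.
  rewrite /coef ncM ncV nc_nat ler_pdivrMl //.
  apply: le_trans (nc_sum _) _.
  apply: le_trans (ler_sum _ (_ : forall j : 'I_(2 ^ k), true -> _ <= F / r ^+ n)) _.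
    move=> j _; rewrite ncM ncV ncX nc_node; apply: ler_wpM2r.
      by rewrite invr_ge0 exprn_ge0 // ltW.
    by apply: hF; rewrite nc_node.
  by rewrite sumr_const card_ord mulr_natl.
apply/ler_addgt0Pr => e e0; have e2 : 0 < e / 2 by rewrite divr_gt0.
pose S := \sum_(0 <= n < m) (p n).2 * nc w ^+ n.
have [k1 hk1] := pow2_small S e2.
have [k2 hk2] := pow2_small (16 * pi * L * r ^+ 2) e2.
(* [m.+1] ensures [0 < k] and [m <= 2 ^ k], so that [pol k] can be cut at [m]. *)
pose k := maxn (maxn k1 k2) m.+1.
have kk1 : (k1 <= k)%N by rewrite !leq_max leqnn.
have kk2 : (k2 <= k)%N by rewrite !leq_max leqnn orbT.
have km : (m < k)%N by rewrite /k leq_maxr.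
have k0 : (0 < k)%N by apply: leq_trans km.
have mk : (m <= 2 ^ k)%N by apply: leq_trans (ltnW km) _; rewrite ltnW // ltn_expl.
have E : pol k w = \sum_(0 <= n < m) coef k n * w ^+ n + \sum_(m <= n < 2 ^ k) coef k n * w ^+ n.
  by rewrite /pol -(big_mkord predT (fun n => coef k n * w ^+ n)) (big_cat_nat _ (n := m)).
have -> : \sum_(0 <= n < m) (p n).1 * w ^+ n - f w =
   (pol k w - f w) - \sum_(0 <= n < m) (coef k n - (p n).1) * w ^+ n
   - \sum_(m <= n < 2 ^ k) coef k n * w ^+ n.
  rewrite E; under [X in _ = _ - X - _]eq_bigr do rewrite mulrBl.
  by rewrite sumrB; ring.
have tail M : nc (\sum_(m <= n < M) coef k n * w ^+ n) <= 2 * F / 2 ^+ m.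
  (* The boolean factor removes the subtracted term while the sum is still empty, for [M < m]. *)
  have : nc (\sum_(m <= n < M) coef k n * w ^+ n) <= 2 * F / 2 ^+ m - (2 * F / 2 ^+ M) * (m <= M)%N%:R.
    elim: M => [|M IH].
      rewrite big_geq // nc0 leqn0; have [->|m0] := eqVneq m 0%N.
        by rewrite mulr1 subrr.
      by rewrite mulr0 subr0 divr_ge0 ?mulr_ge0 ?exprn_ge0.
    have [mM|Mm] := leqP m M.
      rewrite big_nat_recr //=; apply: le_trans (ncD _ _) _.
      apply: le_trans (lerD IH (cF k M)) _; rewrite mM (leq_trans mM) // !mulr1.
      have -> : 2 * F / 2 ^+ M.+1 = F / 2 ^+ M by rewrite exprS; field; rewrite expf_neq0.
      by rewrite -(mulrA 2 F); lra.
    rewrite big_geq // nc0; have [mM|mM] := leqP m M.+1.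
      have -> : m = M.+1 by apply/eqP; rewrite eqn_leq mM.
      by rewrite mulr1 subrr.
    by rewrite mulr0 subr0 divr_ge0 ?mulr_ge0 ?exprn_ge0.
  move=> /le_trans; apply; rewrite gerBl mulr_ge0 ?divr_ge0 ?mulr_ge0 ?exprn_ge0 //.
apply: le_trans (ncB _ _) _; rewrite [leRHS]addrC; apply: lerD; last exact: tail.
rewrite (splitr e); apply: le_trans (ncB _ _) _; apply: lerD.
  by apply: le_trans (pol_cvg k0 wr) _; exact: hk2.
apply: le_trans (hk1 _ kk1); rewrite /S mulr_suml !big_mkord.
apply: le_trans (nc_sum _) _; apply: ler_sum => n _.
by rewrite ncM ncX mulrAC; apply: ler_wpM2r; rewrite ?exprn_ge0 ?nc_ge0 // hp.
Qed.

End analytic.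

(** * Characteristics of the Burgers equation *)

Section characteristics.
Variables (R : realType) (P : probability (measurableTypeR R) R).
Variables (U : R -> R) (B : R).
Hypothesis mU : measurable_fun [set: measurableTypeR R] (U : measurableTypeR R -> measurableTypeR R).
Hypothesis UB : forall u, `|U u| <= B.

Implicit Types (s t e : R) (z w a b : R[i]).

Local Notation M0 := (ctrans P U).
Local Notation M0' := (ctrans' P U).
Local Notation F := (cpot P U).
Local Notation I := (energy P U).

(* [M t] is constant, equal to [M0 z], along [t |-> charG t z]. In terms of
   [w = charG t z], [charE t z] is a primitive of [M t w]. *)
Definition charG (t : R) (z : R[i]) : R[i] := z + (2 * t)%:C * M0 z.

Definition charE (t : R) (z : R[i]) : R[i] := F z + t%:C * M0 z ^+ 2.

(* The preimage of the upper half-plane under [charG t]; [cdom t] adds the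
   boundary points off the real axis. *)
Definition dom (t : R) (z : R[i]) : Prop := 0 < Im z /\ 0 < Im (charG t z).

Definition cdom (t : R) (z : R[i]) : Prop := 0 < Im z /\ 0 <= Im (charG t z).

Lemma charGE t z : charG t z = z + (2 * t)%:C * M0 z.
Proof. by []. Qed.

Lemma charEE t z : charE t z = F z + t%:C * M0 z ^+ 2.
Proof. by []. Qed.

Lemma dom_cdom t z : dom t z -> cdom t z.
Proof. by move=> [z0 /ltW]. Qed.

Lemma Im_charG t z : 0 < Im z ->
  Im (charG t z) = Im z * (1 - 4 * t * I z).
Proof. by move=> z0; rewrite /charG !ReImE mul0r addr0 Im_ctrans //; ring. Qed.

Lemma cdomP t z : 0 < Im z -> cdom t z <-> 4 * t * I z <= 1.
Proof.
move=> z0; split => [[_]|h]; last split => //; rewrite Im_charG // pmulr_rge0 // subr_ge0 //.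
Qed.

Lemma domP t z : 0 < Im z -> dom t z <-> 4 * t * I z < 1.
Proof.
move=> z0; split => [[_]|h]; last split => //; rewrite Im_charG // pmulr_rgt0 // subr_gt0 //.
Qed.

Lemma dom0 z : 0 < Im z -> dom 0 z.
Proof. by move=> z0; apply/domP => //; rewrite mulr0 mul0r. Qed.

Lemma charE0 z : charE 0 z = F z.
Proof. by rewrite /charE (_ : 0%:C = 0) // mul0r addr0. Qed.

Lemma charG0 z : charG 0 z = z.
Proof. by rewrite /charG mulr0 (_ : 0%:C = 0) // mul0r addr0. Qed.

Lemma Im_charG_le t z : 0 <= t -> 0 < Im z -> Im (charG t z) <= Im z.
Proof.
move=> t0 z0; rewrite Im_charG // ler_piMr ?(ltW z0) // lerBlDr lerDl.
by rewrite !mulr_ge0 // ltW // energy_gt0.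
Qed.

(** So [charE t] stays within [1] of [F] on [cdom t], which is the origin of the [+ 1] and [expR 1]
    in later bounds. *)
Lemma nc_tM0 t z : 0 <= t -> cdom t z -> t * nc (M0 z) ^+ 2 <= 1.
Proof.
move=> t0 h; have [z0 _] := h; move/(cdomP t z0): h; apply: le_trans.
have := ler_wpM2l t0 (ctrans_jensen P mU z0); set X := _ * _ ^+ 2; lra.
Qed.

Lemma charG_inj t a b : 0 <= t -> cdom t a -> cdom t b -> charG t a = charG t b -> a = b.
Proof.
move=> t0 ha hb; have [a0 _] := ha; have [b0 _] := hb.
move/(cdomP t a0): ha => ha; move/(cdomP t b0): hb => hb.
move/eqP; rewrite eq_sym -subr_eq0 /charG.
have -> : b + (2 * t)%:C * M0 b - (a + (2 * t)%:C * M0 a) = (b - a) + (2 * t)%:C * (M0 b - M0 a) by ring.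
rewrite ctrans_sub //; have hC := Re_cmean_ckern2_lt P mU a0 b0.
move: hC; set C := cintegral _ _ => hC; clearbody C.
have -> : b - a + (2 * t)%:C * ((a - b) * C) = (b - a) * (1 - (2 * t)%:C * C) by ring.
rewrite mulf_eq0 => /orP[|/eqP /(congr1 (@complex.Re R))]; first by rewrite subr_eq0 => /eqP.
rewrite !ReImE mul0r subr0 /= => hR; exfalso.
case: (ltgtP 0 t) t0 => [t0 _|//|t0 _]; last by rewrite -t0 in hR; lra.
rewrite -(ltr_pM2l t0) in hC; lra.
Qed.

Lemma Re_charG'_gt0 t z : 0 <= t -> cdom t z -> 0 < Re (1 + (2 * t)%:C * M0' z).
Proof.
move=> t0 h; have [z0 _] := h; move/(cdomP t z0): h => h.
have hC := Re_ctrans'_gt P mU z0; move: (M0' z) hC => m hC.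
rewrite !ReImE mul0r subr0 /=.
case: (ltgtP 0 t) t0 => [t0 _|//|<- _]; last by lra.
rewrite -(ltr_pM2l t0) in hC; lra.
Qed.

Lemma charG'_neq0 t z : 0 <= t -> cdom t z -> 1 + (2 * t)%:C * M0' z != 0.
Proof.
by move=> t0 /(Re_charG'_gt0 t0) h; apply/eqP => h0; rewrite h0 ltxx in h.
Qed.

Lemma Im_near (z w : R[i]) : nc (w - z) < Im z / 2 -> Im z / 2 <= Im w.
Proof.
move=> h; have := le_lt_trans (Im_le_nc (w - z)) h; rewrite !ReImE ltr_norml => /andP[]; lra.
Qed.

Lemma qdiff_ctrans z : 0 < Im z -> qdiff M0 z (M0' z).
Proof.
move=> z0; exists M0'; split => //.
have e0 : 0 < Im z / 2 by rewrite divr_gt0.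
exists (Im z / 2), (4 / (Im z / 2) ^+ 3); split => //.
  by rewrite divr_ge0 // exprn_ge0 // ltW.
by move=> a b /Im_near ha /Im_near hb; exact: ctrans_taylor.
Qed.

Lemma qdiff_cpot z : 0 < Im z -> qdiff F z (M0 z).
Proof.
move=> z0; exists M0; split => //.
have e0 : 0 < Im z / 2 by rewrite divr_gt0.
exists (Im z / 2), (8 / (Im z / 2) ^+ 2); split => //.
  by rewrite divr_ge0 // exprn_ge0 // ltW.
by move=> a b /Im_near ha /Im_near hb; apply: (cpot_taylor P mU UB e0).
Qed.

Lemma qdiff_charG t z : 0 < Im z -> qdiff (charG t) z (1 + (2 * t)%:C * M0' z).
Proof.
by move=> z0; apply: qdiffD; [exact: qdiff_id|apply: qdiffZ; exact: qdiff_ctrans].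
Qed.

(** The derivative is kept as [M0 z] times that of [charG t]: with respect to [charG t], the
    derivative of [charE t] is [M0]. *)
Lemma qdiff_charE t z : 0 < Im z ->
  qdiff (charE t) z (M0 z * (1 + (2 * t)%:C * M0' z)).
Proof.
move=> z0.
have -> : M0 z * (1 + (2 * t)%:C * M0' z) = M0 z + t%:C * (2 * M0 z * M0' z).
  by rewrite rmorphM /= (rmorph_nat (real_complex R)); ring.
apply: qdiffD; first exact: qdiff_cpot.
apply: qdiffZ; apply: (qdiff_comp (f := M0) (g := fun z => z ^+ 2)); first exact: qdiff_ctrans.
exact: qdiff_sqr.
Qed.

Lemma charE'_neq0 t z : 0 <= t -> cdom t z -> M0 z * (1 + (2 * t)%:C * M0' z) != 0.
Proof. by move=> t0 h; rewrite mulf_neq0 ?charG'_neq0 // ctrans_neq0 //; case: h. Qed.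

Lemma charE_diff s t z : charE s z = charE t z + (s - t)%:C * M0 z ^+ 2.
Proof. by rewrite /charE rmorphB; ring. Qed.

Lemma charG_diff s t z : charG s z = charG t z + (2 * (s - t))%:C * M0 z.
Proof. by rewrite /charG !rmorphM rmorphB /=; ring. Qed.

Lemma char_continuous t z : 0 < Im z -> forall e, 0 < e -> exists2 dl, 0 < dl &
  forall s w, `|s - t| < dl -> nc (w - z) < dl ->
    nc (charE s w - charE t z) < e /\ nc (charG s w - charG t z) < e.
Proof.
move=> z0 e e0.
have [r1 [K1 [r10 K10 H1]]] := qdiff_lip (qdiff_charE t z0).
have [r2 [K2 [r20 K20 H2]]] := qdiff_lip (qdiff_charG t z0).
pose h := Im z / 2.
have h0 : 0 < h by rewrite divr_gt0.
pose C1 := 4 / h.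
have C10 : 0 < C1 by rewrite divr_gt0.
pose K := K1 + K2 + C1 ^+ 2 + 2 * C1.
have K0 : 0 < K by rewrite /K; have := exprn_gt0 2 C10; lra.
exists (Num.min (Num.min r1 r2) (Num.min h (e / K / 2))).
  by rewrite !lt_min r10 r20 h0 !divr_gt0.
move=> s w; rewrite !lt_min => /andP[_ /andP[_ sK]] /andP[/andP[w1 w2] /andP[wh wK]].
have Mw : nc (M0 w) <= C1 by apply: nc_ctrans_le => //; exact: Im_near.
have cc r : 0 < r -> nc (z - z) <= r by move=> r0; rewrite subrr nc0 ltW.
have eK : (e / K / 2) * K = e / 2 by field; rewrite gt_eqF.
have e2 : e / 2 < e by rewrite half_lt //.
have ss : 0 <= `|s - t| by [].
have n0 := nc_ge0 (w - z).
split.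
  rewrite (charE_diff s t) addrAC; apply: le_lt_trans (ncD _ _) _.
  rewrite ncM nc_real ncX.
  have h1 := H1 _ _ (cc _ r10) (ltW w1).
  have h2 : `|s - t| * nc (M0 w) ^+ 2 <= `|s - t| * C1 ^+ 2.
    by apply: ler_wpM2l => //; rewrite lerXn2r ?nnegrE ?nc_ge0 // ltW.
  apply: le_lt_trans (lerD h1 h2) _; apply: le_lt_trans e2; rewrite -eK.
  have k1 : K1 * nc (w - z) <= K1 * (e / K / 2) by rewrite ler_wpM2l // ltW.
  have k2 : `|s - t| * C1 ^+ 2 <= (e / K / 2) * C1 ^+ 2 by rewrite ler_wpM2r ?exprn_ge0 // ltW.
  apply: le_trans (lerD k1 k2) _.
  rewrite mulrC -mulrDr; apply: ler_wpM2l; first by rewrite !divr_ge0 // ltW.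
  by rewrite /K; have := ltW K20; have := ltW C10; lra.
rewrite (charG_diff s t) addrAC; apply: le_lt_trans (ncD _ _) _.
rewrite ncM nc_real normrM (ger0_norm (ler0n _ 2)).
have h1 := H2 _ _ (cc _ r20) (ltW w2).
have h2 : 2 * `|s - t| * nc (M0 w) <= 2 * `|s - t| * C1 by rewrite ler_wpM2l ?mulr_ge0.
apply: le_lt_trans (lerD h1 h2) _; apply: le_lt_trans e2; rewrite -eK.
have k1 : K2 * nc (w - z) <= K2 * (e / K / 2) by rewrite ler_wpM2l // ltW.
have k2 : 2 * `|s - t| * C1 <= 2 * (e / K / 2) * C1.
  by apply: ler_wpM2r; [exact: ltW|rewrite ler_wpM2l // ltW].
apply: le_trans (lerD k1 k2) _.
have -> : K2 * (e / K / 2) + 2 * (e / K / 2) * C1 = (e / K / 2) * (K2 + 2 * C1) by ring.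
apply: ler_wpM2l; first by rewrite !divr_ge0 // ltW.
by rewrite /K; have := ltW K10; have := sqr_ge0 C1; lra.
Qed.

(** An implicit function theorem. The slope frozen at [(t, z)] serves all nearby times, because
    [charE s - charE t = (s - t) M0^2] has a small Lipschitz constant. It is nonzero on all of
    [cdom t]. *)
Lemma char_solve t z : 0 <= t -> cdom t z -> exists dl K, [/\ 0 < dl, 0 < K &
  forall s c, `|s - t| < dl -> nc (c - charE t z) < dl -> exists w,
    [/\ charE s w = c, 0 < Im w & nc (w - z) <= K * (`|s - t| + nc (c - charE t z))]].
Proof.
move=> t0 hz; have [z0 _] := hz.
set d := M0 z * (1 + (2 * t)%:C * M0' z).
have d0 : d != 0 := charE'_neq0 t0 hz.
have nd : 0 < nc d by rewrite nc_gt0.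
have [r1 r10 H1] := qdiff_strict (qdiff_charE t z0) (divr_gt0 nd (ltr0Sn _ 3)).
have [r2 [K2 [r20 K20 H2]]] := qdiff_lip (qdiff_comp (qdiff_ctrans z0) (qdiff_sqr _)).
pose rho := Num.min (Num.min r1 r2) (Im z / 4).
have rho0 : 0 < rho by rewrite !lt_min r10 r20 divr_gt0.
have rr1 : rho <= r1 by rewrite !ge_min lexx.
have rr2 : rho <= r2 by rewrite !ge_min lexx orbT.
have rrz : rho <= Im z / 4 by rewrite ge_min lexx orbT.
pose C := nc (M0 z ^+ 2) + 1.
have C0 : 0 < C by rewrite ltr_wpDl ?nc_ge0.
(* The first bound keeps the change of slope between times [t] and [s] below [nc d / 4]; the second
   keeps the residual within reach of [solve_near] on the disc of radius [rho]. *)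
pose dl := Num.min (nc d / (4 * K2)) (nc d * rho / (2 * (C + 1))).
have C1 : 0 < C + 1 by rewrite addr_gt0.
have dl0 : 0 < dl by rewrite lt_min; apply/andP; split; apply: divr_gt0 => //; exact: mulr_gt0.
exists dl, (2 * (C + 1) / nc d); split => //; first by apply: divr_gt0 => //; exact: mulr_gt0.
move=> s c sd cd.
have sK : `|s - t| * K2 <= nc d / 4.
  have : `|s - t| <= nc d / (4 * K2) by apply: le_trans (ltW sd) _; rewrite ge_min lexx.
  by rewrite ler_pdivlMr ?mulr_gt0 //; lra.
have sol a b : nc (a - z) <= rho -> nc (b - z) <= rho ->
    nc (charE s b - charE s a - (b - a) * d) <= nc d / 2 * nc (b - a).
  move=> ha hb; rewrite !(charE_diff s t).
  have -> : charE t b + (s - t)%:C * M0 b ^+ 2 - (charE t a + (s - t)%:C * M0 a ^+ 2) - (b - a) * d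
    = (charE t b - charE t a - (b - a) * d) + (s - t)%:C * (M0 b ^+ 2 - M0 a ^+ 2) by ring.
  apply: le_trans (ncD _ _) _; rewrite (ncM (s - t)%:C) nc_real.
  have h1 := H1 _ _ (le_trans ha rr1) (le_trans hb rr1).
  have h2 := H2 _ _ (le_trans ha rr2) (le_trans hb rr2).
  have h3 : `|s - t| * nc (M0 b ^+ 2 - M0 a ^+ 2) <= (nc d / 4) * nc (b - a).
    apply: le_trans (ler_wpM2l (normr_ge0 _) h2) _; rewrite mulrA.
    by apply: ler_wpM2r; rewrite ?nc_ge0.
  apply: le_trans (lerD h1 h3) _; have := nc_ge0 (b - a); nra.
have cs : nc (c - charE s z) <= (C + 1) * (`|s - t| + nc (c - charE t z)) / 1.
  rewrite (charE_diff s t) opprD addrA; apply: le_trans (ncB _ _) _.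
  rewrite ncM nc_real divr1 /C.
  have := nc_ge0 (c - charE t z); have := normr_ge0 (s - t); have := nc_ge0 (M0 z ^+ 2).
  nra.
rewrite divr1 in cs.
have small : 2 * nc (c - charE s z) <= nc d * rho.
  have h : 2 * nc (c - charE s z) <= 2 * ((nc (M0 z ^+ 2)) * `|s - t| + nc (c - charE t z)).
    rewrite ler_pM2l // (charE_diff s t) opprD addrA; apply: le_trans (ncB _ _) _.
    by rewrite ncM nc_real [leLHS]addrC (mulrC (nc _)).
  apply: le_trans h _.
  have h' : 2 * (C + 1) * dl <= nc d * rho.
    have C2 : 0 < 2 * (C + 1) by exact: mulr_gt0.
    by rewrite mulrC -ler_pdivlMr // /dl ge_min lexx orbT.
  apply: le_trans h'.
  have : nc (M0 z ^+ 2) * `|s - t| <= nc (M0 z ^+ 2) * dl by rewrite ler_wpM2l ?nc_ge0 // ltW.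
  have := ltW cd; rewrite /C; have := ltW dl0; have := nc_ge0 (M0 z ^+ 2); nra.
have [w wz we] := solve_near d0 sol small.
exists w; split => //; last first.
  apply: le_trans wz _; rewrite ler_pdivrMr //.
  have -> : 2 * (C + 1) / nc d * (`|s - t| + nc (c - charE t z)) * nc d =
     2 * ((C + 1) * (`|s - t| + nc (c - charE t z))) by field; rewrite gt_eqF.
  by rewrite ler_pM2l.
have : nc (w - z) <= Im z / 4.
  by apply: le_trans wz _; apply: le_trans rrz; rewrite ler_pdivrMr // (mulrC rho).
move=> h; have : Im z / 2 <= Im w by apply: Im_near; lra.
lra.
Qed.

(* Differentiating [charE s z_s = c] along the curve: [d/ds charG s z_s = M0 z_s]. *)
Lemma charG_curve t z (K : R) : 0 <= t -> cdom t z -> 0 <= K -> forall e, 0 < e ->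
  exists2 dl, 0 < dl & forall s w, `|s - t| < dl -> nc (w - z) <= K * `|s - t| ->
    charE s w = charE t z -> nc (charG s w - charG t z - (s - t)%:C * M0 z) <= e * `|s - t|.
Proof.
move=> t0 hz K0 e e0; have [z0 _] := hz.
have m0 : M0 z != 0 := ctrans_neq0 P mU z0.
have nm : 0 < nc (M0 z) by rewrite nc_gt0.
pose e1 := e * nc (M0 z) / 3.
have e10 : 0 < e1 by rewrite divr_gt0 // mulr_gt0.
have K1 : 0 < K + 1 by rewrite ltr_wpDl.
have [r1 r10 H1] := qdiff_strict (qdiff_charE t z0) (divr_gt0 e10 K1).
have [r2 r20 H2] := qdiff_strict (qdiff_charG t z0) (divr_gt0 (divr_gt0 e10 K1) nm).
have [r3 [L [r30 L0 H3]]] := qdiff_lip (qdiff_ctrans z0).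
pose C := (L * K + 1) ^+ 2.
have C0 : 0 < C by rewrite exprn_gt0 // ltr_wpDl // mulr_ge0 // ltW.
exists (Num.min 1 (Num.min (Num.min (r1 / (K + 1)) (r2 / (K + 1))) (Num.min (r3 / (K + 1)) (e1 / C)))).
  by rewrite !lt_min ltr01 (divr_gt0 r10 K1) (divr_gt0 r20 K1) (divr_gt0 r30 K1) (divr_gt0 e10 C0).
move=> s w; rewrite !lt_min => /and3P[s1 /andP[sr1 sr2] /andP[sr3 sC]] wz we.
have wK : nc (w - z) <= (K + 1) * `|s - t| by apply: le_trans wz _; rewrite ler_wpM2r // lerDl.
have near r : `|s - t| < r / (K + 1) -> nc (w - z) <= r.
  rewrite ltr_pdivlMr // => h; apply: le_trans wK _; rewrite mulrC; exact: ltW.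
have cc r : 0 < r -> nc (z - z) <= r by move=> r0; rewrite subrr nc0 ltW.
have h1 := H1 _ _ (cc _ r10) (near _ sr1).
have h2 := H2 _ _ (cc _ r20) (near _ sr2).
have h3 := H3 _ _ (cc _ r30) (near _ sr3).
set D := 1 + (2 * t)%:C * M0' z in h1 h2.
rewrite -(ler_pM2l nm) -ncM.
(* Multiplying by [M0 z] and subtracting the expansion of [charE] eliminates the unknown first-order
   term in [w - z]; the terms in [s - t] then complete a square. *)
have -> : M0 z * (charG s w - charG t z - (s - t)%:C * M0 z) =
   M0 z * (charG t w - charG t z - (w - z) * D)
   - (charE t w - charE t z - (w - z) * (M0 z * D)) - (s - t)%:C * (M0 w - M0 z) ^+ 2.
  have := we; rewrite (charE_diff s t) (charG_diff s t) => <-.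
  by rewrite rmorphM /= (rmorph_nat (real_complex R)); ring.
apply: le_trans (ncB _ _) _; apply: le_trans (lerD (ncB _ _) (lexx _)) _.
rewrite (ncM (M0 z)) (ncM (s - t)%:C) nc_real ncX.
have b0 : e1 / (K + 1) * nc (w - z) <= e1 * `|s - t|.
  rewrite mulrAC ler_pdivrMr //.
  have -> : e1 * `|s - t| * (K + 1) = e1 * ((K + 1) * `|s - t|) by ring.
  by apply: ler_wpM2l => //; exact: ltW.
have b1 : nc (charE t w - charE t z - (w - z) * (M0 z * D)) <= e1 * `|s - t| := le_trans h1 b0.
have b2 : nc (M0 z) * nc (charG t w - charG t z - (w - z) * D) <= e1 * `|s - t|.
  apply: le_trans (ler_wpM2l (ltW nm) h2) _.
  by rewrite mulrA (mulrC (nc (M0 z))) divfK // gt_eqF.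
have b3 : `|s - t| * nc (M0 w - M0 z) ^+ 2 <= e1 * `|s - t|.
  rewrite mulrC; apply: ler_wpM2r => //.
  have q1 : nc (M0 w - M0 z) <= (L * K + 1) * `|s - t|.
    apply: le_trans h3 _; apply: le_trans (ler_wpM2l (ltW L0) wz) _.
    by rewrite mulrA ler_wpM2r // lerDl.
  have q2 : nc (M0 w - M0 z) ^+ 2 <= ((L * K + 1) * `|s - t|) ^+ 2.
    by rewrite lerXn2r ?nnegrE ?nc_ge0 // mulr_ge0 // addr_ge0 // mulr_ge0 // ltW.
  apply: le_trans q2 _; rewrite exprMn -/C.
  have q3 : `|s - t| * C <= e1 by rewrite -ler_pdivlMr // ltW.
  apply: le_trans q3; rewrite mulrC ler_pM2r // expr2 ler_piMl // ltW //.
apply: le_trans (lerD (lerD b2 b1) b3) _; rewrite /e1 le_eqVlt; apply/orP; left; apply/eqP.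
by field.
Qed.

(** On a level curve of [charE] the velocity of [charG] is [M0], of negative imaginary part; going
    back in time therefore raises [charG]. *)
Lemma char_step_back t z : 0 < t -> cdom t z -> exists dl K, [/\ 0 < dl, 0 < K &
  forall s, 0 <= s < t -> t - dl < s -> exists w, [/\ charE s w = charE t z, 0 < Im w,
    Im (charG t z) < Im (charG s w) & nc (w - z) <= K * `|s - t|]].
Proof.
move=> t0 hz; have [z0 _] := hz.
have [d1 [K [d10 K0 H1]]] := char_solve (ltW t0) hz.
have im0 := Im_ctrans_lt0 P mU z0.
have e0 : 0 < - Im (M0 z) / 2 by rewrite divr_gt0 // oppr_gt0.
have [d2 d20 H2] := charG_curve (ltW t0) hz (ltW K0) e0.
exists (Num.min d1 d2), K; split => //; first by rewrite lt_min d10.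
move=> s /andP[s0 st] sd.
have sd' : `|s - t| < Num.min d1 d2 by rewrite ltr0_norm ?subr_lt0 //; lra.
move: sd'; rewrite lt_min => /andP[sd1 sd2].
have cc : nc (charE t z - charE t z) < d1 by rewrite subrr nc0.
have [w [we w0]] := H1 s _ sd1 cc; rewrite subrr nc0 addr0 => wz.
exists w; split => //.
move: im0 (H2 s w sd2 wz we); move: (charG s w) (charG t z) (M0 z) => p q m m0 h.
have := le_trans (Im_le_nc _) h.
rewrite !ReImE mul0r addr0 /= (ltr0_norm (_ : s - t < 0)) ?subr_lt0 // ler_norml => /andP[h1 _].
have : 0 < (t - s) * - Im m by rewrite mulr_gt0 ?subr_gt0 ?oppr_gt0.
lra.
Qed.

(** [Re F] is at least [2 ln (nc z - B)]. The bound does not involve [t], so it applies to sequences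
    with varying times. *)
Lemma dom_bounded t z (C : R) : 0 <= t -> cdom t z -> Re (charE t z) <= C ->
  nc z <= B + 1 + expR (C + 1).
Proof.
move=> t0 hz hC; have [z0 _] := hz.
have [zB|Bz] := leP (nc z) B.
  by apply: le_trans zB _; rewrite -addrA lerDl addr_ge0 // expR_ge0.
have h1 := Re_cpot_ge P mU UB z0 Bz.
have h2 : Re (F z) <= C + 1.
  have : `|Re (t%:C * M0 z ^+ 2)| <= 1.
    apply: le_trans (Re_le_nc _) _; rewrite ncM nc_real ncX ger0_norm //.
    exact: nc_tM0.
  by move: hC; rewrite /charE reD ler_norml => h /andP[]; lra.
have zB : 0 < nc z - B by rewrite subr_gt0.
have h3 : (nc z - B) ^+ 2 <= expR (C + 1).
  rewrite -(lnK (x := (nc z - B) ^+ 2)) ?posrE ?exprn_gt0 // ler_expR.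
  exact: le_trans h1 h2.
have := sqr_ge0 (nc z - B - 1); have := expR_ge0 (C + 1); nra.
Qed.

Lemma cluster_char (r : nat -> R) (z : nat -> R[i]) (c : nat -> R[i]) r' z' c' eta :
  0 < Im z' ->
  (forall e, 0 < e -> forall N, exists2 n, (N <= n)%N & nc (z n - z') < e) ->
  (forall e, 0 < e -> exists N, forall n, (N <= n)%N -> `|r n - r'| < e) ->
  (forall e, 0 < e -> exists N, forall n, (N <= n)%N -> nc (c n - c') < e) ->
  (forall n, charE (r n) (z n) = c n) ->
  (forall n, eta <= Im (charG (r n) (z n))) ->
  charE r' z' = c' /\ eta <= Im (charG r' z').
Proof.
move=> z'0 hz hr hc hE hG.
have key e : 0 < e -> nc (charE r' z' - c') < e /\ eta - e < Im (charG r' z').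
  move=> e0; have e2 : 0 < e / 2 by rewrite divr_gt0.
  have [dl dl0 H] := char_continuous r' z'0 e2.
  have [N1 h1] := hr _ dl0; have [N2 h2] := hc _ e2.
  have [n Nn zn] := hz _ dl0 (maxn N1 N2).
  have n1 : (N1 <= n)%N by rewrite (leq_trans _ Nn) // leq_maxl.
  have n2 : (N2 <= n)%N by rewrite (leq_trans _ Nn) // leq_maxr.
  have [a b] := H _ _ (h1 n n1) zn; split.
    apply: le_lt_trans (nc_distD (c n) _ _) _; rewrite (splitr e); apply: ltrD; last exact: h2.
    by rewrite ncBC -hE.
  have := le_lt_trans (Im_le_nc _) b; rewrite imB ltr_norml => /andP[_].
  by have := hG n; lra.
split; last by apply/ler_addgt0Pr => e /key[_]; lra.
apply/eqP; rewrite -subr_eq0 -nc_eq0 eq_le nc_ge0 andbT.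
by apply/ler_addgt0Pr => e /key[h _]; rewrite add0r ltW.
Qed.

(** Continuation back in time. The condition [eta <= Im (charG s w)] with [eta] fixed passes to
    limits and keeps cluster points off the real axis. *)
Lemma char_back_dom t z : 0 <= t -> dom t z -> forall s, 0 <= s <= t ->
  exists w, dom s w /\ charE s w = charE t z.
Proof.
move=> t0 hz; have [z0 eta0] := hz; set eta := Im _ in eta0.
pose Q s := exists w, [/\ 0 < Im w, eta <= Im (charG s w) & charE s w = charE t z].
suff hQ : forall s, 0 <= s <= t -> Q s.
  by move=> s /hQ[w [w0 wG wE]]; exists w; split => //; split => //; exact: lt_le_trans wG.
(* The infimum of [S] satisfies [Q] by compactness, and [char_step_back] goes below it unless it is
   [0]. *)
pose S := [set s | 0 <= s <= t /\ forall r, s <= r <= t -> Q r].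
have Qt : Q t by exists z.
have St : S t.
  split; first by rewrite t0 lexx.
  by move=> r /andP[r1 r2]; have -> : r = t by apply/eqP; rewrite eq_le r1 r2.
have infS : has_inf S by split; [exists t|exists 0 => s [/andP[]]].
pose a := inf S.
have a0 : 0 <= a by apply: lb_le_inf; [exists t|move=> s [/andP[]]].
have at_ : a <= t by apply: ge_inf => //; case: infS.
have Qgt r : a < r -> r <= t -> Q r.
  move=> ar rt; have ra : 0 < r - a by rewrite subr_gt0.
  have [s [_ hs] sr] := inf_adherent ra infS.
  by apply: hs; rewrite rt andbT ltW //; move: sr; rewrite -/a; lra.
have Qa : Q a.
  have [->//|at0] := eqVneq a t.
  have alt : a < t by rewrite lt_def eq_sym at0 at_.
  pose r n := a + (t - a) / 2 ^+ n.
  have q n : 0 < (t - a) / 2 ^+ n <= t - a.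
    have p2 : 1 <= 2 ^+ n :> R by rewrite exprn_ege1 // ler1n.
    rewrite divr_gt0 ?exprn_gt0 ?subr_gt0 //= ler_pdivrMr ?exprn_gt0 //.
    by rewrite ler_peMr // subr_ge0 ltW.
  have hr n : a < r n /\ r n <= t by have /andP[] := q n; rewrite /r; split; lra.
  have [w hw] := choice (fun n => Qgt (r n) (hr n).1 (hr n).2).
  have bd n : nc (w n) <= B + 1 + expR (Re (charE t z) + 1).
    have [w0 wG wE] := hw n; have r0 : 0 <= r n by rewrite (le_trans a0) // ltW //; case: (hr n).
    apply: (dom_bounded r0); last by rewrite wE.
    by split => //; apply: le_trans (ltW eta0) wG.
  have [l hl] := cluster_bounded bd.
  have l0 : eta <= Im l.
    apply/ler_addgt0Pr => e e0; have [n _ hn] := hl _ e0 0%N.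
    have [w0 wG wE] := hw n; have r0 : 0 <= r n by rewrite (le_trans a0) // ltW //; case: (hr n).
    have := le_trans wG (Im_charG_le r0 w0).
    have := le_lt_trans (Im_le_nc _) hn; rewrite imB ltr_norml => /andP[_]; lra.
  have l00 := lt_le_trans eta0 l0.
  have rr e : 0 < e -> exists N, forall n, (N <= n)%N -> `|r n - a| < e.
    move=> e0; have [N hN] := pow2_small (t - a) (divr_gt0 e0 (ltr0Sn _ 1)).
    exists N => n Nn; have /andP[q0 _] := q n.
    rewrite /r addrAC subrr add0r gtr0_norm //.
    by apply: le_lt_trans (hN n Nn) _; exact: half_lt.
  have cE e : 0 < e -> exists N, forall n, (N <= n)%N -> nc (charE t z - charE t z) < e.
    by move=> e0; exists 0%N => n _; rewrite subrr nc0.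
  have wE n : charE (r n) (w n) = charE t z by case: (hw n).
  have wG n : eta <= Im (charG (r n) (w n)) by case: (hw n).
  have [lE lG] := cluster_char l00 hl rr cE wE wG.
  by exists l.
case: (ltgtP 0 a) a0 => [a0 _|//|a0 _]; last first.
  move=> s /andP[s0 st]; have [->|sa] := eqVneq s a; first exact: Qa.
  by apply: Qgt => //; rewrite lt_def sa -a0.
have [w [w0 wG wE]] := Qa.
have [dl [K [dl0 K0 H]]] := char_step_back a0 (conj w0 (le_trans (ltW eta0) wG) : cdom a w).
pose b := Num.max 0 (a - dl / 2).
have ba : b < a by rewrite gt_max a0 /=; lra.
have b0 : 0 <= b by rewrite le_max lexx.
have bdl : a - dl < b by rewrite lt_max; apply/orP; right; lra.
have Sb : S b.
  split; first by rewrite b0 (le_trans (ltW ba)).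
  move=> r /andP[br rt]; have [ra|ar|->//] := ltgtP r a; last exact: Qgt.
  have [||w' [w'E w'0 w'G _]] := H r; first by rewrite (le_trans b0).
    exact: lt_le_trans br.
  by exists w'; split => //; [rewrite (le_trans wG) // ltW|rewrite w'E].
have : a <= b by apply: ge_inf => //; case: infS.
by rewrite leNgt ba.
Qed.

(** One small step back moves a point with [Im (charG t z) = 0] into some [dom r], where
    [char_back_dom] takes over. *)
Lemma char_back t z : 0 < t -> cdom t z -> forall s, 0 <= s < t ->
  exists w, dom s w /\ charE s w = charE t z.
Proof.
move=> t0 hz s /andP[s0 st]; have [_ G0] := hz.
have [dl [K [dl0 K0 H]]] := char_step_back t0 hz.
pose r := Num.max s (t - dl / 2).
have r0 : 0 <= r by rewrite le_max s0.
have rt : r < t by rewrite gt_max st /=; lra.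
have rdl : t - dl < r by rewrite lt_max; apply/orP; right; lra.
have [|w [wE w0 wG _]] := H r _ rdl; first by rewrite r0.
have wd : dom r w by split => //; exact: le_lt_trans wG.
rewrite -wE; apply: char_back_dom => //.
by rewrite s0 le_max lexx.
Qed.

End characteristics.

(** * Injectivity of [charE] and the flow along its level curves *)

Section characteristic_flow.
Variables (R : realType) (P : probability (measurableTypeR R) R).
Variables (U : R -> R) (B : R).
Hypothesis mU : measurable_fun [set: measurableTypeR R] (U : measurableTypeR R -> measurableTypeR R).
Hypothesis UB : forall u, `|U u| <= B.
Implicit Types (s t e : R) (z w a b : R[i]).

Local Notation M0 := (ctrans P U).
Local Notation M0' := (ctrans' P U).
Local Notation F := (cpot P U).
Local Notation charG := (charG P U).
Local Notation charE := (charE P U).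
Local Notation dom := (dom P U).
Local Notation cdom := (cdom P U).

(** This is what the Burgers solution contributes; it is established in section [loewner]. *)
Hypothesis charG_surj : forall t w, 0 <= t -> 0 < Im w -> exists z, dom t z /\ charG t z = w.

(* In the coordinate [w = charG t z], which ranges over the convex upper
   half-plane, [charE t] has derivative [M0 z], of negative imaginary part. *)
Lemma charE_inj_dom t a b : 0 <= t -> dom t a -> dom t b -> charE t a = charE t b -> a = b.
Proof.
move=> t0 ha hb hab.
have [h hh] : exists h : R[i] -> R[i], forall w, 0 < Im w -> dom t (h w) /\ charG t (h w) = w.
  have H w : exists z, 0 < Im w -> dom t z /\ charG t z = w.
    have [w0|w0] := ltP 0 (Im w); last by exists 0.
    by have [z hz] := charG_surj t0 w0; exists z.
  by have [h hh] := choice H; exists h.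
have hG z : dom t z -> h (charG t z) = z.
  move=> hz; have [d1 e1] := hh _ hz.2.
  exact: (charG_inj mU t0 (dom_cdom d1) (dom_cdom hz) e1).
(* [h] is chosen point by point; injectivity of [charG t] on [cdom t] identifies it near [w] with
   the local holomorphic inverse. *)
have hq w : 0 < Im w -> qdiff h w (1 + (2 * t)%:C * M0' (h w))^-1.
  move=> w0; have [hd hw] := hh _ w0; have [h0 _] := hd.
  have [k [kc kq [s s0 kG]]] := qdiff_inverse (charG'_neq0 mU t0 (dom_cdom hd)) (qdiff_charG P mU t h0).
  rewrite hw in kc kq kG.
  have [r1 [K1 [r10 K10 H1]]] := qdiff_lip kq.
  pose r2 := Num.min (Num.min r1 s) (Num.min (Im (h w) / 2 / K1) (Im w / 2)).
  apply: (@qdiff_eq _ k h w _ r2) kq.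
    by rewrite !lt_min r10 s0 !divr_gt0.
  move=> z; rewrite !lt_min => /andP[/andP[z1 z2] /andP[z3 z4]].
  have Iz : 0 < Im z by have := Im_near z4; lra.
  have [d1 e1] := hh _ Iz.
  have cw : nc (w - w) <= r1 by rewrite subrr nc0 ltW.
  have kz : nc (k z - h w) <= K1 * nc (z - w) by have := H1 w z cw (ltW z1); rewrite kc.
  have kz' : nc (k z - h w) < Im (h w) / 2.
    by apply: le_lt_trans kz _; rewrite mulrC -ltr_pdivlMr.
  have kzI : 0 < Im (k z) by have := Im_near kz'; lra.
  have kd : cdom t (k z) by split; [exact: kzI|rewrite kG // ltW].
  by apply: (charG_inj mU t0 kd (dom_cdom d1)); rewrite e1 kG.
have eq_ w : 0 < Im w -> has_cderiv (charE t \o h) w (M0 (h w)).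
  move=> w0; have [hd hw] := hh _ w0; have [h0 _] := hd.
  have := qdiff_comp (hq _ w0) (qdiff_charE P mU UB t h0).
  by rewrite mulfK ?(charG'_neq0 mU t0 (dom_cdom hd)) //; exact: qdiff_cderiv.
have Ia := ha.2; have Ib := hb.2.
have hGa := hG _ ha; have hGb := hG _ hb.
move: Ia Ib hGa hGb; move: (charG t a) (charG t b) => p q Ip Iq hp hq'.
have [pq|pq] := eqVneq p q; first by rewrite -hp -hq' pq.
exfalso.
have d0 : q - p != 0 by rewrite subr_eq0 eq_sym.
pose path s := p + s%:C * (q - p).
have Ipath s : 0 <= s <= 1 -> 0 < Im (path s).
  move=> /andP[s0 s1]; rewrite /path !ReImE mul0r addr0.
  have [s00|s00] := eqVneq s 0; first by rewrite s00 mul0r addr0.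
  have : 0 < s * Im q by rewrite mulr_gt0 // lt_def s00.
  have : 0 <= (1 - s) * Im p by rewrite mulr_ge0 ?subr_ge0 // ltW.
  lra.
(* Dividing by [q - p] makes the derivative along the segment equal to [M0], whose imaginary part
   has a sign. *)
pose psi s := (charE t \o h) (path s) * (q - p)^-1.
have hpsi s : 0 <= s <= 1 -> has_vderiv `[0, 1] psi s (M0 (h (path s))).
  move=> s01.
  have hpath : has_vderiv `[0, 1] path s (0 + (1 * (q - p) + s%:C * 0)).
    apply: has_vderivD; first exact: has_vderiv_cst.
    by apply: has_vderivM; [exact: has_vderiv_id|exact: has_vderiv_cst].
  have := has_vderivM (has_vderiv_comp (eq_ _ (Ipath _ s01)) hpath) (has_vderiv_cst `[0, 1] (q - p)^-1 s).
  by rewrite !mulr0 addr0 add0r mul1r addr0 mulfK.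
have p1 : path 1 = q by rewrite /path mul1r addrC subrK.
have p0 : path 0 = p by rewrite /path mul0r addr0.
have E : psi 1 = psi 0 by rewrite /psi p1 p0 /comp hp hq' hab.
have neg s : 0 <= s <= 1 -> Im (M0 (h (path s))) < 0.
  by move=> /Ipath /hh[[h0 _] _]; exact: Im_ctrans_lt0.
have := @has_rderiv_lt0 R (fun s => Im (psi s)) (fun s => Im (M0 (h (path s)))) 0 1 ltr01
  (fun s s01 => has_rderiv_Im (hpsi s s01)) neg.
by rewrite E ltxx.
Qed.

(** Both points are moved back by a short time [dl] into [dom], where they coincide. Each moved by
    at most a multiple of [dl], which is arbitrarily small. *)
Lemma charE_inj t a b : 0 <= t -> cdom t a -> cdom t b -> charE t a = charE t b -> a = b.
Proof.
move=> t0 ha hb hab.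
case: (ltgtP 0 t) t0 => [t0 _|//|t0 _]; last first.
  move: hab; rewrite -t0; apply: charE_inj_dom => //; apply: dom0 => //; [by case: ha|by case: hb].
have [d1 [K1 [d10 K10 H1]]] := char_step_back mU UB t0 ha.
have [d2 [K2 [d20 K20 H2]]] := char_step_back mU UB t0 hb.
apply/eqP; rewrite -subr_eq0 -nc_eq0 eq_le nc_ge0 andbT; apply/ler_addgt0Pr => e e0; rewrite add0r.
pose dl := Num.min (Num.min (d1 / 2) (d2 / 2)) (Num.min t (e / (K1 + K2))).
have K0 : 0 < K1 + K2 by rewrite addr_gt0.
have dl0 : 0 < dl by rewrite !lt_min t0 !divr_gt0.
have l1 : dl <= d1 / 2 by rewrite !ge_min lexx.
have l2 : dl <= d2 / 2 by rewrite !ge_min lexx orbT.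
have l3 : dl <= t by rewrite !ge_min lexx !orbT.
have l4 : dl <= e / (K1 + K2) by rewrite !ge_min lexx !orbT.
pose s := t - dl.
have s0t : 0 <= s < t by rewrite /s; apply/andP; split; lra.
have [|a' [aE a0 aG an]] := H1 s s0t; first by rewrite /s; lra.
have [|b' [bE b0 bG bn]] := H2 s s0t; first by rewrite /s; lra.
have da : dom s a' by split => //; apply: le_lt_trans aG; case: ha.
have db : dom s b' by split => //; apply: le_lt_trans bG; case: hb.
have ab : a' = b' by apply: (charE_inj_dom _ da db); [case/andP: s0t|rewrite aE bE].
have st : `|s - t| = dl by rewrite /s addrAC subrr sub0r normrN gtr0_norm.
rewrite st in an bn.
apply: le_trans (nc_distD a' _ _) _; rewrite ncBC {2}ab.
apply: le_trans (lerD an bn) _; rewrite -mulrDl mulrC -ler_pdivlMr //.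
Qed.

Lemma cpot_inj a b : 0 < Im a -> 0 < Im b -> F a = F b -> a = b.
Proof.
move=> a0 b0 ab; apply: (@charE_inj_dom 0) => //; try exact: dom0.
by rewrite !charE0.
Qed.

Lemma dom_open t z : 0 <= t -> dom t z -> exists2 dl, 0 < dl &
  forall s w, `|s - t| < dl -> nc (w - z) < dl -> dom s w.
Proof.
move=> t0 [z0 G0]; have e0 : 0 < Im (charG t z) / 2 by rewrite divr_gt0.
have [dl dl0 H] := char_continuous P mU UB t z0 e0.
exists (Num.min dl (Im z / 2)); first by rewrite lt_min dl0 divr_gt0.
move=> s w; rewrite !lt_min => /andP[sd _] /andP[wd wz].
split; first by have := Im_near wz; lra.
have [_ h] := H _ _ sd wd; have := Im_near h; lra.
Qed.

(** The level curve is followed back to time [0] by [char_back_dom] and slightly beyond [t] by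
    [char_solve]; the latter gives the strict [t < om]. *)
Lemma char_flow t z z0 : 0 <= t -> dom t z -> 0 < Im z0 -> F z0 = charE t z ->
  exists2 om, t < om & exists zeta : R -> R[i],
  [/\ zeta 0 = z0, forall s, 0 <= s < om -> dom s (zeta s) & forall s, 0 <= s < om ->
     has_vderiv [set u | 0 <= u < om] (fun s => charG s (zeta s)) s (M0 (zeta s))].
Proof.
move=> t0 hz z00 hE.
have near s w : 0 <= s -> dom s w -> charE s w = F z0 -> exists dl K, [/\ 0 < dl, 0 < K &
  forall r, `|r - s| < dl -> exists w', [/\ dom r w', charE r w' = F z0 & nc (w' - w) <= K * `|r - s|]].
  move=> s0 hw hwE.
  have [d1 [K [d10 K0 H1]]] := char_solve mU UB s0 (dom_cdom hw).
  have [d2 d20 H2] := dom_open s0 hw.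
  exists (Num.min d1 (Num.min d2 (d2 / K))), K; split => //.
    by rewrite !lt_min d10 d20 divr_gt0.
  move=> r; rewrite !lt_min => /and3P[r1 r2 r3].
  have cc : nc (F z0 - charE s w) < d1 by rewrite hwE subrr nc0.
  have [w' [w'E w'0]] := H1 r _ r1 cc; rewrite hwE subrr nc0 addr0 => w'w.
  exists w'; split => //; apply: H2 => //; apply: le_lt_trans w'w _.
  by rewrite mulrC -ltr_pdivlMr.
have [dl [K [dl0 K0 H]]] := near t z t0 hz (esym hE).
exists (t + dl); first by rewrite ltrDl.
have ex s : exists w, 0 <= s < t + dl -> dom s w /\ charE s w = F z0.
  have [s0t|] := boolP (0 <= s < t + dl); last by exists 0.
  have /andP[s0 st] := s0t.
  have [sle|slt] := leP s t.
    have [|w [wd wE]] := char_back_dom mU UB t0 hz (s := s); first by rewrite s0.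
    by exists w => _; rewrite wE hE.
  have [|w [wd wE _]] := H s; first by rewrite gtr0_norm ?subr_gt0 //; lra.
  by exists w.
have [zeta hzeta] := choice ex; exists zeta; split.
- have [|d e] := hzeta 0; first by rewrite lexx /=; lra.
  by apply: cpot_inj => //; [case: d|rewrite -e charE0].
- by move=> s /hzeta[].
move=> s sI; have /andP[s0 st] := sI; have [sd sE] := hzeta s sI.
have [d1 [K1 [d10 K10 H1]]] := near s _ s0 sd sE.
move=> e e0; have [d2 d20 H2] := charG_curve mU UB s0 (dom_cdom sd) (ltW K10) e0.
exists (Num.min d1 d2); first by rewrite lt_min d10.
move=> r rI; rewrite lt_min => /andP[r1 r2].
have [rd rE] := hzeta r rI.
have [w [wd wE wn]] := H1 r r1.
(* The pointwise choice [zeta] agrees with the local branch [w] by injectivity, and so inherits its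
   Lipschitz estimate. *)
have rw : zeta r = w.
  by apply: (charE_inj_dom _ rd wd); [case/andP: rI|rewrite rE wE].
by apply: H2 => //; rewrite ?rw // wE sE.
Qed.

End characteristic_flow.

(** * Support of the limit measure *)

Section support.
Variables (R : realType) (B : R).
Hypothesis B0 : 0 < B.

(* Equal to the identity [mu]-almost everywhere, so that the unbounded kernels
   may be composed with it. *)
Definition clamp (u : R) : R := Num.max (- B) (Num.min B u).

Lemma clamp_bound u : `|clamp u| <= B.
Proof.
rewrite ler_norml /clamp le_max lexx /= ge_max ge_min lexx /= andbT.
by rewrite (le_trans _ (ltW B0)) // oppr_le0 ltW.
Qed.

Lemma clamp_id u : u \in `[- B, B] -> clamp u = u.
Proof.
rewrite in_itv /= => /andP[h1 h2]; rewrite /clamp.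
by rewrite (min_idPr h2) (max_idPr h1).
Qed.

Lemma clamp_continuous : continuous clamp.
Proof.
move=> u; apply: (@continuous_max _ _ (cst (- B)) (fun v => Num.min B v)); first exact: cst_continuous.
by apply: (@continuous_min _ _ (cst B) id); [exact: cst_continuous|exact: cvg_id].
Qed.

Lemma clamp_measurable :
  measurable_fun [set: measurableTypeR R] (clamp : measurableTypeR R -> measurableTypeR R).
Proof. exact: continuous_measurable_fun clamp_continuous. Qed.

Variables (N : nat -> nat) (x : nat -> nat -> R) (mu : probability (measurableTypeR R) R).
Hypothesis x_bound : forall l k, (k < N l)%N -> x l k \in `[- B, B].
Hypothesis mu_cvg : weakly_cvg (fun l => empirical_measure (N l) (x l)) mu.

(** The test function [f] is continuous, bounded thanks to the cap [1], and zero exactly on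
    [[-B, B]]. Its empirical means vanish, hence so does its mean under [mu]. *)
Lemma ae_clamp : {ae mu, forall u, clamp u = u}.
Proof.
pose f (u : R) := Num.min 1 `|u - clamp u|.
have f0 u : 0 <= f u by rewrite le_min ler01 normr_ge0.
have f1 u : f u <= 1 by rewrite ge_min lexx.
have cf : continuous f.
  move=> u; apply: (@continuous_min _ _ (cst 1) (fun v => `|v - clamp v|)); first exact: cst_continuous.
  apply: (@continuous_comp _ _ _ (fun v : R => v - clamp v) Num.norm); last exact: norm_continuous.
  by apply: cvgB; [exact: cvg_id|exact: clamp_continuous].
have mf : measurable_fun [set: measurableTypeR R] (EFin \o f).
  by apply/measurable_EFinP; exact: continuous_measurable_fun.
have If l : \int[empirical_measure (N l) (x l)]_u f u = 0.
  rewrite /Rintegral /empirical_measure ge0_integral_mscale //; last by move=> u _; rewrite lee_fin.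
  rewrite ge0_integral_measure_sum //; last by move=> u _; rewrite lee_fin.
  rewrite big1 ?mule0 // => k _; rewrite integral_dirac //.
  have xk : f (x l k) = 0.
    by rewrite /f clamp_id ?x_bound // subrr normr0; apply/min_idPr.
  by rewrite /= xk mule0.
have bf : bounded_fun (f : R -> R^o).
  exists 1; split; first exact: num_real.
  by move=> y y1 u _ /=; rewrite ger0_norm // (le_trans (f1 u)) // ltW.
have := mu_cvg cf bf.
have -> : (fun n => \int[empirical_measure (N n) (x n)]_u f u) = cst 0 by apply/funext => l; rewrite If.
move=> h; have I0 : \int[mu]_u f u = 0.
  by apply/esym; apply: (cvg_unique _ (cvg_cst 0) h); exact: norm_hausdorff.
have bm : bounded_meas f.
  split; first exact: continuous_measurable_fun.
  by exists 1 => u; rewrite ger0_norm.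
have I0' : (\int[mu]_u `|(f u)%:E| = 0)%E.
  transitivity (\int[mu]_u (f u)%:E)%E.
    by apply: eq_integral => u _; rewrite gee0_abs // lee_fin.
  rewrite -[LHS]fineK; first by rewrite -[fine _]/(\int[mu]_u f u) I0.
  by apply: integrable_fin_num => //; exact: bounded_meas_integrable.
have /(ae_eq_integral_abs mu measurableT mf) := I0'.
apply: filterS => u /(_ Logic.I) [] fu.
apply/eqP; rewrite eq_sym -subr_eq0 -normr_eq0.
by move: fu; rewrite /f; case: (leP 1 `|u - clamp u|) => [_ /eqP|_ ->//]; rewrite oner_eq0.
Qed.

Lemma cauchy_integral_clamp (z : R[i]) : 0 < Im z ->
  cauchy_integral mu z = ctrans mu clamp z.
Proof.
move=> z0.
have mid : measurable_fun [set: measurableTypeR R] (id : measurableTypeR R -> measurableTypeR R) by [].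
have [[m1 _] [m2 _]] := bounded_cmeas_ckern2 mid z0.
have [[m3 _] [m4 _]] := bounded_cmeas_ckern2 clamp_measurable z0.
have [A [mA A0 sA]] := ae_clamp.
apply: complex_ext => /=; congr fine; apply: ae_eq_integral => //; try by apply/measurable_EFinP.
  by exists A; split => // u /= h; apply: sA => /= uE; apply: h => _; rewrite /ckern uE.
by exists A; split => // u /= h; apply: sA => /= uE; apply: h => _; rewrite /ckern uE.
Qed.

End support.

(** * Burgers and Loewner equations *)

Section burgers.
Variables (R : realType) (mu : probability (measurableTypeR R) R) (M : R -> cplx R -> cplx R).
Hypothesis M_burgers : burgers_solution mu M.
Implicit Types (r s t e : R) (z w a b : R[i]).

Local Notation M' := (fun t : R => derive1 (M t)).

(** The support at time [t] is unknown, whence [id] for [U]; Cauchy kernels are bounded off the real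
    axis anyway. *)
Lemma burgers_ctrans t : 0 <= t -> exists Pt : probability (measurableTypeR R) R,
  (forall z, 0 < Im z -> M t z = ctrans Pt id z) /\
  (forall z, 0 < Im z -> M' t z = ctrans' Pt id z).
Proof.
move=> t0; have [[mu_ [_ hmu]] _ _] := M_burgers.
exists (mu_ t); have h z : 0 < Im z -> M t z = ctrans (mu_ t) id z by move=> z0; exact: hmu.
split => // z z0; apply: has_cderiv_derive1.
have mid : measurable_fun [set: measurableTypeR R] (id : measurableTypeR R -> measurableTypeR R) by [].
apply: (@qdiff_cderiv _ (M t)).
apply: (@qdiff_eq _ (ctrans (mu_ t) id) _ _ _ (Im z / 2)); first by rewrite divr_gt0.
  by move=> w /Im_near wz; rewrite h //; apply: lt_le_trans wz; rewrite divr_gt0.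
exact: qdiff_ctrans.
Qed.

Let mid : measurable_fun [set: measurableTypeR R] (id : measurableTypeR R -> measurableTypeR R).
Proof. by []. Qed.

Lemma burgers_Im_lt0 t z : 0 <= t -> 0 < Im z -> Im (M t z) < 0.
Proof. by move=> /burgers_ctrans[Pt [h _]] z0; rewrite h // Im_ctrans_lt0. Qed.

Lemma burgers_taylor t a b eta : 0 <= t -> 0 < eta -> eta <= Im a -> eta <= Im b ->
  nc (M t b - M t a - (b - a) * M' t a) <= 4 / eta ^+ 3 * nc (b - a) ^+ 2.
Proof.
move=> /burgers_ctrans[Pt [h h']] e0 ea eb.
by rewrite !h ?h' ?(lt_le_trans e0) //; exact: ctrans_taylor.
Qed.

Lemma burgers_deriv_le t z eta : 0 <= t -> 0 < eta -> eta <= Im z ->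
  nc (M' t z) <= 4 / eta ^+ 2.
Proof.
move=> /burgers_ctrans[Pt [h h']] e0 ez.
by rewrite h' ?(lt_le_trans e0) //; exact: nc_ctrans'_le.
Qed.

Lemma burgers_time t z : 0 <= t -> 0 < Im z ->
  has_vderiv `[0, +oo[ (M^~ z) t (- 2 * M t z * M' t z).
Proof. by move=> t0 z0; have [_ _ h] := M_burgers; have [_ /has_deriv_withinP] := h t z t0 z0. Qed.

Lemma burgers_time_continuous t z e : 0 <= t -> 0 < Im z -> 0 < e ->
  exists2 dl, 0 < dl & forall s, 0 <= s -> `|s - t| < dl -> nc (M s z - M t z) <= e.
Proof.
move=> t0 z0 e0; have [dl dl0 H] := has_vderiv_lip (burgers_time t0 z0).
set K := nc _ + 1 in H; have K0 : 0 < K by rewrite ltr_wpDl ?nc_ge0.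
exists (Num.min dl (e / K)); first by rewrite lt_min dl0 divr_gt0.
move=> s s0; rewrite lt_min => /andP[s1 s2].
have := H s; rewrite /= in_itv /= s0 => /(_ isT s1) /le_trans; apply.
by rewrite mulrC -ler_pdivlMr // ltW.
Qed.

(* [M' t z] is a limit of difference quotients, uniformly in [t]. *)
Lemma burgers_deriv_continuous t z e : 0 <= t -> 0 < Im z -> 0 < e ->
  exists2 dl, 0 < dl & forall s, 0 <= s -> `|s - t| < dl -> nc (M' s z - M' t z) <= e.
Proof.
move=> t0 z0 e0; set eta := Im z in z0.
pose C := 4 / eta ^+ 3; have C0 : 0 < C by rewrite divr_gt0 // exprn_gt0.
(* With this step [C * h = e / 4]: each of the two Taylor errors and each of the two variations in
   time is at most [h * (e / 4)]. *)
pose h := e / (4 * C); have h0 : 0 < h by rewrite divr_gt0 // mulr_gt0.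
pose b := z + h%:C.
have Ib : Im b = eta by rewrite /b !ReImE addr0.
have bz : b - z = h%:C by rewrite /b addrAC subrr add0r.
have nbz : nc (b - z) = h by rewrite bz nc_real gtr0_norm.
have b0 : 0 < Im b by rewrite Ib.
have he : 0 < h * (e / 4) by rewrite mulr_gt0 // divr_gt0.
have [d1 d10 H1] := burgers_time_continuous t0 z0 he.
have [d2 d20 H2] := burgers_time_continuous t0 b0 he.
exists (Num.min d1 d2); first by rewrite lt_min d10.
move=> s s0; rewrite lt_min => /andP[s1 s2].
rewrite -(ler_pM2l h0) -{1}nbz -ncM.
have regroup (x1 x2 x3 x4 u1 u2 k : R[i]) : k * (u2 - u1) =
  (x1 - x2 - k * u1) - (x3 - x4 - k * u2) + ((x3 - x1) - (x4 - x2)) by ring.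
rewrite (regroup (M t b) (M t z) (M s b) (M s z) (M' t z) (M' s z) (b - z)).
have T s' : 0 <= s' -> nc (M s' b - M s' z - (b - z) * M' s' z) <= h * (e / 4).
  move=> s'0; apply: le_trans (@burgers_taylor s' z b eta s'0 z0 (lexx _) _) _; first by rewrite Ib.
  rewrite nbz -/C; have -> : e / 4 = C * h by rewrite /h; field; rewrite gt_eqF.
  by rewrite le_eqVlt; apply/orP; left; apply/eqP; ring.
apply: le_trans (ncD _ _) _.
apply: le_trans (lerD (ncB _ _) (ncB _ _)) _.
apply: le_trans (lerD (lerD (T t t0) (T s s0)) (lerD (H2 s s0 s2) (H1 s s0 s1))) _.
lra.
Qed.

(** [M] is given as differentiable in each variable separately. The joint expansion along [p]
    follows from the Taylor bound in space, uniform in time, and the continuity of [M'] in time. *)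
Lemma burgers_chain (A : set R) (p : R -> R[i]) s p' : (forall r, A r -> 0 <= r) ->
  0 <= s -> 0 < Im (p s) -> has_vderiv A p s p' ->
  has_vderiv A (fun r => M r (p r)) s (- 2 * M s (p s) * M' s (p s) + p' * M' s (p s)).
Proof.
move=> A0 s0 ps0 hp.
set z := p s in ps0 *; set eta := Im z / 2.
have eta0 : 0 < eta by rewrite divr_gt0.
have etaz : eta <= Im z by rewrite /eta; lra.
have hM : has_vderiv A (M^~ z) s (- 2 * M s z * M' s z).
  by apply: has_vderiv_subset (burgers_time s0 ps0) => r /A0 r0; rewrite /= in_itv /= r0.
have hpM : has_vderiv A (fun r => p r * M' s z) s (p' * M' s z).
  by have := has_vderivM hp (has_vderiv_cst A (M' s z) s); rewrite mulr0 addr0.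
suff hrem : has_vderiv A (fun r => (M r (p r) - M r z - (p r - z) * M' s z)) s 0.
  have := has_vderivD (has_vderivD hM hpM) (has_vderivD hrem (has_vderiv_cst A (- (z * M' s z)) s)).
  rewrite !addr0; congr (has_vderiv _ _ _ _); apply/funext => r; ring.
have [d1 d10 H1] := has_vderiv_lip hp; set K := nc p' + 1 in H1.
have K0 : 0 < K by rewrite ltr_wpDl ?nc_ge0.
pose C := 4 / eta ^+ 3; have C0 : 0 < C by rewrite divr_gt0 // exprn_gt0.
move=> e e0.
have e1 : 0 < e / 2 / K by rewrite !divr_gt0.
have [d2 d20 H2] := burgers_deriv_continuous s0 ps0 e1.
exists (Num.min (Num.min d1 d2) (Num.min (eta / K) (e / 2 / (C * K ^+ 2)))).
  have CK : 0 < C * K ^+ 2 by apply: mulr_gt0 => //; exact: exprn_gt0.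
  by rewrite !lt_min d10 d20 (divr_gt0 eta0 K0) (divr_gt0 (divr_gt0 e0 (ltr0Sn _ 1)) CK).
move=> r Ar; rewrite !lt_min => /andP[/andP[r1 r2] /andP[r3 r4]].
have r0 := A0 r Ar.
have pr := H1 r Ar r1.
have prn : nc (p r - z) < Im z / 2.
  by apply: le_lt_trans pr _; rewrite mulrC -ltr_pdivlMr.
have Ipr := Im_near prn.
have fs0 : M s (p s) - M s z - (p s - z) * M' s z = 0 by rewrite -/z !subrr mul0r subr0.
rewrite fs0 mulr0 !subr0.
have split_rem (x y h c d : R[i]) : x - y - h * d = (x - y - h * c) + h * (c - d) by ring.
rewrite (split_rem (M r (p r)) (M r z) (p r - z) (M' r z) (M' s z)).
apply: le_trans (ncD _ _) _; rewrite (ncM (p r - z)).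
have T1 := burgers_taylor r0 eta0 etaz Ipr; rewrite -/C in T1.
have T2 := H2 r r0 r2.
have b1 : C * nc (p r - z) ^+ 2 <= e / 2 * `|r - s|.
  have q : nc (p r - z) ^+ 2 <= (K * `|r - s|) ^+ 2.
    by rewrite lerXn2r ?nnegrE ?nc_ge0 // mulr_ge0 // ltW.
  apply: le_trans (ler_wpM2l (ltW C0) q) _.
  have -> : C * (K * `|r - s|) ^+ 2 = (`|r - s| * (C * K ^+ 2)) * `|r - s| by ring.
  apply: ler_wpM2r => //; rewrite -ler_pdivlMr ?(ltW r4) //.
  by rewrite mulr_gt0 // exprn_gt0.
have b2 : nc (p r - z) * nc (M' r z - M' s z) <= e / 2 * `|r - s|.
  apply: le_trans (ler_pM (nc_ge0 _) (nc_ge0 _) pr T2) _.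
  rewrite le_eqVlt; apply/orP; left; apply/eqP; field.
  by rewrite gt_eqF.
apply: le_trans (lerD (le_trans T1 b1) b2) _; lra.
Qed.

(** Along the line of velocity [2 m] that ends at [w], the deviation [f] of [M] from [m = M t w]
    satisfies [f' = - 2 M' f] and vanishes at time [t]; Gronwall's inequality makes it vanish at
    time [0]. Since [Im m < 0], the line lies above [w] at earlier times, where [M'] is bounded. *)
Lemma burgers_characteristic t w : 0 <= t -> 0 < Im w ->
  M 0 (w - (2 * t)%:C * M t w) = M t w.
Proof.
move=> t0 w0; set m := M t w; set eta := Im w in w0.
have m0 : Im m < 0 by exact: burgers_Im_lt0.
pose path s := w + (s - t)%:C * (2 * m).
have Ipath s : 0 <= s <= t -> eta <= Im (path s).
  move=> /andP[s0 st]; rewrite /path !ReImE !mul0r !addr0 -/eta.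
  have : 0 <= (t - s) * - Im m by rewrite mulr_ge0 ?subr_ge0 // oppr_ge0 ltW.
  lra.
have hpath s : has_vderiv `[0, t] path s (2 * m).
  have := has_vderivM (has_vderivD (has_vderiv_id `[0, t] s) (has_vderiv_cst `[0, t] (- t%:C) s))
    (has_vderiv_cst `[0, t] (2 * m) s).
  move=> /(has_vderivD (has_vderiv_cst `[0, t] w s)).
  rewrite mulr0 !addr0 mul1r add0r; congr (has_vderiv _ _ _ _); apply/funext => r.
  by rewrite /path rmorphB.
pose f s := M s (path s) - m.
have hf s : 0 <= s <= t -> has_vderiv `[0, t] f s (- 2 * M' s (path s) * f s).
  move=> sI; have /andP[s0 st] := sI.
  have A0 r : `[0, t]%classic r -> 0 <= r by rewrite /= in_itv /= => /andP[].
  have Is : 0 < Im (path s) := lt_le_trans w0 (Ipath s sI).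
  have := has_vderivD (burgers_chain A0 s0 Is (hpath s)) (has_vderiv_cst `[0, t] (- m) s).
  by congr (has_vderiv _ _ _ _); rewrite /f; ring.
(* [2 M'] is bounded by [8 / eta^2 = K / 2], so that the derivative of [n2] is at least [- K n2]. *)
pose K := 16 / eta ^+ 2.
have K0 : 0 < K by rewrite divr_gt0 // exprn_gt0.
pose n2 s := Re (f s) * Re (f s) + Im (f s) * Im (f s).
have n2E s : n2 s = nc (f s) ^+ 2 by rewrite nc_sqr /n2 !expr2.
pose d s := - 2 * M' s (path s) * f s.
have hn2 s : 0 <= s <= t -> has_rderiv `[0, t] n2 s
   (Re (d s) * Re (f s) + Re (f s) * Re (d s) +
    (Im (d s) * Im (f s) + Im (f s) * Im (d s))).
  move=> sI; apply: has_rderivD.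
    by apply: has_rderivM; exact: has_rderiv_Re (hf s sI).
  by apply: has_rderivM; exact: has_rderiv_Im (hf s sI).
have hexp s : has_rderiv `[0, t] (fun r => expR (K * r)) s (expR (K * s) * K).
  apply: is_derive_rderiv.
  have h1 : is_derive s 1 (fun r : R => K * r) K.
    by apply: is_derive_eq; rewrite /GRing.scale /=; ring.
  exact: (@is_derive1_comp R expR (fun r : R => K * r) s _ _ (is_derive_expR _) h1).
(* [n2 s * expR (K * s)] is nondecreasing; the signs are those of [has_rderiv_le0]. *)
have key : - (n2 t * expR (K * t)) <= - (n2 0 * expR (K * 0)).
  pose D s := (Re (d s) * Re (f s) + Re (f s) * Re (d s) +
    (Im (d s) * Im (f s) + Im (f s) * Im (d s))) * expR (K * s) +
    n2 s * (expR (K * s) * K).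
  have := @has_rderiv_le0 R (fun s => -1 * (n2 s * expR (K * s)))
    (fun s => 0 * (n2 s * expR (K * s)) + -1 * D s) 0 t t0.
  rewrite !mulN1r; apply.
    move=> s sI; apply: (@has_rderivM R _ (fun=> -1) (fun r => n2 r * expR (K * r))).
      exact: has_rderiv_cst.
    exact: has_rderivM (hn2 s sI) (hexp s).
  move=> s sI; rewrite mul0r add0r mulN1r oppr_le0.
  have -> : D s = (2 * (Re (d s) * Re (f s) + Im (d s) * Im (f s))
      + K * n2 s) * expR (K * s) by rewrite /D; ring.
  apply: mulr_ge0; last exact: expR_ge0.
  have dn : nc (d s) <= K / 2 * nc (f s).
    rewrite /d ncM; apply: ler_wpM2r; rewrite ?nc_ge0 //.
    rewrite ncM ncN nc_nat; have /andP[s0 _] := sI.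
    have := burgers_deriv_le s0 w0 (Ipath s sI); rewrite /K; lra.
  have e1 : `|Re (d s) * Re (f s)| <= K / 2 * nc (f s) * `|Re (f s)|.
    rewrite normrM; apply: ler_wpM2r => //; exact: le_trans (Re_le_nc _) dn.
  have := nc_sqr (f s); have := nc_sqr (d s); rewrite n2E.
  set a := Re _; set b := Re _; set a' := Im _; set b' := Im _.
  move=> e2 e3.
  have e4 : nc (d s) ^+ 2 <= (K / 2 * nc (f s)) ^+ 2.
    by rewrite lerXn2r ?nnegrE ?nc_ge0 // mulr_ge0 ?nc_ge0 // divr_ge0 // ltW.
  rewrite e2 exprMn e3 in e4; rewrite e3.
  have q1 : 0 <= (a + K / 2 * b) ^+ 2 by exact: sqr_ge0.
  have q2 : 0 <= (a' + K / 2 * b') ^+ 2 by exact: sqr_ge0.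
  have K2 : 0 < K / 2 by rewrite divr_gt0.
  rewrite -(pmulr_rge0 _ K2).
  suff : (a ^+ 2 + a' ^+ 2) <= (K / 2) ^+ 2 * (b ^+ 2 + b' ^+ 2) by nra.
  exact: e4.
have ft : f t = 0 by rewrite /f /path subrr mul0r addr0 subrr.
move: key; rewrite n2E ft nc0 expr0n mul0r oppr0 oppr_ge0 mulr0 expR0 mulr1 n2E => h.
have : f 0 = 0.
  apply/eqP; rewrite -nc_eq0 -sqrf_eq0 eq_le h sqr_ge0 //.
rewrite /f => /eqP; rewrite subr_eq0 => /eqP E; rewrite -[RHS]E; congr (M 0 _).
by rewrite /path sub0r rmorphN !rmorphM /= (rmorph_nat (real_complex R)); ring.
Qed.

End burgers.

(** * The Loewner flow in characteristic coordinates *)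

Section loewner.
Variables (R : realType) (mu : probability (measurableTypeR R) R) (M : R -> cplx R -> cplx R).
Hypothesis M_burgers : burgers_solution mu M.
Variables (U : R -> R) (B : R).
Hypothesis mU : measurable_fun [set: measurableTypeR R] (U : measurableTypeR R -> measurableTypeR R).
Hypothesis UB : forall u, `|U u| <= B.
Hypothesis M0E : forall z : R[i], 0 < Im z -> M 0 z = ctrans mu U z.
Implicit Types (r s t e : R) (z w a b : R[i]).

Local Notation M0 := (ctrans mu U).
Local Notation F := (cpot mu U).
Local Notation charG := (charG mu U).
Local Notation charE := (charE mu U).
Local Notation dom := (dom mu U).
Local Notation cdom := (cdom mu U).

(** [z] is the starting point of the characteristic through [w]. It lies at least as high as [w],
    because [Im (M t w) < 0]. *)
Lemma subordination t w : 0 <= t -> 0 < Im w ->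
  let z := w - (2 * t)%:C * M t w in [/\ dom t z, charG t z = w & M0 z = M t w].
Proof.
move=> t0 w0 z.
have z0 : Im w <= Im z.
  rewrite /z imB imM imC mul0r addr0 /= -[leLHS]subr0 lerD2l lerN2.
  by rewrite mulr_ge0_le0 ?mulr_ge0 // ltW // (burgers_Im_lt0 M_burgers).
have z00 := lt_le_trans w0 z0.
have Mz : M0 z = M t w by rewrite -M0E // (burgers_characteristic M_burgers).
have Gz : charG t z = w by rewrite charGE Mz subrK.
by split => //; split => //; rewrite Gz.
Qed.

Lemma charG_surj t w : 0 <= t -> 0 < Im w -> exists z, dom t z /\ charG t z = w.
Proof.
by move=> t0 w0; have [h1 h2 _] := subordination t0 w0; exists (w - (2 * t)%:C * M t w).
Qed.

Lemma burgers_charG t z : 0 <= t -> dom t z -> M t (charG t z) = M0 z.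
Proof.
move=> t0 hz; have [h1 h2 <-] := subordination t0 hz.2; congr M0.
exact: (charG_inj mU t0 (dom_cdom h1) (dom_cdom hz) h2).
Qed.

Lemma loewner_charE t z (s : \bar R) g : 0 < Im z -> 0 <= t -> (t%:E < s)%E ->
  loewner_solution M z s g -> exists w, dom t w /\ charE t w = F z.
Proof.
move=> z0 t0 ts [g0 hg].
have lt r : 0 <= r <= t -> (r%:E < s)%E by move=> /andP[_ rt]; apply: le_lt_trans ts; rewrite lee_fin.
have gI r : 0 <= r <= t -> 0 < Im (g r).
  by move=> rI; have /andP[r0 _] := rI; have [] := hg r r0 (lt r rI).
pose m r : R[i] := M r (g r).
pose zeta r := g r - (2 * r)%:C * m r.
have sub r : 0 <= r <= t -> [/\ dom r (zeta r), charG r (zeta r) = g r & M0 (zeta r) = m r].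
  by move=> rI; have /andP[r0 _] := rI; exact: subordination (gI r rI).
pose d r : R[i] := derive1 (M r) (g r).
have hgd r : 0 <= r <= t -> has_vderiv `[0, t] g r (m r).
  move=> rI; have /andP[r0 _] := rI; have [_ /has_deriv_withinP] := hg r r0 (lt r rI).
  apply: has_vderiv_subset => q /=; rewrite in_itv /= => qI; split; first by case/andP: qI.
  exact: lt.
have hm r : 0 <= r <= t -> has_vderiv `[0, t] m r (- (m r * d r)).
  move=> rI; have /andP[r0 _] := rI.
  have A0 q : `[0, t]%classic q -> 0 <= q by rewrite /= in_itv /= => /andP[].
  have := burgers_chain M_burgers A0 r0 (gI r rI) (hgd r rI).
  by congr (has_vderiv _ _ _ _); rewrite -/(m r) -/(d r); ring.
have hz r : 0 <= r <= t -> has_vderiv `[0, t] zeta r (- m r + (2 * r)%:C * (m r * d r)).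
  move=> rI.
  have h2 := has_vderivM (has_vderivM (has_vderiv_cst `[0, t] (-2) r) (has_vderiv_id `[0, t] r)) (hm r rI).
  have := has_vderivD (hgd r rI) h2.
  have -> : (fun s0 : R => g s0 + -2 * s0%:C * m s0) = zeta.
    by apply/funext => q; rewrite /zeta rmorphM /= (rmorph_nat (real_complex R)); ring.
  congr (has_vderiv _ _ _ _); rewrite rmorphM /= (rmorph_nat (real_complex R)); ring.
(* This is [charE r (zeta r)] with [m r] in place of [M0 (zeta r)], because [burgers_chain] gives
   the derivative of [m] directly. *)
pose Q r := F (zeta r) + r%:C * (m r * m r).
have hQ r : 0 <= r <= t -> has_vderiv `[0, t] Q r 0.
  move=> rI; have [dz Gz Mz] := sub r rI.
  have h1 := has_vderiv_comp (qdiff_cderiv (qdiff_cpot mu mU UB dz.1)) (hz r rI).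
  have h2 := has_vderivM (has_vderiv_id `[0, t] r) (has_vderivM (hm r rI) (hm r rI)).
  have := has_vderivD h1 h2; rewrite /comp /= -/Q.
  congr (has_vderiv _ _ _ _); rewrite Mz rmorphM /= (rmorph_nat (real_complex R)); ring.
have tI : 0 <= t <= t by rewrite t0 lexx.
have [dz Gz Mz] := sub t tI.
exists (zeta t); split => //.
have := vderiv0_cst t0 hQ; rewrite /Q charEE Mz expr2 => ->.
by rewrite (_ : 0%:C = 0) // mul0r addr0 /zeta mulr0 (_ : 0%:C = 0) // mul0r subr0 g0.
Qed.

(** For the converse, [charG] along the level curve of [char_flow] solves the Loewner equation up to
    a time beyond [t]. *)
Lemma lt_lifetime t z : 0 < Im z -> 0 <= t ->
  (t%:E < lifetime M z)%E <-> exists w, dom t w /\ charE t w = F z.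
Proof.
move=> z0 t0; split.
  by move=> /ereal_sup_gt[s [g hg] ts]; exact: loewner_charE hg.
move=> [w [wd wE]].
have [om tom [zeta [zeta0 zd zv]]] := char_flow mU UB charG_surj t0 wd z0 (esym wE).
apply: (@lt_le_trans _ _ om%:E); first by rewrite lte_fin.
apply: ereal_sup_ubound; exists (fun s => charG s (zeta s)); split.
  by rewrite charG0.
move=> s s0; rewrite lte_fin => som.
have sI : 0 <= s < om by rewrite s0.
split; first by case: (zd s sI).
apply/has_deriv_withinP; rewrite (burgers_charG s0 (zd s sI)).
apply: has_vderiv_subset (zv s sI) => r /= [r0]; rewrite lte_fin => ->.
by rewrite r0.
Qed.

End loewner.

(** * Boundedness of the hull *)

Section hull_bounded.
Variables (R : realType) (mu : probability (measurableTypeR R) R) (M : R -> cplx R -> cplx R).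
Hypothesis M_burgers : burgers_solution mu M.
Variables (U : R -> R) (B : R).
Hypothesis mU : measurable_fun [set: measurableTypeR R] (U : measurableTypeR R -> measurableTypeR R).
Hypothesis UB : forall u, `|U u| <= B.
Hypothesis M0E : forall z : R[i], 0 < Im z -> M 0 z = ctrans mu U z.
Implicit Types (r s t e : R) (z w a b : R[i]).

Local Notation M0 := (ctrans mu U).
Local Notation F := (cpot mu U).
Local Notation charG := (charG mu U).
Local Notation charE := (charE mu U).
Local Notation dom := (dom mu U).
Local Notation cdom := (cdom mu U).

(** For [nc z >= B + 2] the energy is at most [1 / 4] and [nc (M0 z)] at most [1]; the factor [Im z]
    comes from [Im (M0 z)] in [Im (M0 z ^+ 2)]. *)
Lemma Im_charE_sub t z : 0 <= t -> 0 < Im z -> B + 2 <= nc z ->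
  `|Im (charE t z) - Im (F z)| <= 4 * t * Im z.
Proof.
move=> t0 z0 zB.
have Bz : B < nc z by lra.
have I1 : energy mu U z <= 1 / 4.
  apply: le_trans (energy_le mu mU UB z0 Bz) _.
  rewrite div1r lef_pV2 ?posrE //; last by rewrite exprn_gt0 // subr_gt0.
  by have -> : 4 = 2 ^+ 2 :> R; [rewrite -natrX|rewrite lerXn2r ?nnegrE //; lra].
have m1 : nc (M0 z) <= 1.
  have := ctrans_jensen mu mU z0; have := nc_ge0 (M0 z).
  rewrite -[X in _ -> _ -> _ <= X]/(1 : R) => n0 h.
  rewrite -(@ler_pXn2r _ 2) ?nnegrE // expr1n; apply: le_trans h _; lra.
have -> : Im (charE t z) - Im (F z) = t * (2 * (Re (M0 z) * Im (M0 z))).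
  rewrite charEE imD imM imC reC mul0r addr0 expr2 imM; ring.
rewrite Im_ctrans // normrM (ger0_norm t0).
have -> : 4 * t * Im z = t * (4 * Im z) by ring.
apply: ler_wpM2l => //.
rewrite !normrM normrN !normrM (gtr0_norm z0) (gtr0_norm (energy_gt0 mu mU z0)) !(ger0_norm (ler0n _ 2)).
have r1 := le_trans (Re_le_nc (M0 z)) m1.
have e0 := ltW (energy_gt0 mu mU z0).
have q : Im z * energy mu U z <= Im z * (1 / 4) by rewrite ler_pM2l.
have q0 : 0 <= Im z * energy mu U z by rewrite mulr_ge0 // ltW.
have : `|Re (M0 z)| * (Im z * energy mu U z) <= 1 * (Im z * energy mu U z).
  by apply: ler_wpM2r.
rewrite mul1r; have := normr_ge0 (Re (M0 z)); lra.
Qed.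

(* A limit point on the real axis is excluded: there [Im charE] would tend to
   [0] or to [2 pi]. *)
Lemma char_limit (r : nat -> R) (zeta : nat -> R[i]) (c : nat -> R[i]) r' c' (D K : R) :
  B + 2 <= D -> 0 < Im c' < 2 * pi ->
  (forall n, 0 <= r n) -> (forall n, dom (r n) (zeta n)) -> (forall n, D <= nc (zeta n)) ->
  (forall n, nc (zeta n) <= K) ->
  (forall e, 0 < e -> exists N, forall n, (N <= n)%N -> `|r n - r'| < e) ->
  (forall e, 0 < e -> exists N, forall n, (N <= n)%N -> nc (c n - c') < e) ->
  (forall n, charE (r n) (zeta n) = c n) ->
  exists z, [/\ cdom r' z, D <= nc z & charE r' z = c'].
Proof.
move=> DB /andP[c0 c2] r0 hd hD hK hr hc hE.
have [l hl] := cluster_bounded hK.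
have lD : D <= nc l.
  apply/ler_addgt0Pr => e e0; have [n _ hn] := hl _ e0 0%N.
  have h1 := hD n; have h2 := nc_subD (zeta n) l; lra.
have l0 : 0 <= Im l.
  apply/ler_addgt0Pr => e e0; have [n _ hn] := hl _ e0 0%N.
  have [z0 _] := hd n.
  have := le_lt_trans (Im_le_nc _) hn; rewrite imB ltr_norml => /andP[_]; lra.
have [l00|l00] := eqVneq (Im l) 0; last first.
  have lp : 0 < Im l by rewrite lt_def l00.
  have hG n : 0 <= Im (charG (r n) (zeta n)) by case: (hd n) => _ /ltW.
  have [lE lG] := cluster_char mU UB lp hl hr hc hE hG.
  by exists l.
exfalso.
have lRe : `|Re l| = nc l.
  by rewrite -sqrtr_sqr /nc l00 expr0n addr0.
(* Three errors of size [e] add up: [c n] against [c'], [charE] against [F], and [Im F] against [0]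
   or [2 pi]. A quarter of the gap beats them. *)
pose e := Num.min (Im c') (2 * pi - Im c') / 4.
have m0 : 0 < Num.min (Im c') (2 * pi - Im c') by rewrite lt_min c0 subr_gt0.
have e0 : 0 < e by rewrite divr_gt0.
have e1 : 4 * e <= Im c'.
  by rewrite /e mulrC divfK // ge_min lexx.
have e2 : 4 * e <= 2 * pi - Im c'.
  by rewrite /e mulrC divfK // ge_min lexx orbT.
have [N1 h1] := hc _ e0; have [N2 h2] := hr _ ltr01.
have [d1 d10 H1] := Im_cpot_right mu mU UB e0.
have [d2 d20 H2] := Im_cpot_left mu mU UB e0.
have K0 : 0 < 4 * (`|r'| + 1) by rewrite mulr_gt0 // ltr_wpDl.
pose d := Num.min (Num.min d1 d2) (Num.min 1 (e / (4 * (`|r'| + 1)))).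
have d0 : 0 < d by rewrite !lt_min d10 d20 ltr01 divr_gt0.
have [n Nn hn] := hl _ d0 (maxn N1 N2).
have n1 : (N1 <= n)%N by rewrite (leq_trans _ Nn) // leq_maxl.
have n2 : (N2 <= n)%N by rewrite (leq_trans _ Nn) // leq_maxr.
have [z0 _] := hd n.
have cn := le_lt_trans (Im_le_nc _) (h1 n n1); rewrite imB ltr_norml in cn.
have rn := h2 n n2.
have rn' : r n <= `|r'| + 1.
  have := ler_norm r'; move: rn; rewrite ltr_norml => /andP[]; lra.
have Iz : Im (zeta n) < d.
  have := le_lt_trans (Im_le_nc _) hn; rewrite imB l00 subr0; exact: le_lt_trans (ler_norm _).
have Rz := le_lt_trans (Re_le_nc _) hn; rewrite reB in Rz.
move: (Iz) Rz; rewrite !lt_min => /andP[/andP[i1 i2] /andP[_ i3]] /andP[_ /andP[Rz _]].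
have nB : B + 2 <= nc (zeta n) by apply: le_trans DB (hD n).
have dE := Im_charE_sub (r0 n) z0 nB; rewrite hE in dE.
have dE' : 4 * r n * Im (zeta n) <= e.
  apply: le_trans (_ : 4 * (`|r'| + 1) * Im (zeta n) <= _).
    by rewrite ler_pM2r // ler_pM2l.
  by rewrite mulrC -ler_pdivlMr // ltW.
have := le_trans dE dE'; rewrite ler_norml => /andP[q1 q2].
move: cn => /andP[p1 p2]; move: Rz; rewrite ltr_norml => /andP[R1 R2].
have [lp|ln] := leP 0 (Re l).
  rewrite ger0_norm // in lRe.
  have : B + 1 <= Re (zeta n) by lra.
  by move=> /(H1 _ z0 i1); lra.
rewrite ltr0_norm // in lRe.
have : Re (zeta n) <= - (B + 1) by lra.
by move=> /(H2 _ z0 i2); lra.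
Qed.

(** [Re F] lies between [2 ln (nc z - B)] and [2 ln (nc z + B)]; the factor [expR 1] absorbs the
    difference of at most [1] between [charE] and [F]. *)
Lemma nc_lower t z z' (D : R) : 0 <= t -> cdom t z' -> 0 < Im z -> charE t z' = F z ->
  0 <= D -> B + expR 1 * (D + B) < nc z -> D <= nc z'.
Proof.
move=> t0 hz' z0 hE D0 hz; have [z'0 _] := hz'.
have B0 : 0 <= B := bound_ge0 UB.
have e1 : 1 <= expR 1 :> R by have := expR_ge1Dx (1 : R); lra.
have DB : 0 <= D + B by rewrite addr_ge0.
have Bz : B < nc z by apply: le_lt_trans hz; rewrite lerDl mulr_ge0 // expR_ge0.
rewrite leNgt; apply/negP => zD.
have h1 := Re_cpot_ge mu mU UB z0 Bz.
have h2 := Re_cpot_le mu mU UB z'0.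
have h3 : Re (F z) <= Re (F z') + 1.
  have : `|Re (t%:C * M0 z' ^+ 2)| <= 1.
    apply: le_trans (Re_le_nc _) _; rewrite ncM nc_real ncX ger0_norm //.
    exact: (nc_tM0 mU t0 hz').
  by rewrite -hE charEE reD ler_norml => /andP[]; lra.
have zB : 0 < nc z - B by rewrite subr_gt0.
have z'B : 0 < nc z' + B by apply: lt_le_trans z'0 _; apply: le_trans (ler_norm _) _;
  apply: le_trans (Im_le_nc _) _; rewrite lerDl.
have h4 : ln ((nc z - B) ^+ 2) <= ln ((nc z' + B) ^+ 2 * expR 1).
  by rewrite lnM ?posrE ?exprn_gt0 ?expR_gt0 // expRK; lra.
rewrite ler_ln ?posrE ?mulr_gt0 ?exprn_gt0 ?expR_gt0 // in h4.
have h5 : expR 1 * (D + B) < nc z - B by lra.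
have h6 : (nc z' + B) ^+ 2 <= (D + B) ^+ 2 by rewrite lerXn2r ?nnegrE ?(ltW z'B) //; lra.
have h7 : (expR 1 * (D + B)) ^+ 2 < (nc z - B) ^+ 2.
  by rewrite ltrXn2r ?nnegrE ?(ltW zB) // mulr_ge0 // expR_ge0.
have h8 : (D + B) ^+ 2 * expR 1 <= (expR 1 * (D + B)) ^+ 2.
  rewrite exprMn mulrC; apply: ler_wpM2r; first exact: sqr_ge0.
  by rewrite expr2 ler_peMl // expR_ge0.
have h9 : (nc z' + B) ^+ 2 * expR 1 <= (D + B) ^+ 2 * expR 1 by rewrite ler_wpM2r // expR_ge0.
lra.
Qed.

(** If the lifetime [T] were at most [t], the characteristic points at times increasing to [T] would
    cluster at some [l] in [cdom T]. Being far from the support, [l] lies in [dom T], and the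
    solution outlives [T]. *)
Lemma lifetime_gt t z : 0 <= t -> 0 < Im z ->
  B + expR 1 * ((B + 2 + 4 * t) + B) < nc z -> (t%:E < lifetime M z)%E.
Proof.
move=> t0 z0 hz; have lP := lt_lifetime M_burgers mU UB M0E z0.
rewrite ltNge; apply/negP => hT.
have T0 : (0%:E < lifetime M z)%E.
  by apply/lP => //; exists z; split; [exact: dom0|exact: charE0].
have [T TE] : exists T, lifetime M z = T%:E.
  by move: hT T0; case: (lifetime M z) => [T _ _|//|//]; exists T.
rewrite TE lee_fin in hT; rewrite TE lte_fin in T0.
pose r n := T - T / 2 ^+ n.
have rI n : 0 <= r n < T.
  have p2 : 1 <= 2 ^+ n :> R by rewrite exprn_ege1 // ler1n.
  have p2' : 0 < 2 ^+ n :> R by rewrite exprn_gt0.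
  rewrite /r subr_ge0 ler_pdivrMr // ler_peMr ?(ltW T0) //=.
  by rewrite ltrBlDr ltrDl divr_gt0.
have ex n : exists w, dom (r n) w /\ charE (r n) w = F z.
  by have /andP[a b] := rI n; apply/lP => //; rewrite TE lte_fin.
have [zeta hzeta] := choice ex.
have r0 n : 0 <= r n by case/andP: (rI n).
have B0 : 0 <= B := bound_ge0 UB.
(* [B + 2] is what [char_limit] requires; the extra [4 * t] makes
   [4 T energy <= 4 t / (2 + 4 t)^2 < 1] at the limit point. *)
pose D := B + 2 + 4 * t.
have DB : B + 2 <= D by rewrite lerDl mulr_ge0.
have D0 : 0 <= D by apply: le_trans DB; rewrite addr_ge0.
have Dz n : D <= nc (zeta n).
  by have [h1 h2] := hzeta n; exact: (nc_lower (r0 n) (dom_cdom h1) z0 h2 D0).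
have Kz n : nc (zeta n) <= B + 1 + expR (Re (F z) + 1).
  have [h1 h2] := hzeta n.
  by apply: (dom_bounded mU UB (r0 n) (dom_cdom h1)); rewrite h2.
have hr e : 0 < e -> exists N, forall n, (N <= n)%N -> `|r n - T| < e.
  move=> e0; have [N hN] := pow2_small T (divr_gt0 e0 (ltr0Sn _ 1)).
  exists N => n Nn; rewrite /r addrAC subrr add0r normrN gtr0_norm ?divr_gt0 ?exprn_gt0 //.
  by apply: le_lt_trans (hN n Nn) _; exact: half_lt.
have hc e : 0 < e -> exists N, forall n, (N <= n)%N -> nc (F z - F z) < e.
  by move=> e0; exists 0%N => n _; rewrite subrr nc0.
have cI : 0 < Im (F z) < 2 * pi.
  by rewrite (Im_cpot_gt0 mu mU UB z0) (Im_cpot_lt2pi mu mU UB z0).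
have hE n : charE (r n) (zeta n) = F z by case: (hzeta n).
have hd n : dom (r n) (zeta n) by case: (hzeta n).
have [l [lT lD lE]] := char_limit DB cI r0 hd Dz Kz hr hc hE.
have l0 := lT.1.
have : dom T l.
  apply/domP => //.
  have Bl : B < nc l by lra.
  have h := energy_le mu mU UB l0 Bl.
  have q1 : (2 + 4 * t) ^+ 2 <= (nc l - B) ^+ 2.
    rewrite lerXn2r ?nnegrE ?subr_ge0 ?(ltW Bl) // ?addr_ge0 ?mulr_ge0 //.
    by move: lD; rewrite /D; lra.
  have q2 : 0 < (2 + 4 * t) ^+ 2 by rewrite exprn_gt0 // ltr_wpDr // mulr_ge0.
  have q3 : 0 < (nc l - B) ^+ 2 by apply: lt_le_trans q1.
  apply: le_lt_trans (_ : 4 * t * (2 + 4 * t) ^- 2 < 1).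
    apply: ler_pM; rewrite ?mulr_ge0 ?(ltW T0) ?(ltW (energy_gt0 mu mU l0)) //.
      by rewrite ler_pM2l.
    by apply: le_trans h _; rewrite lef_pV2 ?posrE.
  rewrite ltr_pdivrMr // mul1r; have := sqr_ge0 t; nra.
move=> dT; have : (T%:E < lifetime M z)%E by apply/lP; [exact: ltW|exists l].
by rewrite TE ltxx.
Qed.

Lemma hull_bounded t : 0 <= t -> bounded_set (hull M t).
Proof.
move=> t0; pose K := B + expR 1 * ((B + 2 + 4 * t) + B).
exists K%:C; split; first by apply/complex_realP; exists K.
move=> y Ky z [z0 hz]; apply: le_trans (ltW Ky); rewrite ncE lecR leNgt.
apply/negP => zK; apply: hz; split => //.
exact: lifetime_gt.
Qed.

End hull_bounded.

(** * Boundary of the hull *)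

Section real_line.
Variable R : realType.
Implicit Types (a b s t e : R).

Lemma intermediate_value (f : R -> R) a b v : a <= b ->
  (forall s, a <= s <= b -> forall e, 0 < e -> exists2 dl, 0 < dl &
    forall t, a <= t <= b -> `|t - s| < dl -> `|f t - f s| < e) ->
  f a <= v <= f b -> exists2 c, a <= c <= b & f c = v.
Proof.
move=> ab hf /andP[fa fb].
pose S := [set s | a <= s <= b /\ f s <= v].
have Sa : S a by split; rewrite ?lexx.
have supS : has_sup S by split; [exists a | exists b => s [/andP[]]].
pose c := sup S.
have ac : a <= c by apply: ub_le_sup => //; case: supS.
have cb : c <= b by apply: ge_sup; [exists a|move=> s [/andP[]]].
have cab : a <= c <= b by rewrite ac.
exists c => //; apply/eqP; rewrite eq_le; apply/andP; split; rewrite leNgt; apply/negP => h.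
  have e0 : 0 < f c - v by rewrite subr_gt0.
  have [dl dl0 H] := hf c cab _ e0.
  have [s [sab fs] cs] := sup_adherent dl0 supS.
  have sc : s <= c by apply: ub_le_sup => //; case: supS.
  have sd : `|s - c| < dl.
    by rewrite distrC ger0_norm ?subr_ge0 //; move: cs; rewrite -/c; lra.
  by have := H s sab sd; rewrite ltr_norml => /andP[]; lra.
have e0 : 0 < v - f c by rewrite subr_gt0.
have [dl dl0 H] := hf c cab _ e0.
have cltb : c < b by rewrite lt_def cb andbT; apply/eqP => bc; by move: fb; rewrite bc leNgt h.
pose m := Num.min (dl / 2) (b - c).
have m0 : 0 < m by rewrite lt_min subr_gt0 cltb divr_gt0.
have mdl : m < dl by rewrite gt_min half_lt //.
have mb : c + m <= b by rewrite -lerBrDl ge_min lexx orbT.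
have am : a <= c + m <= b by rewrite mb (le_trans ac) // lerDl ltW.
have : S (c + m).
  split => //; have := H (c + m) am; rewrite addrAC subrr add0r (gtr0_norm m0) => /(_ mdl).
  by rewrite ltr_norml => /andP[_]; lra.
move=> Sm; have : c + m <= c by apply: ub_le_sup => //; case: supS.
by rewrite gerDl leNgt m0.
Qed.

Lemma open_convex_itv (W : set R) (K : R) : (exists s, W s) -> (forall s, W s -> `|s| <= K) ->
  (forall s, W s -> exists2 e, 0 < e & forall t, `|t - s| < e -> W t) ->
  (forall a b s, W a -> W b -> a <= s <= b -> W s) ->
  exists a b, a < b /\ forall s, W s <-> s \in `]a, b[.
Proof.
move=> [s0 Ws0] bd op cv.
have supW : has_sup W by split; [exists s0|exists K => s /bd; rewrite ler_norml => /andP[]].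
have infW : has_inf W by split; [exists s0|exists (- K) => s /bd; rewrite ler_norml => /andP[]].
have Win s : W s -> inf W < s < sup W.
  move=> Ws; have [e e0 He] := op s Ws.
  have W1 : W (s + e / 2).
    by apply: He; rewrite addrAC subrr add0r gtr0_norm ?divr_gt0 //; lra.
  have W2 : W (s - e / 2).
    by apply: He; rewrite addrAC subrr add0r normrN gtr0_norm ?divr_gt0 //; lra.
  have h1 : s + e / 2 <= sup W by apply: ub_le_sup => //; case: supW.
  have h2 : inf W <= s - e / 2 by apply: ge_inf => //; case: infW.
  by apply/andP; split; lra.
exists (inf W), (sup W); split; first by have /andP[] := Win _ Ws0; exact: lt_trans.
move=> s; split; first by move=> /Win; rewrite in_itv.
rewrite in_itv /= => /andP[h1 h2].
have i0 : 0 < s - inf W by rewrite subr_gt0.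
have s1 : 0 < sup W - s by rewrite subr_gt0.
have [a Wa ha] := inf_adherent i0 infW.
have [b Wb hb] := sup_adherent s1 supW.
apply: (cv a b) => //; apply/andP; split; lra.
Qed.

Lemma qdiff_power_series (h : R[i] -> R[i]) c l : qdiff h c l ->
  exists (a : nat -> R[i]) (r : R), 0 < r /\ exists K : R, forall w m, nc (w - c) < r ->
    nc (\sum_(0 <= n < m) a n * (w - c) ^+ n - h w) <= K / 2 ^+ m.
Proof.
move=> [h' [_ [rho [L [rho0 L0 H]]]]].
pose r := rho / 2; have r0 : 0 < r by rewrite divr_gt0.
have rr : r < rho by rewrite half_lt //.
pose f z := h (c + z); pose f' z := h' (c + z).
have fL (a b : R[i]) : nc a <= r -> nc b <= r -> nc (f b - f a - (b - a) * f' a) <= L * nc (b - a) ^+ 2.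
  move=> ha hb; have E : b - a = (c + b) - (c + a) by rewrite opprD addrACA subrr add0r.
  rewrite E; apply: H; rewrite addrAC subrr add0r; exact: le_lt_trans rr.
have [a [K HK]] := power_series_expansion r0 L0 fL.
exists a, (r / 2); split; first by rewrite divr_gt0.
exists K => w m wr; have := HK (w - c) m (ltW wr).
by rewrite /f (addrC c) subrK.
Qed.

End real_line.

(** * The upper boundary of the characteristic domain and its image, the boundary of the hull *)

Section hull_boundary.
Variables (R : realType) (mu : probability (measurableTypeR R) R) (M : R -> cplx R -> cplx R).
Hypothesis M_burgers : burgers_solution mu M.
Variables (U : R -> R) (B : R).
Hypothesis mU : measurable_fun [set: measurableTypeR R] (U : measurableTypeR R -> measurableTypeR R).
Hypothesis UB : forall u, `|U u| <= B.
Hypothesis M0E : forall z : R[i], 0 < Im z -> M 0 z = ctrans mu U z.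
Variable t : R.
Hypothesis tB : (B + 1) ^+ 2 <= t.
Implicit Types (s e x y : R) (z w a b : R[i]).

Local Notation M0 := (ctrans mu U).
Local Notation M0' := (ctrans' mu U).
Local Notation F := (cpot mu U).
Local Notation I := (energy mu U).
Local Notation charG := (charG mu U).
Local Notation charE := (charE mu U).
Local Notation dom := (dom mu U).
Local Notation cdom := (cdom mu U).

Let B0 : 0 <= B := bound_ge0 UB.

Let t_gt0 : 0 < t.
Proof. by apply: lt_le_trans tB; rewrite exprn_gt0 // ltr_wpDl. Qed.

Let t_ge0 : 0 <= t := ltW t_gt0.

Let surj := charG_surj M_burgers M0E.

Definition rim : set R[i] := [set a | 0 < Im a /\ Im (charG t a) = 0].

Lemma rim_cdom a : rim a -> cdom t a.
Proof. by move=> [a0 aG]; split => //; rewrite aG. Qed.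

Lemma rim_energy a : rim a -> 4 * t * I a = 1.
Proof.
move=> [a0]; rewrite (Im_charG mu mU) // => /eqP; rewrite mulf_eq0 gt_eqF //= subr_eq0 => /eqP.
by [].
Qed.

(** The threshold on [t] enters here: [energy_ge] gives [4 t <= (nc a + B)^2], hence
    [2 (B + 1) <= nc a + B]. *)
Lemma cdom_far a : cdom t a -> B + 2 <= nc a.
Proof.
move=> ha; have [a0 _] := ha; move/(cdomP mu mU t a0): ha => ha.
have h := energy_ge mu mU UB a0.
have p : 0 < nc a + B.
  by apply: lt_le_trans a0 _; apply: le_trans (ler_norm _) _; apply: le_trans (Im_le_nc _) _; rewrite lerDl.
have h1 : 4 * t * (nc a + B) ^- 2 <= 1.
  by apply: le_trans ha; rewrite ler_pM2l // mulr_gt0.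
rewrite ler_pdivrMr ?exprn_gt0 // mul1r in h1.
have h2 : (2 * (B + 1)) ^+ 2 <= (nc a + B) ^+ 2.
  by apply: le_trans h1; rewrite exprMn (_ : 2 ^+ 2 = 4 :> R) ?ler_pM2l // -natrX.
rewrite ler_pXn2r ?nnegrE ?(ltW p) ?mulr_ge0 ?addr_ge0 // in h2; lra.
Qed.

Let lifeP z : 0 < Im z -> (t%:E < lifetime M z)%E <-> exists w, dom t w /\ charE t w = F z.
Proof. by move=> z0; exact: lt_lifetime. Qed.

Let flow_open z : flow_domain M t z -> exists2 dl, 0 < dl &
  forall z', nc (z' - z) < dl -> flow_domain M t z'.
Proof.
move=> [z0' /(lifeP z0')[w [wd wE]]]; have z0 : 0 < Im z := z0'.
have [d1 [K [d10 K0 H1]]] := char_solve mU UB t_ge0 (dom_cdom wd).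
have [d2 d20 H2] := dom_open mU UB t_ge0 wd.
have [d3 [L [d30 L0 H3]]] := qdiff_lip (qdiff_cpot mu mU UB z0).
exists (Num.min (Num.min d3 (Im z / 2)) (Num.min (d1 / L) (d2 / (K * L)))).
  by rewrite !lt_min d30 !divr_gt0 // mulr_gt0.
move=> z'; rewrite !lt_min => /andP[/andP[z1 z2] /andP[z3 z4]].
have z'0 : 0 < Im z' by have := Im_near z2; lra.
split => //; apply/(lifeP z'0).
have cc : nc (z - z) <= d3 by rewrite subrr nc0 ltW.
have FF := H3 _ _ cc (ltW z1).
have tt : `|t - t| < d1 by rewrite subrr normr0.
have tt2 : `|t - t| < d2 by rewrite subrr normr0.
have Fd : nc (F z' - charE t w) < d1.
  by rewrite wE; apply: le_lt_trans FF _; rewrite mulrC -ltr_pdivlMr.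
have [w' [w'E w'0 w'w]] := H1 t (F z') tt Fd.
exists w'; split => //; apply: (H2 t _ tt2); apply: le_lt_trans w'w _.
rewrite subrr normr0 add0r wE; apply: le_lt_trans (ler_wpM2l (ltW K0) FF) _.
by rewrite mulrA mulrC -ltr_pdivlMr // mulr_gt0.
Qed.

(** A boundary point is a limit of points of the flow domain, and their witnesses in [dom t] cluster
    in [cdom t] by [char_limit]; the cluster point is not in [dom t], since the open flow domain
    misses the closure of the hull. *)
Lemma boundary_hull : boundary (hull M t) `&` upper_half_plane =
  [set z | 0 < Im z /\ exists2 a, rim a & F z = charE t a].
Proof.
apply/seteqP; split => z.
  move=> [[zc zi] z0']; have z0 : 0 < Im z := z0'.
  split => //.
  have znD : ~ flow_domain M t z.
    move=> /flow_open[dl dl0 H].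
    have nz : nbhs (z : cplx R) [set y : cplx R | nc (y - z) < dl] by apply/nbhs_cplxP; exists dl.
    by have [y [[_ yD] yz]] := zc _ nz; apply: yD; exact: H.
  have [rho [L [rho0 L0 HL]]] := qdiff_lip (qdiff_cpot mu mU UB z0).
  pose q n := Num.min rho (Im z / 2) / 2 ^+ n.
  have m0 : 0 < Num.min rho (Im z / 2) by rewrite lt_min rho0 divr_gt0.
  have q0 n : 0 < q n by rewrite divr_gt0 // exprn_gt0.
  have qm n : q n <= Num.min rho (Im z / 2).
    by rewrite ler_pdivrMr ?exprn_gt0 // ler_peMr ?(ltW m0) // exprn_ege1 // ler1n.
  have ex n : exists y : R[i] * R[i], [/\ nc (y.1 - z) < q n, dom t y.2 & charE t y.2 = F y.1].
    have [y yq yD] : exists2 y : R[i], nc (y - z) < q n & flow_domain M t y.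
      apply: contrapT => hn; apply: zi; apply/nbhs_cplxP; exists (q n) => // y yq.
      have yz : nc (y - z) < Im z / 2.
        by apply: lt_le_trans yq _; apply: le_trans (qm n) _; rewrite ge_min lexx orbT.
      split; first by have := Im_near yz; rewrite /upper_half_plane /=; lra.
      by move=> yD; apply: hn; exists y.
    have [y0 /(lifeP y0)[w [wd wE]]] := yD.
    by exists (y, w).
  have [y hy] := choice ex.
  have yrho n : nc ((y n).1 - z) <= rho.
    have [h _ _] := hy n; apply: le_trans (ltW h) _; apply: le_trans (qm n) _.
    by rewrite ge_min lexx.
  have zz : nc (z - z) <= rho by rewrite subrr nc0 ltW.
  have Fy n : nc (F (y n).1 - F z) <= L * q n.
    apply: le_trans (HL _ _ zz (yrho n)) _; rewrite ler_pM2l //.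
    by have [h _ _] := hy n; exact: ltW.
  have hc e : 0 < e -> exists N, forall n, (N <= n)%N -> nc (F (y n).1 - F z) < e.
    move=> e0; have e2 : 0 < e / 2 by rewrite divr_gt0.
    have [N hN] := pow2_small (L * Num.min rho (Im z / 2)) e2.
    exists N => n Nn; apply: le_lt_trans (Fy n) _; rewrite /q mulrA.
    by apply: le_lt_trans (hN n Nn) _; lra.
  have hr e : 0 < e -> exists N : nat, forall n, (N <= n)%N -> `|t - t| < e.
    by move=> e0; exists 0%N => n _; rewrite subrr normr0.
  have cI : 0 < Im (F z) < 2 * pi.
    by rewrite (Im_cpot_gt0 mu mU UB z0) (Im_cpot_lt2pi mu mU UB z0).
  have hd n : dom t (y n).2 by case: (hy n).
  have hE n : charE t (y n).2 = F (y n).1 by case: (hy n).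
  have hD n : B + 2 <= nc (y n).2 := cdom_far (dom_cdom (hd n)).
  have hK n : nc (y n).2 <= B + 1 + expR ((Re (F z) + L * Num.min rho (Im z / 2)) + 1).
    apply: (dom_bounded mU UB t_ge0 (dom_cdom (hd n))); rewrite hE.
    have := le_trans (Re_le_nc _) (Fy n); rewrite reB ler_norml => /andP[_ h].
    have : L * q n <= L * Num.min rho (Im z / 2) by rewrite ler_pM2l.
    lra.
  have [a [ad _ aE]] := char_limit mU UB (lexx _) cI (fun=> t_ge0) hd hD hK hr hc hE.
  exists a; last by rewrite aE.
  split; first by case: ad.
  apply/eqP; rewrite eq_le (_ : 0 <= _); last by case: ad.
  rewrite andbT leNgt; apply/negP => aG; apply: znD; split => //; apply/(lifeP z0).
  by exists a; split => //; split => //; case: ad.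
move=> [z0 [a ar aE]]; split => //.
have znD : ~ flow_domain M t z.
  move=> [_ /(lifeP z0)[w [wd wE]]].
  have wa := charE_inj mU UB surj t_ge0 (dom_cdom wd) (rim_cdom ar) (etrans wE aE).
  by have := wd.2; rewrite wa ar.2 ltxx.
split; first by apply: subset_closure; split.
move=> /nbhs_cplxP[e e0 He].
have [k [kc kq [s s0 kG]]] := qdiff_inverse (charG'_neq0 mU t_ge0 (rim_cdom ar)) (qdiff_charG mu mU t ar.1).
have z0d := dom_cdom (dom0 mu mU z0).
have [d1 [K [d10 K0 H1]]] := char_solve mU UB (lexx 0) z0d.
have [d2 [L2 [d20 L20 H2]]] := qdiff_lip kq.
have [d3 [L3 [d30 L30 H3]]] := qdiff_lip (qdiff_charE mu mU UB t ar.1).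
pose d := Num.min (Num.min (s / 2) d2) (Num.min (Num.min (d3 / L2) (Im a / 2 / L2 / 2))
   (Num.min (d1 / (L3 * L2) / 2) (e / (K * (L3 * L2)) / 2))).
have L32 : 0 < L3 * L2 by rewrite mulr_gt0.
have a0 := ar.1.
have d0 : 0 < d.
  rewrite !lt_min d20 (divr_gt0 d30 L20) (divr_gt0 s0 (ltr0Sn _ 1)).
  rewrite (divr_gt0 (divr_gt0 (divr_gt0 a0 (ltr0Sn _ 1)) L20) (ltr0Sn _ 1)).
  rewrite (divr_gt0 (divr_gt0 d10 L32) (ltr0Sn _ 1)).
  by rewrite (divr_gt0 (divr_gt0 e0 (mulr_gt0 K0 L32)) (ltr0Sn _ 1)).
(* Lifting [charG t a] off the real axis gives a point of [dom t] near [a]. Its [charE] value is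
   [F z'] with [z'] within [e] of [z], so that [z'] survives time [t] and [z] is not interior to the
   hull. *)
pose w := charG t a + (0 +i* d).
have wa : w - charG t a = 0 +i* d by rewrite /w addrAC subrr add0r.
have nw : nc (w - charG t a) = d by rewrite wa /nc /= expr0n add0r sqrtr_sqr gtr0_norm.
have l1 : d <= s / 2 by rewrite !ge_min lexx.
have l2 : d <= d2 by rewrite !ge_min lexx orbT.
have l3 : d <= d3 / L2 by rewrite !ge_min lexx !orbT.
have l4 : d <= Im a / 2 / L2 / 2 by rewrite !ge_min lexx !orbT.
have l5 : d <= d1 / (L3 * L2) / 2 by rewrite !ge_min lexx !orbT.
have l6 : d <= e / (K * (L3 * L2)) / 2 by rewrite !ge_min lexx !orbT.
have Gk : charG t (k w) = w by apply: kG; rewrite nw; lra.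
have kw : nc (k w - a) <= L2 * d.
  have cc : nc (charG t a - charG t a) <= d2 by rewrite subrr nc0 ltW.
  by have := H2 _ w cc; rewrite nw kc; apply.
have kI : 0 < Im (k w).
  have : nc (k w - a) < Im a / 2.
    apply: le_lt_trans kw _; rewrite mulrC -ltr_pdivlMr //.
    apply: le_lt_trans l4 _; rewrite ltr_pdivrMr // ltr_pMr ?ltr1n // divr_gt0 // divr_gt0 //.
  by move=> /Im_near; lra.
have kd : dom t (k w).
  split; first exact: kI.
  by rewrite Gk /w imD ar.2 add0r.
have Ek : nc (charE t (k w) - charE t a) <= L3 * L2 * d.
  have cc : nc (a - a) <= d3 by rewrite subrr nc0 ltW.
  have kd3 : nc (k w - a) <= d3 by apply: le_trans kw _; rewrite mulrC -ler_pdivlMr.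
  by apply: le_trans (H3 _ _ cc kd3) _; rewrite -mulrA ler_pM2l.
have EF : nc (charE t (k w) - charE 0 z) < d1.
  rewrite charE0 aE; apply: le_lt_trans Ek _; rewrite mulrC -ltr_pdivlMr //.
  by apply: le_lt_trans l5 _; rewrite ltr_pdivrMr // ltr_pMr ?ltr1n // divr_gt0.
have s00 : `|0 - 0 : R| < d1 by rewrite subrr normr0.
have [z' [z'E z'0 z'z]] := H1 0 _ s00 EF.
have z'e : nc (z' - z) < e.
  apply: le_lt_trans z'z _; rewrite subrr normr0 add0r charE0 aE.
  apply: le_lt_trans (ler_wpM2l (ltW K0) Ek) _; rewrite mulrA mulrC -ltr_pdivlMr ?mulr_gt0 //.
  by apply: le_lt_trans l6 _; rewrite ltr_pdivrMr // ltr_pMr ?ltr1n // divr_gt0 // mulr_gt0.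
have [_] := He z' z'e; apply; split => //; apply/(lifeP z'0).
by exists (k w); split => //; rewrite -z'E charE0.
Qed.

Lemma energy_decr x y y' : 0 < y -> y < y' -> I (x +i* y') < I (x +i* y).
Proof.
move=> y0 yy'; have y'0 := lt_trans y0 yy'.
apply: mean_lt; try exact: bounded_meas_nc_ckern.
move=> u; rewrite !nc_ckern_sqr /=.
have p : 0 < (x - U u) ^+ 2 + y ^+ 2 by rewrite ltr_wpDl ?sqr_ge0 // exprn_gt0.
have q : 0 < (x - U u) ^+ 2 + y' ^+ 2 by rewrite ltr_wpDl ?sqr_ge0 // exprn_gt0.
by rewrite ltf_pV2 ?posrE // ltrD2l ltrXn2r ?nnegrE ?(ltW y0) ?(ltW y'0).
Qed.

Lemma rim_unique x y y' : 0 < y -> 0 < y' -> rim (x +i* y) -> rim (x +i* y') -> y = y'.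
Proof.
move=> y0 y'0 /rim_energy h /rim_energy h'.
have t4 : 0 < 4 * t by rewrite mulr_gt0.
have [yy'|yy'|//] := ltgtP y y'.
  by have := energy_decr x y0 yy'; rewrite -(ltr_pM2l t4) h h' ltxx.
by have := energy_decr x y'0 yy'; rewrite -(ltr_pM2l t4) h h' ltxx.
Qed.

Lemma Im_charG_sign x y y' : 0 < y -> rim (x +i* y) -> 0 < y' ->
  (y' < y -> Im (charG t (x +i* y')) < 0) /\
  (y < y' -> 0 < Im (charG t (x +i* y'))).
Proof.
move=> y0 /rim_energy h y'0.
have t4 : 0 < 4 * t by rewrite mulr_gt0.
split => yy'; rewrite (Im_charG mu mU) //.
  have := energy_decr x y'0 yy'; rewrite -(ltr_pM2l t4) h => h'.
  by rewrite pmulr_rlt0 // subr_lt0.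
have := energy_decr x y0 yy'; rewrite -(ltr_pM2l t4) h => h'.
by rewrite pmulr_rgt0 // subr_gt0.
Qed.

Lemma rim_above x y : 0 < y -> 1 <= 4 * t * I (x +i* y) -> exists2 y', 0 < y' & rim (x +i* y').
Proof.
move=> y0 h.
(* High enough that [4 t <= y1^2], while the energy at height [y1] is at most [y1^-2]. *)
pose y1 := y + 1 + 4 * t.
have y1y : y <= y1 by rewrite /y1 -addrA lerDl addr_ge0 // mulr_ge0.
have hi : 0 <= Im (charG t (x +i* y1)).
  have y10 : 0 < y1 by apply: lt_le_trans y1y.
  rewrite (Im_charG mu mU) // pmulr_rge0 // subr_ge0.
  have I1 : I (x +i* y1) <= y1 ^- 2.
    rewrite -(mean_cst mu (y1 ^- 2)); apply: mean_le.
    - exact: bounded_meas_nc_ckern.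
    - exact: bounded_meas_cst.
    move=> u; rewrite nc_ckern_sqr /= lef_pV2 ?posrE ?exprn_gt0 ?lerDr ?sqr_ge0 //.
    by rewrite ltr_wpDl ?sqr_ge0 // exprn_gt0.
  apply: le_trans (_ : 4 * t * y1 ^- 2 <= 1).
    by rewrite ler_pM2l // mulr_gt0.
  rewrite ler_pdivrMr ?exprn_gt0 // mul1r /y1; have := t_gt0; nra.
have lo : Im (charG t (x +i* y)) <= 0.
  by rewrite (Im_charG mu mU) // pmulr_rle0 // subr_le0.
have cont s : y <= s <= y1 -> forall e, 0 < e -> exists2 dl, 0 < dl & forall s', y <= s' <= y1 ->
    `|s' - s| < dl -> `|Im (charG t (x +i* s')) - Im (charG t (x +i* s))| < e.
  move=> sI e e0; have /andP[s1 _] := sI; have s0 := lt_le_trans y0 s1.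
  have [dl dl0 H] := char_continuous mu mU UB t (s0 : 0 < Im (x +i* s)) e0.
  exists dl => // s' _ ss'.
  have tt : `|t - t| < dl by rewrite subrr normr0.
  have nn : nc ((x +i* s') - (x +i* s)) < dl.
    by apply: le_lt_trans (nc_le_ReIm _) _; rewrite reB imB /= subrr normr0 add0r.
  have [_ h'] := H _ _ tt nn.
  by rewrite -imB; exact: le_lt_trans (Im_le_nc _) h'.
have lohi : Im (charG t (x +i* y)) <= 0 <= Im (charG t (x +i* y1)) by rewrite lo hi.
have [s sI E] := intermediate_value y1y cont lohi.
have /andP[s1 _] := sI; exists s; first exact: lt_le_trans s1.
by split => //; exact: lt_le_trans s1.
Qed.

(** At height [1] above [[-B, B]] the energy is at least [1 / (4 B^2 + 1)], which is at least
    [1 / (4 t)]. *)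
Lemma rim_over x : `|x| <= B -> exists2 y, 0 < y & rim (x +i* y).
Proof.
move=> xB; apply: (@rim_above x 1) => //.
have z0 : 0 < Im (x +i* 1) by exact: ltr01.
have h : (4 * t)^-1 <= I (x +i* 1).
  rewrite -(mean_cst mu ((4 * t)^-1)); apply: mean_le.
  - exact: bounded_meas_cst.
  - exact: bounded_meas_nc_ckern.
  move=> u; rewrite nc_ckern_sqr /= lef_pV2 ?posrE ?mulr_gt0 //; last first.
    by rewrite ltr_wpDl ?sqr_ge0 // expr1n.
  have /andP[u1 u2] := U_bounds UB u.
  move: xB; rewrite ler_norml => /andP[x1 x2].
  have : (x - U u) ^+ 2 <= (2 * B) ^+ 2.
    rewrite -ler_sqrt ?exprn_ge0 ?mulr_ge0 // !sqrtr_sqr (ger0_norm (mulr_ge0 _ _)) //.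
    by rewrite ler_norml; apply/andP; split; lra.
  rewrite expr1n; move: tB; nra.
have t4 : 0 < 4 * t by rewrite mulr_gt0.
by have := ler_wpM2l (ltW t4) h; rewrite mulfV // gt_eqF.
Qed.

(** Outside [[-B, B]], moving horizontally towards the support decreases every [|x - U u|] and so
    increases the energy; [rim_above] then applies at the height of the outer rim point. *)
Let rim_between a b x : rim a -> rim b -> Re a <= x <= Re b ->
  exists2 y, 0 < y & rim (x +i* y).
Proof.
move=> ra rb /andP[ax xb].
have [xB|xB] := leP (`|x|) B; first exact: rim_over.
have side c : rim c -> (forall u, (x - U u) ^+ 2 <= (Re c - U u) ^+ 2) ->
    exists2 y, 0 < y & rim (x +i* y).
  move=> rc hx; have c0 := rc.1; apply: (rim_above c0).
  rewrite -[leLHS](rim_energy rc) ler_pM2l ?mulr_gt0 //; apply: mean_le.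
  - exact: bounded_meas_nc_ckern.
  - exact: bounded_meas_nc_ckern.
  move=> u; rewrite !nc_ckern_sqr /= lef_pV2 ?posrE ?ltr_wpDl ?sqr_ge0 ?exprn_gt0 //.
  by rewrite lerD2r.
have [x0|x0] := leP 0 x.
  rewrite ger0_norm // in xB.
  apply: (side b rb) => u; have /andP[u1 u2] := U_bounds UB u.
  by rewrite lerXn2r ?nnegrE; lra.
rewrite ltr0_norm // in xB.
apply: (side a ra) => u; have /andP[u1 u2] := U_bounds UB u.
by rewrite -(sqrrN (x - _)) -(sqrrN (Re a - _)) lerXn2r ?nnegrE; lra.
Qed.

Definition rim_coord : set R := [set s | exists2 a, rim a & charG t a = s%:C].

Lemma rim_coordE a : rim a -> charG t a = (Re (charG t a))%:C.
Proof. by move=> [_ h]; apply: complex_ext. Qed.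

(** Between two rim points the rim is the graph of a continuous function [y], and the intermediate
    value theorem applies to [Re (charG t)] along it. *)
Lemma rim_coord_convex s1 s2 s : rim_coord s1 -> rim_coord s2 -> s1 <= s <= s2 -> rim_coord s.
Proof.
move=> [a ra aG] [b rb bG] /andP[sa sb].
have main c d : rim c -> rim d -> Re c <= Re d ->
    (Re (charG t c) <= s <= Re (charG t d)) ||
    (Re (charG t d) <= s <= Re (charG t c)) -> rim_coord s.
  move=> rc rd cd hs.
  have [y hy] : exists y : R -> R, forall x, Re c <= x <= Re d ->
      0 < y x /\ rim (x +i* y x).
    have H x : exists y, Re c <= x <= Re d -> 0 < y /\ rim (x +i* y).
      have [xI|] := boolP (Re c <= x <= Re d); last by exists 0.
      by have [y y0 yr] := rim_between rc rd xI; exists y.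
    by have [y hy] := choice H; exists y.
  have yE (e' : R[i]) : rim e' -> Re c <= Re e' <= Re d ->
      Re e' +i* y (Re e') = e'.
    move=> re eI; have [y0 yr] := hy _ eI; apply: complex_ext => //=.
    have re' : rim (Re e' +i* Im e') by case: (e') re.
    exact: (rim_unique y0 re.1 yr re').
  pose f x := Re (charG t (x +i* y x)).
  have ycont x0 : Re c <= x0 <= Re d -> forall e, 0 < e -> exists2 dl, 0 < dl &
      forall x, Re c <= x <= Re d -> `|x - x0| < dl -> `|y x - y x0| < e.
    move=> x0I e e0; have [y0 yr] := hy _ x0I.
    (* The signs of [Im (charG t)] at heights [y x0 - e1] and [y x0 + e1] persist for nearby [x] and
       trap [y x]; the second bound keeps the lower height positive. *)
    pose e1 := Num.min (e / 2) (y x0 / 2).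
    have e10 : 0 < e1 by rewrite lt_min !divr_gt0.
    have e1e : e1 < e by rewrite gt_min half_lt //.
    have e1y : e1 < y x0 by rewrite gt_min [X in _ || X]half_lt // // orbT.
    have lo0 : 0 < y x0 - e1 by rewrite subr_gt0.
    have hi0 : 0 < y x0 + e1 by rewrite addr_gt0.
    have lo : Im (charG t (x0 +i* (y x0 - e1))) < 0.
      by apply: (Im_charG_sign y0 yr lo0).1; rewrite gtrBl.
    have hi : 0 < Im (charG t (x0 +i* (y x0 + e1))).
      by apply: (Im_charG_sign y0 yr hi0).2; rewrite ltrDl.
    have lo' : 0 < - Im (charG t (x0 +i* (y x0 - e1))) by rewrite oppr_gt0.
    have [dl1 dl10 H1] := char_continuous mu mU UB t (lo0 : 0 < Im (x0 +i* (y x0 - e1))) lo'.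
    have [dl2 dl20 H2] := char_continuous mu mU UB t (hi0 : 0 < Im (x0 +i* (y x0 + e1))) hi.
    exists (Num.min dl1 dl2); first by rewrite lt_min dl10.
    move=> x xI; rewrite lt_min => /andP[x1 x2]; have [yx0 yxr] := hy _ xI.
    have nn q dl : `|x - x0| < dl -> nc ((x +i* q) - (x0 +i* q)) < dl.
      move=> xd; apply: le_lt_trans (nc_le_ReIm _) _.
      by rewrite reB imB /= subrr normr0 addr0.
    have tt dl : 0 < dl -> `|t - t| < dl by rewrite subrr normr0.
    have [_ G1] := H1 _ _ (tt _ dl10) (nn (y x0 - e1) _ x1).
    have [_ G2] := H2 _ _ (tt _ dl20) (nn (y x0 + e1) _ x2).
    have := le_lt_trans (Im_le_nc _) G1; rewrite imB ltr_norml => /andP[_ g1].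
    have := le_lt_trans (Im_le_nc _) G2; rewrite imB ltr_norml => /andP[g2 _].
    have g1' : Im (charG t (x +i* (y x0 - e1))) < 0.
      by move: g1; rewrite -[X in _ < X]add0r ltrD2r.
    have g2' : 0 < Im (charG t (x +i* (y x0 + e1))).
      by move: g2; rewrite -[X in X < _]add0r ltrD2r.
    have k1 : y x0 - e1 <= y x.
      rewrite leNgt; apply/negP => k; have := (Im_charG_sign yx0 yxr lo0).2 k.
      by rewrite ltNge (ltW g1').
    have k2 : y x <= y x0 + e1.
      rewrite leNgt; apply/negP => k; have := (Im_charG_sign yx0 yxr hi0).1 k.
      by rewrite ltNge (ltW g2').
    rewrite ltr_norml; apply/andP; split.
      by rewrite ltrBrDl; apply: lt_le_trans k1; rewrite ltrD2l ltrN2.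
    by rewrite ltrBlDl; apply: le_lt_trans k2 _; rewrite ltrD2l.
  have fcont x0 : Re c <= x0 <= Re d -> forall e, 0 < e -> exists2 dl, 0 < dl &
      forall x, Re c <= x <= Re d -> `|x - x0| < dl -> `|f x - f x0| < e.
    move=> x0I e e0; have [y0 yr] := hy _ x0I.
    have [d1 d10 H1] := char_continuous mu mU UB t (y0 : 0 < Im (x0 +i* y x0)) e0.
    have d12 : 0 < d1 / 2 by rewrite divr_gt0.
    have [d2 d20 H2] := ycont x0 x0I _ d12.
    exists (Num.min (d1 / 2) d2); first by rewrite lt_min d12.
    move=> x xI; rewrite lt_min => /andP[x1 x2].
    have nn : nc ((x +i* y x) - (x0 +i* y x0)) < d1.
      apply: le_lt_trans (nc_le_ReIm _) _; rewrite reB imB /=.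
      by rewrite (splitr d1); apply: ltrD => //; exact: H2.
    have tt : `|t - t| < d1 by rewrite subrr normr0.
    have [_ G1] := H1 _ _ tt nn.
    by rewrite /f -reB; exact: le_lt_trans (Re_le_nc _) G1.
  have cI : Re c <= Re c <= Re d by rewrite lexx.
  have dI : Re c <= Re d <= Re d by rewrite lexx andbT.
  have fc : f (Re c) = Re (charG t c) by rewrite /f yE.
  have fd : f (Re d) = Re (charG t d) by rewrite /f yE.
  have [x xI fx] : exists2 x, Re c <= x <= Re d & f x = s.
    case/orP: hs => hs.
      by apply: intermediate_value => //; rewrite fc fd.
    have [||x xI fx] := @intermediate_value R (fun x => - f x) _ _ (- s) cd.
    - move=> x0 x0I e e0; have [dl dl0 H] := fcont x0 x0I e e0; exists dl => // x xI xx.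
      by rewrite -opprD normrN; exact: H.
    - by rewrite fc fd !lerN2 andbC.
    - by exists x => //; apply: oppr_inj.
  have [y0 yr] := hy _ xI; exists (x +i* y x) => //.
  by rewrite (rim_coordE yr) -/(f x) fx.
have [ab|ba] := leP (Re a) (Re b).
  by apply: (main a b) => //; rewrite aG bG /= sa sb.
by apply: (main b a) => //; [exact: ltW|rewrite aG bG /= sa sb orbT].
Qed.

(** On the rim [energy_le] gives [(nc a - B)^2 <= 4 t] once [nc a > B], and [t |M0|^2 <= 1] bounds
    the shift [2 t M0] by [2 (1 + t)]. *)
Lemma rim_coord_bounded s : rim_coord s -> `|s| <= B + 1 + 4 * t + 2 * (1 + t).
Proof.
move=> [a ra aG]; have a0 := ra.1; have aI := rim_energy ra.
have m1 := nc_tM0 mU t_ge0 (rim_cdom ra).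
have aB : nc a <= B + 1 + 4 * t.
  have [aB|Ba] := leP (nc a) B; first by rewrite -addrA; apply: ler_wpDr => //; rewrite addr_ge0 // mulr_ge0.
  have p : 0 < nc a - B by rewrite subr_gt0.
  have h : 1 <= 4 * t * (nc a - B) ^- 2.
    by rewrite -[leLHS]aI ler_pM2l ?mulr_gt0 //; exact: energy_le.
  rewrite ler_pdivlMr ?exprn_gt0 // mul1r in h.
  have := sqr_ge0 (nc a - B - 1); nra.
have m2 : t * nc (M0 a) <= 1 + t.
  have := sqr_ge0 (nc (M0 a) - 1); have := t_gt0; have := nc_ge0 (M0 a); nra.
rewrite -(nc_real s) -aG; apply: le_trans (ncD _ _) _.
rewrite ncM nc_real ger0_norm ?mulr_ge0 // -mulrA.
by apply: lerD => //; rewrite ler_pM2l.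
Qed.

Lemma rim_coord_inh : exists s, rim_coord s.
Proof.
have [|y y0 yr] := @rim_over 0; first by rewrite normr0.
by exists (Re (charG t (0 +i* y))), (0 +i* y); last exact: rim_coordE.
Qed.

(** The pair holds the rim point over [s] and the corresponding boundary point of the hull, reached
    by following the level curve back to time [0]. Outside [rim_coord] it is a dummy. *)
Let gamma_ex s : exists p : R[i] * R[i], rim_coord s ->
  [/\ rim p.1, charG t p.1 = s%:C, 0 < Im p.2 & F p.2 = charE t p.1].
Proof.
have [[a ra aG]|nW] := pselect (rim_coord s); last by exists (0, 0).
have [|z [zd zE]] := char_back mU UB t_gt0 (rim_cdom ra) (s := 0).
  by rewrite lexx t_gt0.
by exists (a, z) => _; split => //=; [case: zd|rewrite -zE charE0].
Qed.

(* Near [s0] the curve is the restriction to the real axis of a holomorphic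
   function, namely [F^-1 \o charE t \o (charG t)^-1]. *)
Lemma rim_curve_local (p : R -> R[i] * R[i]) s0 :
  (forall s, rim_coord s ->
    [/\ rim (p s).1, charG t (p s).1 = s%:C, 0 < Im (p s).2 & F (p s).2 = charE t (p s).1]) ->
  rim_coord s0 -> exists h l, [/\ l != 0, qdiff h s0%:C l & exists2 dl, 0 < dl &
    forall s, `|s - s0| < dl -> rim_coord s /\ (p s).2 = h s%:C].
Proof.
move=> hp Ws0; have [ra aG z0 zE] := hp s0 Ws0.
set a := (p s0).1 in ra aG zE; set z := (p s0).2 in z0 zE.
have G0 := charG'_neq0 mU t_ge0 (rim_cdom ra); have E0 := charE'_neq0 mU t_ge0 (rim_cdom ra).
have [k [kc kq [d1 d10 kG]]] := qdiff_inverse G0 (qdiff_charG mu mU t ra.1).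
have F0 := ctrans_neq0 mu mU z0.
have [j [jc jq [d2 d20 jF]]] := qdiff_inverse F0 (qdiff_cpot mu mU UB z0).
rewrite aG in kc kq kG; rewrite zE in jc jq jF.
have kq' : qdiff (charE t) (k s0%:C) (M0 a * (1 + (2 * t)%:C * M0' a)).
  by rewrite kc; exact: (qdiff_charE mu mU UB t ra.1).
have q1 := qdiff_comp kq kq'.
have jq' : qdiff j ((charE t \o k) s0%:C) (M0 z)^-1 by rewrite /comp kc.
have q2 := qdiff_comp q1 jq'.
exists (j \o (charE t \o k)), ((M0 z)^-1 * (M0 a * (1 + (2 * t)%:C * M0' a) * (1 + (2 * t)%:C * M0' a)^-1)).
split; last 1 first.
- have [r1 [K1 [r10 K10 H1]]] := qdiff_lip kq.
  have [r2 [K2 [r20 K20 H2]]] := qdiff_lip q1.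
  have [r3 [K3 [r30 K30 H3]]] := qdiff_lip q2.
  have a0 := ra.1.
  pose d := Num.min (Num.min (Num.min d1 r1) (Num.min r2 r3))
     (Num.min (Im a / 2 / K1) (Num.min (d2 / K2) (Im z / 2 / K3))).
  exists d.
    rewrite !lt_min d10 r10 r20 r30 (divr_gt0 d20 K20).
    by rewrite (divr_gt0 (divr_gt0 a0 (ltr0Sn _ 1)) K10) (divr_gt0 (divr_gt0 z0 (ltr0Sn _ 1)) K30).
  move=> s; rewrite !lt_min => /andP[/andP[/andP[s1 s2] /andP[s3 s4]] /and3P[s5 s6 s7]].
  have ns : nc (s%:C - s0%:C) = `|s - s0| by rewrite -rmorphB nc_real.
  have cc r : 0 < r -> nc (s0%:C - s0%:C) <= r by rewrite subrr nc0; exact: ltW.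
  have Gk : charG t (k s%:C) = s%:C by apply: kG; rewrite ns.
  have kI : 0 < Im (k s%:C).
    have : nc (k s%:C - a) < Im a / 2.
      rewrite -kc; apply: le_lt_trans (H1 _ _ (cc _ r10) (_ : nc (s%:C - s0%:C) <= r1)) _.
        by rewrite ns ltW.
      by rewrite ns mulrC -ltr_pdivlMr // kc.
    by move=> /Im_near; lra.
  have rk : rim (k s%:C) by split => //; rewrite Gk.
  have Ws : rim_coord s by exists (k s%:C).
  split => //.
  have [ra' aG' z0' zE'] := hp s Ws.
  have pk : (p s).1 = k s%:C.
    by apply: (charG_inj mU t_ge0 (rim_cdom ra') (rim_cdom rk)); rewrite aG' Gk.
  have Fj : F (j (charE t (k s%:C))) = charE t (k s%:C).
    apply: jF; have := H2 _ s%:C (cc _ r20); rewrite ns => /(_ (ltW s3)).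
    rewrite /comp kc => /le_lt_trans; apply.
    by rewrite mulrC -ltr_pdivlMr.
  have jI : 0 < Im (j (charE t (k s%:C))).
    have : nc (j (charE t (k s%:C)) - z) < Im z / 2.
      have := H3 _ s%:C (cc _ r30); rewrite ns => /(_ (ltW s4)).
      rewrite /comp kc jc => /le_lt_trans; apply.
      by rewrite mulrC -ltr_pdivlMr.
    by move=> /Im_near; lra.
  by apply: (cpot_inj mU UB surj z0' jI); rewrite zE' Fj pk.
- by apply: mulf_neq0; [rewrite invr_eq0|apply: mulf_neq0; rewrite ?invr_eq0].
- exact: q2.
Qed.

Lemma boundary_hull_curve : analytic_curve (boundary (hull M t) `&` upper_half_plane).
Proof.
rewrite boundary_hull.
have [p hp] := choice gamma_ex.
have loc := fun s0 => @rim_curve_local p s0 hp.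
have op s : rim_coord s -> exists2 e, 0 < e & forall s', `|s' - s| < e -> rim_coord s'.
  by move=> /loc[h [l [_ _ [dl dl0 H]]]]; exists dl => // s' /H[].
have [a [b [ab Wab]]] := open_convex_itv rim_coord_inh rim_coord_bounded op rim_coord_convex.
exists a, b, (fun s => (p s).2); split => //.
- move=> s0; rewrite /= => /Wab /loc[h [l [_ hq [dl dl0 H]]]].
  have [c [r [r0 [K HK]]]] := qdiff_power_series hq.
  exists c, (Num.min r dl); split; first by rewrite lt_min r0.
  move=> s; rewrite lt_min => /andP[s1 s2]; have [_ ->] := H s s2.
  apply/cvg_cplxP => e e0.
  have e2 : 0 < e / 2 by rewrite divr_gt0.
  have [N hN] := pow2_small K e2.
  exists N => // m /= Nm; rewrite /series /=.
  have ns : nc (s%:C - s0%:C) < r by rewrite -rmorphB nc_real.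
  under eq_bigr => n _ do rewrite rmorphXn rmorphB.
  apply: le_lt_trans (HK s%:C m ns) _; apply: le_lt_trans (hN m Nm) _; lra.
- move=> s /Wab Ws; have [h [l [l0 hq [dl dl0 H]]]] := loc s Ws.
  exists l => //; apply/has_deriv_withinP => e e0.
  have [d1 d10 H1] := qdiff_cderiv hq e0.
  exists (Num.min dl d1); first by rewrite lt_min dl0.
  move=> s' _; rewrite lt_min => /andP[s1 s2].
  have ss : `|s - s| < dl by rewrite subrr normr0.
  have [_ ->] := H s' s1; have [_ ->] := H s ss.
  by rewrite -(nc_real (s' - s)) rmorphB; apply: H1; rewrite -rmorphB nc_real.
- move=> s1 s2; rewrite !inE /= => /Wab /hp[r1 G1 _ E1] /Wab /hp[r2 G2 _ E2] h.
  have : (p s1).1 = (p s2).1.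
    by apply: (charE_inj mU UB surj t_ge0 (rim_cdom r1) (rim_cdom r2)); rewrite -E1 -E2 h.
  by move=> h'; apply: complexI; rewrite -G1 -G2 h'.
- apply/seteqP; split => z /=.
    move=> [z0 [c rc zE]]; exists (Re (charG t c)).
      by apply/Wab; exists c => //; exact: rim_coordE.
    have Wc : rim_coord (Re (charG t c)) by exists c => //; exact: rim_coordE.
    have [r1 G1 z1 E1] := hp _ Wc.
    apply: (cpot_inj mU UB surj z1 z0); rewrite E1 zE; congr (charE t _).
    by apply: (charG_inj mU t_ge0 (rim_cdom r1) (rim_cdom rc)); rewrite G1 -rim_coordE.
  move=> [s /Wab /hp[r1 G1 z1 E1] <-]; split => //.
  by exists (p s).1.
Qed.

End hull_boundary.

Theorem theorem1p2 (R : realType)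
    (N : nat -> nat) (x : nat -> nat -> R) (B : R)
    (mu : probability (measurableTypeR R) R)
    (M g : R -> cplx R -> cplx R)
    (N_gt0 : forall l, (0 < N l)%N)
    (N_incr : forall l m, (l < m)%N -> (N l < N m)%N)
    (x_incr : forall l j k, (j < k)%N -> (k < N l)%N -> x l j < x l k)
    (B_gt0 : 0 < B)
    (x_bound : forall l k, (k < N l)%N -> x l k \in `[- B, B])
    (mu_cvg : weakly_cvg (fun l => empirical_measure (N l) (x l)) mu)
    (M_burgers : burgers_solution mu M)
    (g_flow : loewner_flow M g) :
  (forall t : R, 0 <= t -> bounded_set (hull M t)) /\
  (exists T : R, 0 < T /\ forall t : R, T < t ->
     analytic_curve (boundary (hull M t) `&` upper_half_plane)).
Proof.
have mU := clamp_measurable B.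
have UB := clamp_bound B_gt0.
have M0E z : 0 < complex.Im z -> M 0 z = ctrans mu (clamp B) z.
  move=> z0; have [_ h _] := M_burgers; rewrite h //.
  exact: (cauchy_integral_clamp x_bound mu_cvg z0).
split; first by move=> t; exact: (hull_bounded M_burgers mU UB M0E).
have B1 : 0 < B + 1 by rewrite addr_gt0.
exists ((B + 1) ^+ 2); split; first exact: exprn_gt0.
by move=> t /ltW tB; exact: (boundary_hull_curve M_burgers mU UB M0E tB).
Qed.
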